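(* Let $G=\{(z+w,zw):z,w\in\mathbb D\}$, let $\mathcal R=\{(2z,z^2):z\in\mathbb D\}$, so that $\mathcal R^-=\{(2z,z^2):|z|\le1\}$ and $\partial\mathcal R=\{(2z,z^2):|z|=1\}$. Let $\delta$ be a nondegenerate datum in $G$, let $\mathcal D_\delta$ be the unique complex geodesic in $G$ contacted by $\delta$, and let $E=\mathcal D_\delta^-\cap\mathcal R^-$ (closures in $\mathbb C^2$). Then (1) $E$ consists of two points, one lying in $\mathcal R$ and one lying in $\partial\mathcal R$, if and only if $\delta$ is purely unbalanced; (2) $E$ consists of a single point that lies in $\partial\mathcal R$ if and only if $\delta$ is exceptional; (3) $E$ consists of two points, both lying in $\partial\mathcal R$, if and only if $\delta$ is purely balanced; (4) $E$ consists of a single point that lies in $\mathcal R$ if and only if $\delta$ is flat; (5) $E=\mathcal R^-$ if and only if $\delta$ is royal.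
   Context: $\mathbb D$ is the open unit disc and $\mathbb T$ the unit circle in $\mathbb C$. A datum in a domain $U\subset\mathbb C^n$ is either a discrete datum $(x,y)$ with $x,y\in U$, or an infinitesimal datum $(x,v)$ with $x\in U$ and $v\in\mathbb C^n$ a tangent vector at $x$. It is nondegenerate if $x\ne y$ (discrete case) or $v\neq0$ (infinitesimal case). For a holomorphic map $F:U\to\Omega$ between domains, $F(\delta)=(F(x),F(y))$ in the discrete case and $F(\delta)=(F(x),D_vF(x))$ in the infinitesimal case, where $D_v$ is the directional derivative. The modulus of a datum in $\mathbb D$ is $|(z_1,z_2)|=\left|\frac{z_1-z_2}{1-\bar z_2z_1}\right|$ (discrete) and $|(z,c)|=\frac{|c|}{1-|z|^2}$ (infinitesimal). A holomorphic $C:G\to\mathbb D$ solves $\mathrm{Car}(\delta)$ if $|C(\delta)|=\sup\{|F(\delta)|: F:G\to\mathbb D\text{ holomorphic}\}$. For $\omega\in\mathbb T$, $\Phi_\omega(s,p)=\frac{2\omega p-s}{2-\omega s}$ for $(s,p)\in G$; it is a holomorphic map $G\to\mathbb D$. Put $\rho_\delta(\omega)=|\Phi_\omega(\delta)|^2$ for $\omega\in\mathbb T$. A nondegenerate datum $\delta$ in $G$ is: purely unbalanced if $\rho_\delta$ has a unique maximizer $\omega_0=e^{it_0}$ on $\mathbb T$ and $\frac{d^2}{dt^2}\rho_\delta(e^{it})|_{t=t_0}<0$; exceptional if $\rho_\delta$ has a unique maximizer $\omega_0=e^{it_0}$ on $\mathbb T$ and $\frac{d^2}{dt^2}\rho_\delta(e^{it})|_{t=t_0}=0$;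 purely balanced if $\rho_\delta$ has exactly two maximizers in $\mathbb T$; royal if $\rho_\delta$ is constant and $C(s,p)=\frac12 s$ solves $\mathrm{Car}(\delta)$; flat if $\rho_\delta$ is constant and $C(s,p)=p$ solves $\mathrm{Car}(\delta)$. A complex geodesic in $G$ is a set $k(\mathbb D)$ where $k:\mathbb D\to G$ is holomorphic and has a holomorphic left inverse $C:G\to\mathbb D$. A datum $\delta$ in $G$ contacts a set $V\subseteq G$ if either $\delta=(x,y)$ is discrete and $x,y\in V$, or $\delta=(x,v)$ is infinitesimal and either $v=0$ and $x\in V$, or there are sequences $(x_n),(y_n)$ in $V$ with $x_n\ne y_n$ for all $n$, $x_n\to x$, $y_n\to x$ and $\frac{y_n-x_n}{\|y_n-x_n\|}\to v_0$ for some unit vector $v_0$ collinear with $v$. Every nondegenerate datum $\delta$ in $G$ contacts a unique complex geodesic in $G$, denoted $\mathcal D_\delta$. *)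

(* Defs.v *)
From Stdlib Require Import Reals.
From Coquelicot Require Import Coquelicot.

Local Open Scope R_scope.

(** C^2 as a complex normed space; its [norm] is the Euclidean norm. *)
Definition C2 : NormedModule C_AbsRing :=
  prod_NormedModule C_AbsRing C_NormedModule C_NormedModule.

(** ** Domains, holomorphic maps and data *)

Definition disc (z : C) : Prop := Cmod z < 1.
Definition circle (z : C) : Prop := Cmod z = 1.

Definition symbidisc (x : C2) : Prop :=
  exists z w : C, disc z /\ disc w /\ x = ((z + w)%C, (z * w)%C).

(** Maps are total functions of which only the restriction to the domain
    matters.  The differential in [ex_filterdiff] is complex linear, since the
    scalars are [C_AbsRing]. *)
Definition holomorphic {V W : NormedModule C_AbsRing}
    (U : V -> Prop) (F : V -> W) : Prop :=
  forall x, U x -> ex_filterdiff F (locally x).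

Definition holomorphic_map {V W : NormedModule C_AbsRing}
    (U : V -> Prop) (Omega : W -> Prop) (F : V -> W) : Prop :=
  holomorphic U F /\ forall x, U x -> Omega (F x).

Inductive datum (V : Type) : Type :=
  | Discrete (x y : V)
  | Infinitesimal (x v : V).
Arguments Discrete {V} x y.
Arguments Infinitesimal {V} x v.

Definition datum_in {V : Type} (U : V -> Prop) (delta : datum V) : Prop :=
  match delta with
  | Discrete x y => U x /\ U y
  | Infinitesimal x _ => U x
  end.

Definition nondegenerate {V : NormedModule C_AbsRing} (delta : datum V) : Prop :=
  match delta with
  | Discrete x y => x <> y
  | Infinitesimal _ v => v <> zero
  end.

(** [C_derive] is total; it is the genuine directional derivative as soon as
    [F] is complex differentiable at [x] ([C_derive_correct]). *)
Definition push {V : NormedModule C_AbsRing} (F : V -> C) (delta : datum V)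
    : datum C :=
  match delta with
  | Discrete x y => Discrete (F x) (F y)
  | Infinitesimal x v =>
      Infinitesimal (F x) (C_derive (fun t : C => F (plus x (scal t v))) (RtoC 0))
  end.

Definition modulus (delta : datum C) : R :=
  match delta with
  | Discrete z1 z2 => Cmod ((z1 - z2) / (RtoC 1 - Cconj z2 * z1))%C
  | Infinitesimal z c => Cmod c / (1 - Cmod z ^ 2)
  end.

(** ** The Caratheodory extremal problem and the types of data in G *)

Definition solves_Car (delta : datum C2) (f : C2 -> C) : Prop :=
  holomorphic_map (W := C_NormedModule) symbidisc disc f /\
  is_lub
    (fun r : R => exists F : C2 -> C,
       holomorphic_map (W := C_NormedModule) symbidisc disc F /\
       r = modulus (push F delta))
    (modulus (push f delta)).

Definition Phi (omega : C) (x : C2) : C :=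
  let s : C := fst x in
  let p : C := snd x in
  ((RtoC 2 * omega * p - s) / (RtoC 2 - omega * s))%C.

Definition rho (delta : datum C2) (omega : C) : R :=
  modulus (push (Phi omega) delta) ^ 2.

Definition expi (t : R) : C := (cos t, sin t).

Definition maximizer (delta : datum C2) (omega : C) : Prop :=
  circle omega /\ forall omega', circle omega' -> rho delta omega' <= rho delta omega.

Definition rho_constant (delta : datum C2) : Prop :=
  forall omega omega', circle omega -> circle omega' ->
    rho delta omega = rho delta omega'.

Definition purely_unbalanced (delta : datum C2) : Prop :=
  exists t0 : R,
    (forall omega, maximizer delta omega <-> omega = expi t0) /\
    Derive_n (fun t => rho delta (expi t)) 2 t0 < 0.

Definition exceptional (delta : datum C2) : Prop :=
  exists t0 : R,
    (forall omega, maximizer delta omega <-> omega = expi t0) /\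
    Derive_n (fun t => rho delta (expi t)) 2 t0 = 0.

Definition purely_balanced (delta : datum C2) : Prop :=
  exists omega1 omega2 : C, omega1 <> omega2 /\
    forall omega, maximizer delta omega <-> omega = omega1 \/ omega = omega2.

Definition royal (delta : datum C2) : Prop :=
  rho_constant delta /\
  solves_Car delta (fun x : C2 => (fst x / RtoC 2)%C).

Definition flat (delta : datum C2) : Prop :=
  rho_constant delta /\ solves_Car delta (fun x : C2 => snd x).

(** ** Complex geodesics and contact *)

Definition complex_geodesic (D : C2 -> Prop) : Prop :=
  exists k : C -> C2,
    holomorphic_map (V := C_NormedModule) disc symbidisc k /\
    (exists f : C2 -> C,
       holomorphic_map (W := C_NormedModule) symbidisc disc f /\
       forall z, disc z -> f (k z) = z) /\
    forall x, D x <-> exists z, disc z /\ x = k z.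

(** Collinearity is over [C]; since [v0] is a unit vector, it amounts to [v]
    being a complex multiple of [v0]. *)
Definition contacts (delta : datum C2) (V : C2 -> Prop) : Prop :=
  match delta with
  | Discrete x y => V x /\ V y
  | Infinitesimal x v =>
      (v = zero /\ V x) \/
      exists (xn yn : nat -> C2) (v0 : C2),
        (forall n, V (xn n) /\ V (yn n) /\ xn n <> yn n) /\
        filterlim xn eventually (locally x) /\
        filterlim yn eventually (locally x) /\
        filterlim
          (fun n => scal (RtoC (/ norm (minus (yn n) (xn n))))
                         (minus (yn n) (xn n)))
          eventually (locally v0) /\
        norm v0 = 1 /\
        exists c : C, v = scal c v0
  end.

(** ** The royal variety *)

Definition closure (V : C2 -> Prop) (x : C2) : Prop :=
  forall eps : posreal, exists y, ball x eps y /\ V y.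

Definition royal_variety (x : C2) : Prop :=
  exists z : C, Cmod z < 1 /\ x = ((RtoC 2 * z)%C, (z * z)%C).

(** Not the topological boundary in C^2, but the image of the unit circle. *)
Definition royal_boundary (x : C2) : Prop :=
  exists z : C, Cmod z = 1 /\ x = ((RtoC 2 * z)%C, (z * z)%C).

(* Main.v *)
(** Rotate so that a maximizer of [rho] is 1.  In the coordinates
    [zeta = (1 - p) / (1 - s + p)] and [g = zeta^2 - (1 + s + p) / (1 - s + p)],
    [G] becomes [{Re zeta > 0, |g| + Re g < 2 (Re zeta)^2}], the royal variety
    becomes [g = 0], and the functions [Phi_omega] become, up to a Cayley
    transform, [zeta] (for [omega = 1]) and [zeta - g / (zeta - i t)] with [t] real.

    On a geodesic the maximal [Phi] is an automorphism of the disc, by the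
    equality case of the Schwarz lemma, so the geodesic is a graph over [zeta].
    The Schwarz-Pick inequality for all the other [Phi_omega], at every point,
    forces [Im g = Re zeta * Im g'], and hence
      [g = a zeta^2 + i b zeta - c],  [0 <= a <= 1],  [a t^2 + b t + c >= 0],
    with strict positivity when [a = 1].  The set [E] is then read off from the
    zeros of [g] in the closed half-plane, together with [zeta = infinity] when
    [a < 1].  An explicit formula for [rho] shows that the other maximizers
    correspond to the real zeros of [a t^2 + b t + c], and that the second
    derivative of [rho] at 1 is a negative multiple of [(1 - a) a].  The five
    types are: [0 < a < 1] with [b^2 < 4 a c] (purely unbalanced), [a = b = 0 < c]
    (exceptional), [0 < a < 1] with [b^2 = 4 a c] (purely balanced), [a = 1]
    (flat), [a = b = c = 0] (royal). *)

Require Import Defs.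
From Stdlib Require Import Reals Lra Lia ClassicalEpsilon.
From Coquelicot Require Import Coquelicot.

Local Open Scope R_scope.

(** A geodesic comes with an arbitrary left inverse [f], and nothing says at the outset that some
    Phi could serve instead. The equality case of the Schwarz lemma is reached through a comparison
    curve. At [k 0] the maximality of one Phi, in infinitesimal speed, over all the others forces an
    explicit quadratic curve inside [G] to be tangent to [k]; Schwarz-Pick for [f] along this curve
    bounds the speed of the maximal Phi from below by its largest possible value. The same algebra
    at every point of the graph gives the differential equation for [g]. Holomorphy is bare complex
    differentiability, so the Schwarz lemma is built from Goursat's argument on rectangles in polar
    coordinates, with circle means of [f z / z] in place of the maximum principle. On both sides the
    five alternatives exclude one another, so each coefficient case only has to exhibit its shape of
    [E] and its type of datum; both directions of the five equivalences follow. *)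

(** * Bisection of rectangles and Goursat's argument *)

(** [P x y n] is read as a property of the rectangle with lower left corner [(x, y)] and sides
    [h / 2 ^ n], [k / 2 ^ n]. If it failed at level 0, some quarter would fail at every level, and
    these nested rectangles shrink to a point [(p, q)] near which the local hypothesis makes it
    hold. *)
Lemma bisection_2d (P : R -> R -> nat -> Prop) (a c h k : R) :
  0 <= h -> 0 <= k ->
  (forall x y n,
     P x y (S n) -> P (x + h / 2 ^ S n) y (S n) ->
     P x (y + k / 2 ^ S n) (S n) ->
     P (x + h / 2 ^ S n) (y + k / 2 ^ S n) (S n) -> P x y n) ->
  (forall p q, a <= p <= a + h -> c <= q <= c + k ->
     exists d, 0 < d /\ forall x y n,
       a <= x -> x + h / 2 ^ n <= a + h -> c <= y -> y + k / 2 ^ n <= c + k ->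
       x <= p <= x + h / 2 ^ n -> y <= q <= y + k / 2 ^ n ->
       h / 2 ^ n < d -> k / 2 ^ n < d -> P x y n) ->
  P a c O.
Proof.
intros Hh Hk Hstep Hloc.
destruct (classic (P a c O)) as [Ha|Ha]; [exact Ha|exfalso].
(* A failing quarter is selected by testing three of them; if these are good, the fourth fails by
   [Hstep]. *)
pose (next := fun (n : nat) (s : R * R) =>
  let (x, y) := s in
  if excluded_middle_informative (P x y (S n)) then
  if excluded_middle_informative (P (x + h / 2 ^ S n) y (S n)) then
  if excluded_middle_informative (P x (y + k / 2 ^ S n) (S n)) then
    (x + h / 2 ^ S n, y + k / 2 ^ S n)
  else (x, y + k / 2 ^ S n)
  else (x + h / 2 ^ S n, y)
  else (x, y)).
pose (st := fix st n := match n with O => (a, c) | S n => next n (st n) end).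
assert (Hp : forall n, 0 < 2 ^ n) by (intros; apply pow_lt; lra).
assert (Hhn : forall n, 0 <= h / 2 ^ n).
{ intros n. apply Rmult_le_pos; [lra|]. left. apply Rinv_0_lt_compat, Hp. }
assert (Hkn : forall n, 0 <= k / 2 ^ n).
{ intros n. apply Rmult_le_pos; [lra|]. left. apply Rinv_0_lt_compat, Hp. }
assert (Hh2 : forall n, h / 2 ^ n = h / 2 ^ S n + h / 2 ^ S n).
{ intros n. simpl. field. apply Rgt_not_eq, Hp. }
assert (Hk2 : forall n, k / 2 ^ n = k / 2 ^ S n + k / 2 ^ S n).
{ intros n. simpl. field. apply Rgt_not_eq, Hp. }
assert (Hbad : forall n, ~ P (fst (st n)) (snd (st n)) n).
{ induction n as [|n IH]; [exact Ha|].
  change (st (S n)) with (next n (st n)).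
  destruct (st n) as [x y]. cbn [fst snd] in *.
  unfold next.
  repeat destruct excluded_middle_informative; cbn [fst snd]; auto. }
assert (Hone : forall n,
  fst (st n) <= fst (st (S n)) /\
  fst (st (S n)) + h / 2 ^ S n <= fst (st n) + h / 2 ^ n /\
  snd (st n) <= snd (st (S n)) /\
  snd (st (S n)) + k / 2 ^ S n <= snd (st n) + k / 2 ^ n).
{ intros n. change (st (S n)) with (next n (st n)).
  destruct (st n) as [x y]. unfold next.
  specialize (Hh2 n). specialize (Hk2 n).
  generalize (Hhn (S n)) (Hkn (S n)); intros.
  repeat destruct excluded_middle_informative; cbn [fst snd]; repeat split; lra. }
assert (Hmono : forall n m,
  fst (st n) <= fst (st (m + n)%nat) /\
  fst (st (m + n)%nat) + h / 2 ^ (m + n) <= fst (st n) + h / 2 ^ n /\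
  snd (st n) <= snd (st (m + n)%nat) /\
  snd (st (m + n)%nat) + k / 2 ^ (m + n) <= snd (st n) + k / 2 ^ n).
{ intros n m. induction m as [|m IH]; [cbn [Nat.add]; repeat split; lra|].
  specialize (Hone (m + n)%nat). cbn [Nat.add]. repeat split; lra. }
assert (Hcross : forall n m,
  fst (st n) <= fst (st m) + h / 2 ^ m /\ snd (st n) <= snd (st m) + k / 2 ^ m).
{ intros n m. destruct (Nat.le_ge_cases n m) as [Hl|Hl].
  - specialize (Hmono n (m - n)%nat).
    replace (m - n + n)%nat with m in Hmono by lia.
    specialize (Hhn m); specialize (Hkn m); split; lra.
  - specialize (Hmono m (n - m)%nat).
    replace (n - m + m)%nat with n in Hmono by lia.
    specialize (Hhn n); specialize (Hkn n); split; lra. }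
assert (Hlub : forall (z : nat -> R) (w : nat -> R), (forall n m, z n <= w m) ->
  exists p, forall n, z n <= p <= w n).
{ intros z w Hzw.
  destruct (completeness (fun r => exists n, r = z n)) as [p [Hp1 Hp2]].
  - exists (w O). intros r [n ->]. apply Hzw.
  - exists (z O). now exists O.
  - exists p. intros n. split; [apply Hp1; now exists n|].
    apply Hp2. intros r [m ->]. apply Hzw. }
destruct (Hlub (fun n => fst (st n)) (fun n => fst (st n) + h / 2 ^ n)) as [p Hpp].
{ intros n m. apply Hcross. }
destruct (Hlub (fun n => snd (st n)) (fun n => snd (st n) + k / 2 ^ n)) as [q Hqq].
{ intros n m. apply Hcross. }
cbv beta in Hpp, Hqq.
destruct (Hloc p q) as [d [Hd HP]].
{ generalize (Hpp O). simpl. lra. }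
{ generalize (Hqq O). simpl. lra. }
(* With [1 / 2 ^ n < d / (h + k + 1)] both sides fall below [d]; the added 1 keeps the denominator
   positive when [h = k = 0]. *)
destruct (pow_lt_1_zero (/ 2)) with (y := d / (h + k + 1)) as [n Hn].
{ rewrite Rabs_pos_eq; lra. }
{ apply Rdiv_lt_0_compat; lra. }
specialize (Hn n (le_n n)).
rewrite pow_inv, Rabs_pos_eq in Hn by (left; apply Rinv_0_lt_compat, Hp).
apply (Rmult_lt_compat_r (h + k + 1)) in Hn; [|lra].
unfold Rdiv in Hn. rewrite (Rmult_assoc d), Rinv_l, Rmult_1_r in Hn by lra.
assert (0 < / 2 ^ n) by apply Rinv_0_lt_compat, Hp.
apply (Hbad n). apply HP; try (apply Hpp || apply Hqq).
- generalize (Hmono O n). rewrite Nat.add_0_r. simpl. lra.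
- generalize (Hmono O n). rewrite Nat.add_0_r. simpl. lra.
- generalize (Hmono O n). rewrite Nat.add_0_r. simpl. lra.
- generalize (Hmono O n). rewrite Nat.add_0_r. simpl. lra.
- unfold Rdiv; nra.
- unfold Rdiv; nra.
Qed.

Lemma Rabs_small_zero (x M : R) : (forall eps, 0 < eps -> Rabs x <= eps * M) -> x = 0.
Proof.
intros H. destruct (Req_dec x 0) as [E|E]; [exact E|exfalso].
apply Rabs_pos_lt in E. assert (HM := Rabs_pos M). assert (HM2 := Rle_abs M).
assert (H1 : 0 < Rabs x / (2 * (Rabs M + 1))) by (apply Rdiv_lt_0_compat; lra).
specialize (H _ H1).
assert (Hq : Rabs x / (2 * (Rabs M + 1)) * (Rabs M + 1) = Rabs x / 2) by (field; lra).
nra.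
Qed.

Lemma RInt_diff_bound (f g : R -> R) (s w m e : R) : 0 <= w ->
  ex_RInt f s (s + w) -> ex_RInt g s (s + w) ->
  (forall t, s <= t <= s + w -> Rabs (f t - g t - m) <= e) ->
  Rabs (RInt f s (s + w) - RInt g s (s + w) - w * m) <= w * e.
Proof.
intros Hw Hf Hg H.
assert (Hfg := ex_RInt_minus f g s (s + w) Hf Hg).
assert (E : RInt (fun t => minus (minus (f t) (g t)) m) s (s + w) =
  RInt f s (s + w) - RInt g s (s + w) - w * m).
{ rewrite (RInt_minus (fun t => minus (f t) (g t)) (fun _ => m)); [|exact Hfg|apply ex_RInt_const].
  rewrite (RInt_minus f g), RInt_const by assumption.
  unfold minus, plus, opp, scal; simpl. unfold mult; simpl. ring. }
rewrite <- E. replace (w * e) with ((s + w - s) * e) by ring.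
apply abs_RInt_le_const; [lra|apply @ex_RInt_minus; [exact Hfg|apply @ex_RInt_const]|].
exact H.
Qed.

Section Green.
Variables u v : R -> R -> R.

(** The integral of [v dx + u dy] counterclockwise around the rectangle. *)
Definition form_defect (x y h k : R) : R :=
  (RInt (u (x + h)) y (y + k) - RInt (u x) y (y + k)) -
  (RInt (fun t => v t (y + k)) x (x + h) - RInt (fun t => v t y) x (x + h)).

Definition closed_at (x y : R) : Prop :=
  exists l m m', differentiable_pt_lim u x y l m /\
                 differentiable_pt_lim v x y m' l.

Lemma continuous_differentiable_pt_lim_1 (w : R -> R -> R) x y lx ly :
  differentiable_pt_lim w x y lx ly -> continuous (fun t => w t y) x.
Proof.
intros H. apply (ex_derive_continuous (fun t => w t y)).
exists lx. apply is_derive_Reals.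
replace lx with (lx * 1 + ly * 0) by ring.
apply (derivable_pt_lim_comp_2d w (fun t => t) (fun _ => y) x); auto.
- apply derivable_pt_lim_id.
- apply derivable_pt_lim_const.
Qed.

Lemma continuous_differentiable_pt_lim_2 (w : R -> R -> R) x y lx ly :
  differentiable_pt_lim w x y lx ly -> continuous (w x) y.
Proof.
intros H. apply (ex_derive_continuous (w x)).
exists ly. apply is_derive_Reals.
replace ly with (lx * 0 + ly * 1) by ring.
apply (derivable_pt_lim_comp_2d w (fun _ => x) (fun t => t) y); auto.
- apply derivable_pt_lim_const.
- apply derivable_pt_lim_id.
Qed.

(* Goursat's argument for the form [v dx + u dy]: no continuity of the partial
   derivatives is assumed. *)
Lemma green_zero (a c h k : R) :
  0 <= h -> 0 <= k ->
  (forall x y, a <= x <= a + h -> c <= y <= c + k -> closed_at x y) ->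
  form_defect a c h k = 0.
Proof.
intros Hh Hk Hcl.
assert (Hu : forall x y1 y2, a <= x <= a + h -> c <= y1 -> y1 <= y2 -> y2 <= c + k ->
   ex_RInt (u x) y1 y2).
{ intros x y1 y2 Hx H1 H2 H3. apply (ex_RInt_continuous (u x)).
  intros z Hz. rewrite Rmin_left, Rmax_right in Hz by lra.
  destruct (Hcl x z) as (l & m & m' & D1 & D2); [lra|lra|].
  eapply continuous_differentiable_pt_lim_2, D1. }
assert (Hv : forall y x1 x2, c <= y <= c + k -> a <= x1 -> x1 <= x2 -> x2 <= a + h ->
   ex_RInt (fun t => v t y) x1 x2).
{ intros y x1 x2 Hx H1 H2 H3. apply (ex_RInt_continuous (fun t => v t y)).
  intros z Hz. rewrite Rmin_left, Rmax_right in Hz by lra.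
  destruct (Hcl z y) as (l & m & m' & D1 & D2); [lra|lra|].
  eapply continuous_differentiable_pt_lim_1, D2. }
assert (Hp : forall n, 0 < / 2 ^ n).
{ intros; apply Rinv_0_lt_compat, pow_lt; lra. }
assert (Hp2 : forall n, / 2 ^ n = / 2 ^ S n + / 2 ^ S n).
{ intros n. simpl. field. apply pow_nonzero; lra. }
apply (Rabs_small_zero _ (2 * (h + k) ^ 2)).
intros eps Heps.
(* The bound is quadratic in the sides, so the bounds of the four quarters add up to the bound of
   the whole. *)
pose (P := fun x y n =>
  a <= x -> x + h / 2 ^ n <= a + h -> c <= y -> y + k / 2 ^ n <= c + k ->
  Rabs (form_defect x y (h / 2 ^ n) (k / 2 ^ n)) <= eps * (2 * (h / 2 ^ n + k / 2 ^ n) ^ 2)).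
assert (HP0 : P a c O).
{ apply (bisection_2d P a c h k Hh Hk).
  - intros x y n P1 P2 P3 P4 Hx1 Hx2 Hy1 Hy2.
    unfold P in P1, P2, P3, P4.
    replace (h / 2 ^ n) with (h / 2 ^ S n + h / 2 ^ S n) in *
      by (unfold Rdiv; rewrite (Hp2 n); ring).
    replace (k / 2 ^ n) with (k / 2 ^ S n + k / 2 ^ S n) in *
      by (unfold Rdiv; rewrite (Hp2 n); ring).
    assert (h0 : 0 <= h / 2 ^ S n) by (apply Rmult_le_pos; [lra|left; apply Hp]).
    assert (k0 : 0 <= k / 2 ^ S n) by (apply Rmult_le_pos; [lra|left; apply Hp]).
    set (h' := h / 2 ^ S n) in *. set (k' := k / 2 ^ S n) in *.
    specialize (P1 ltac:(lra) ltac:(lra) ltac:(lra) ltac:(lra)).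
    specialize (P2 ltac:(lra) ltac:(lra) ltac:(lra) ltac:(lra)).
    specialize (P3 ltac:(lra) ltac:(lra) ltac:(lra) ltac:(lra)).
    specialize (P4 ltac:(lra) ltac:(lra) ltac:(lra) ltac:(lra)).
    assert (E : form_defect x y (h' + h') (k' + k') =
      form_defect x y h' k' + form_defect (x + h') y h' k' +
      form_defect x (y + k') h' k' + form_defect (x + h') (y + k') h' k').
    { unfold form_defect.
      rewrite <- !Rplus_assoc.
      rewrite <- (RInt_Chasles (u (x + h' + h')) y (y + k') (y + k' + k')) by (apply Hu; lra).
      rewrite <- (RInt_Chasles (u x) y (y + k') (y + k' + k')) by (apply Hu; lra).
      rewrite <- (RInt_Chasles (fun t => v t (y + k' + k')) x (x + h') (x + h' + h')) by (apply Hv; lra).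
      rewrite <- (RInt_Chasles (fun t => v t y) x (x + h') (x + h' + h')) by (apply Hv; lra).
      unfold plus; simpl. ring. }
    rewrite E.
    eapply Rle_trans; [apply Rabs_triang|].
    eapply Rle_trans; [apply Rplus_le_compat_r, Rabs_triang|].
    eapply Rle_trans; [apply Rplus_le_compat_r, Rplus_le_compat_r, Rabs_triang|].
    nra.
  - intros p q Hpa Hqa.
    destruct (Hcl p q Hpa Hqa) as (l & m & m' & D1 & D2).
    destruct (D1 (mkposreal _ (Rdiv_lt_0_compat _ _ Heps Rlt_0_2))) as [d1 E1].
    destruct (D2 (mkposreal _ (Rdiv_lt_0_compat _ _ Heps Rlt_0_2))) as [d2 E2].
    simpl in E1, E2.
    exists (Rmin d1 d2). split; [apply Rmin_pos; [apply d1|apply d2]|].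
    intros x y n Hx1 Hx2 Hy1 Hy2 Hpx Hqy Hs1 Hs2 _ _ _ _.
    assert (h0 : 0 <= h / 2 ^ n) by (apply Rmult_le_pos; [lra|left; apply Hp]).
    assert (k0 : 0 <= k / 2 ^ n) by (apply Rmult_le_pos; [lra|left; apply Hp]).
    set (h' := h / 2 ^ n) in *. set (k' := k / 2 ^ n) in *.
    assert (Hd1 : Rmin d1 d2 <= d1) by apply Rmin_l.
    assert (Hd2 : Rmin d1 d2 <= d2) by apply Rmin_r.
    assert (U : forall s t, x <= s <= x + h' -> y <= t <= y + k' ->
      Rabs (u s t - u p q - (l * (s - p) + m * (t - q))) <= eps / 2 * (h' + k')).
    { intros s t Hs Ht. eapply Rle_trans.
      - apply E1; apply Rabs_def1; lra.
      - apply Rmult_le_compat_l; [lra|].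
        apply Rmax_lub; apply Rabs_le; lra. }
    assert (V : forall s t, x <= s <= x + h' -> y <= t <= y + k' ->
      Rabs (v s t - v p q - (m' * (s - p) + l * (t - q))) <= eps / 2 * (h' + k')).
    { intros s t Hs Ht. eapply Rle_trans.
      - apply E2; apply Rabs_def1; lra.
      - apply Rmult_le_compat_l; [lra|].
        apply Rmax_lub; apply Rabs_le; lra. }
    (* The affine parts of [u] and [v] at [(p, q)] contribute [l * h' * k'] to each of the two
       differences of integrals; closedness makes these equal, and only the error terms remain. *)
    assert (IU : Rabs (RInt (u (x + h')) y (y + k') - RInt (u x) y (y + k') - k' * (l * h'))
       <= k' * (eps * (h' + k'))).
    { apply RInt_diff_bound; [lra|apply Hu; lra|apply Hu; lra|]. intros t Ht.
      generalize (U (x + h') t ltac:(lra) ltac:(lra)) (U x t ltac:(lra) ltac:(lra)).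
      rewrite !Rabs_le_between. lra. }
    assert (IV : Rabs (RInt (fun t => v t (y + k')) x (x + h') - RInt (fun t => v t y) x (x + h')
       - h' * (l * k')) <= h' * (eps * (h' + k'))).
    { apply (RInt_diff_bound (fun t => v t (y + k')) (fun t => v t y));
        [lra|apply Hv; lra|apply Hv; lra|]. intros t Ht.
      generalize (V t (y + k') ltac:(lra) ltac:(lra)) (V t y ltac:(lra) ltac:(lra)).
      rewrite !Rabs_le_between. lra. }
    unfold form_defect.
    apply Rabs_le_between in IU. apply Rabs_le_between in IV.
    apply Rabs_le. nra. }
unfold P in HP0. simpl in HP0. rewrite !Rdiv_1_r in HP0.
apply HP0; lra.
Qed.
End Green.

(** * Complex derivatives in one variable *)

(** The codomain carries the [Cmod] balls of [AbsRing_NormedModule], where the product rule is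
    stated, while [C_NormedModule] carries the product uniform structure. [cderiv_is_derive] and
    [cderiv_filterdiff] pass between the two. *)
Definition cderiv (f : C -> C) (z l : C) : Prop :=
  @is_derive C_AbsRing (AbsRing_NormedModule C_AbsRing) f z l.

Lemma cderiv_eps (f : C -> C) (z l : C) :
  cderiv f z l <->
  forall eps, 0 < eps -> exists d, 0 < d /\ forall w, Cmod (w - z) < d ->
    Cmod (f w - f z - (w - z) * l) <= eps * Cmod (w - z).
Proof.
split.
- intros [_ H] eps Heps.
  destruct (H z (fun P HP => HP) (mkposreal eps Heps)) as [d Hd].
  exists d. split; [apply d|]. intros w Hw. apply (Hd w). exact Hw.
- intros H. split; [apply is_linear_scal_l|].
  intros x Hx eps.
  apply (is_filter_lim_locally_unique (K := C_AbsRing)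
           (V := AbsRing_NormedModule C_AbsRing)) in Hx. subst x.
  destruct (H eps (cond_pos eps)) as [d [Hd0 Hd]].
  exists (mkposreal d Hd0). intros w Hw. apply (Hd w). exact Hw.
Qed.

Lemma cderiv_is_derive (f : C -> C) (z l : C) :
  cderiv f z l <-> @is_derive C_AbsRing C_NormedModule f z l.
Proof.
split; intros [_ H]; (split; [apply @is_linear_scal_l|exact H]).
Qed.

Lemma cderiv_const (a z : C) : cderiv (fun _ => a) z (RtoC 0).
Proof. apply @is_derive_const. Qed.

Lemma cderiv_id (z : C) : cderiv (fun w => w) z (RtoC 1).
Proof. apply @is_derive_id. Qed.

Lemma cderiv_plus (f g : C -> C) (z l m : C) :
  cderiv f z l -> cderiv g z m -> cderiv (fun w => f w + g w)%C z (l + m)%C.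
Proof. apply @is_derive_plus. Qed.

Lemma cderiv_minus (f g : C -> C) (z l m : C) :
  cderiv f z l -> cderiv g z m -> cderiv (fun w => f w - g w)%C z (l - m)%C.
Proof. apply @is_derive_minus. Qed.

Lemma cderiv_mult (f g : C -> C) (z l m : C) :
  cderiv f z l -> cderiv g z m ->
  cderiv (fun w => f w * g w)%C z (l * g z + f z * m)%C.
Proof. intros Hf Hg. apply @is_derive_mult; auto. exact Cmult_comm. Qed.

Lemma cderiv_comp (f g : C -> C) (z l m : C) :
  cderiv f (g z) l -> cderiv g z m -> cderiv (fun w => f (g w)) z (m * l)%C.
Proof. intros Hf Hg. apply @is_derive_comp; auto. Qed.

Lemma cderiv_ext (f g : C -> C) (z l : C) :
  (forall w, f w = g w) -> cderiv f z l -> cderiv g z l.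
Proof. exact (@is_derive_ext C_AbsRing (AbsRing_NormedModule C_AbsRing) f g z l). Qed.

Lemma cderiv_ext_loc (f g : C -> C) (z l : C) :
  (exists d, 0 < d /\ forall w, Cmod (w - z) < d -> f w = g w) ->
  cderiv f z l -> cderiv g z l.
Proof.
intros [d [Hd H]].
apply (@is_derive_ext_loc C_AbsRing (AbsRing_NormedModule C_AbsRing) f g z l).
exists (mkposreal d Hd). intros w Hw. apply H. exact Hw.
Qed.

Lemma Cmod_triangle_rev (x y : C) : Cmod x - Cmod y <= Cmod (x - y).
Proof.
generalize (Cmod_triangle (x - y) y).
replace (x - y + y)%C with x by ring. lra.
Qed.

Lemma cderiv_inv_id (z : C) : z <> RtoC 0 -> cderiv (fun w => / w)%C z (- / (z * z))%C.
Proof.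
intros Hz. assert (Hz' := Hz). rewrite cderiv_eps. intros eps Heps.
apply Cmod_gt_0 in Hz. set (M := Cmod z) in *.
assert (HM : 0 < M * (M * M)) by (repeat apply Rmult_lt_0_compat; auto).
exists (Rmin (M / 2) (eps * (M * (M * M)) / 2)). split.
- apply Rmin_pos; [lra|]. apply Rdiv_lt_0_compat; [|lra]. now apply Rmult_lt_0_compat.
- intros w Hw.
  assert (Hw1 := Rlt_le_trans _ _ _ Hw (Rmin_l _ _)).
  assert (Hw2 := Rlt_le_trans _ _ _ Hw (Rmin_r _ _)).
  assert (Hwm : M / 2 < Cmod w).
  { generalize (Cmod_triangle_rev z (z - w)).
    replace (z - (z - w))%C with w by ring.
    replace (z - w)%C with (- (w - z))%C by ring. rewrite Cmod_opp. fold M. lra. }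
  assert (Hw0 : w <> RtoC 0) by (apply Cmod_gt_0; lra).
  replace (/ w - / z - (w - z) * - / (z * z))%C
    with ((w - z) * ((w - z) / (w * (z * z))))%C by (field; auto).
  rewrite Cmod_mult, (Rmult_comm eps).
  apply Rmult_le_compat_l; [apply Cmod_ge_0|].
  assert (Hn : (w * (z * z))%C <> RtoC 0) by (repeat apply Cmult_neq_0; auto).
  rewrite Cmod_div by auto. rewrite !Cmod_mult. fold M.
  apply Rmult_le_reg_r with (Cmod w * (M * M)).
  + apply Rmult_lt_0_compat; nra.
  + unfold Rdiv. rewrite Rmult_assoc, Rinv_l by (apply Rgt_not_eq, Rmult_lt_0_compat; nra).
    rewrite Rmult_1_r.
    assert (eps * (M / 2 * (M * M)) <= eps * (Cmod w * (M * M))).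
    { apply Rmult_le_compat_l; [lra|]. apply Rmult_le_compat_r; nra. }
    lra.
Qed.

Lemma cderiv_inv (f : C -> C) (z l : C) : f z <> RtoC 0 -> cderiv f z l ->
  cderiv (fun w => / f w)%C z (- l / (f z * f z))%C.
Proof.
intros Hz Hf.
replace (- l / (f z * f z))%C with (l * - / (f z * f z))%C
  by (field; auto).
apply (cderiv_comp (fun w => / w)%C); auto. now apply cderiv_inv_id.
Qed.

Lemma cderiv_div (f g : C -> C) (z l m : C) : g z <> RtoC 0 ->
  cderiv f z l -> cderiv g z m ->
  cderiv (fun w => f w / g w)%C z ((l * g z - f z * m) / (g z * g z))%C.
Proof.
intros Hz Hf Hg.
replace ((l * g z - f z * m) / (g z * g z))%C
  with (l * / g z + f z * (- m / (g z * g z)))%C by (field; auto).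
apply (cderiv_mult f (fun w => / g w)%C); auto. now apply cderiv_inv.
Qed.

Lemma cderiv_scal (c : C) (f : C -> C) (z l : C) :
  cderiv f z l -> cderiv (fun w => c * f w)%C z (c * l)%C.
Proof.
intros H. replace (c * l)%C with (RtoC 0 * f z + c * l)%C by ring.
apply (cderiv_mult (fun _ => c) f); auto. apply cderiv_const.
Qed.

Lemma cderiv_eq (f : C -> C) (z l m : C) : cderiv f z l -> l = m -> cderiv f z m.
Proof. now intros H <-. Qed.

Create HintDb cderiv.

Ltac cderiv_tac :=
  lazymatch goal with
  | |- cderiv (fun _ => ?k) _ _ => apply cderiv_const
  | |- cderiv (fun w => w) _ _ => apply cderiv_id
  | |- cderiv (fun w => @?f w + @?g w)%C _ _ => eapply (cderiv_plus f g); cderiv_tac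
  | |- cderiv (fun w => @?f w - @?g w)%C _ _ => eapply (cderiv_minus f g); cderiv_tac
  | |- cderiv (fun w => @?f w * @?g w)%C _ _ =>
      lazymatch f with
      | fun _ => ?c => eapply (cderiv_scal c g)
      | _ => eapply (cderiv_mult f g)
      end; cderiv_tac
  | |- cderiv (fun w => @?f w / @?g w)%C _ _ =>
      eapply (cderiv_div f g); [auto|cderiv_tac|cderiv_tac]
  | _ => eauto with cderiv
  end.

Lemma cderiv_C_derive (f : C -> C) (z l : C) : cderiv f z l -> C_derive f z = l.
Proof. intros H. apply is_C_derive_unique. now apply cderiv_is_derive. Qed.

Lemma cderiv_unique (f : C -> C) (z l m : C) :
  cderiv f z l -> cderiv f z m -> l = m.
Proof.
intros H1 H2. apply cderiv_C_derive in H1, H2. congruence.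
Qed.

(** * Mean value property and the Schwarz lemma *)

(** The Cauchy-Riemann equations together with total real differentiability, the form that
    [closed_at] asks for. *)
Lemma cderiv_re_im (f : C -> C) (x y : R) (l : C) : cderiv f (x, y) l ->
  differentiable_pt_lim (fun a b => fst (f (a, b))) x y (fst l) (- snd l) /\
  differentiable_pt_lim (fun a b => snd (f (a, b))) x y (snd l) (fst l).
Proof.
intros H. rewrite cderiv_eps in H.
assert (Hs : 0 < sqrt 2) by (apply sqrt_lt_R0; lra).
assert (Hs2 : sqrt 2 * sqrt 2 = 2) by (apply sqrt_sqrt; lra).
assert (Hs3 : sqrt 2 < 2) by nra.
split; intros eps.
all: destruct (H (eps / 2)) as [d [Hd H1]]; [generalize (cond_pos eps); lra|].
all: assert (Hd2 : 0 < d / 2) by lra; exists (mkposreal _ Hd2); intros u v Hu Hv; simpl in Hu, Hv.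
all: assert (Hm := Cmod_2Rmax ((u, v) - (x, y))%C); change (fst ((u, v) - (x, y))%C) with (u + - x) in Hm; change (snd ((u, v) - (x, y))%C) with (v + - y) in Hm.
all: assert (Hmax : Rmax (Rabs (u + - x)) (Rabs (v + - y)) < d / 2) by (apply Rmax_lub_lt; auto).
all: assert (0 <= Rmax (Rabs (u + - x)) (Rabs (v + - y))) by (eapply Rle_trans; [apply Rabs_pos|apply Rmax_l]).
all: assert (Hlt : Cmod ((u, v) - (x, y)) < d) by (eapply Rle_lt_trans; [exact Hm|]; generalize dependent (Rmax (Rabs (u + - x)) (Rabs (v + - y))); intros; nra).
all: specialize (H1 (u, v) Hlt).
all: assert (Hfin : eps / 2 * Cmod ((u, v) - (x, y)) <= eps * Rmax (Rabs (u + - x)) (Rabs (v + - y)))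
  by (generalize (cond_pos eps); generalize dependent (Cmod ((u, v) - (x, y))); generalize dependent (Rmax (Rabs (u + - x)) (Rabs (v + - y))); intros M; intros; assert (sqrt 2 * M <= 2 * M) by nra; nra).
all: generalize (Rmax_Cmod (f (u, v) - f (x, y) - ((u, v) - (x, y)) * l)%C); intros Hmc.
- apply Rle_trans with (Rabs (fst (f (u, v) - f (x, y) - ((u, v) - (x, y)) * l)%C)).
  + right. f_equal. simpl. ring.
  + eapply Rle_trans; [apply Rmax_l|]. eapply Rle_trans; [exact Hmc|].
    eapply Rle_trans; [exact H1|]. exact Hfin.
- apply Rle_trans with (Rabs (snd (f (u, v) - f (x, y) - ((u, v) - (x, y)) * l)%C)).
  + right. f_equal. simpl. ring.
  + eapply Rle_trans; [apply Rmax_r|]. eapply Rle_trans; [exact Hmc|].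
    eapply Rle_trans; [exact H1|]. exact Hfin.
Qed.

Lemma differentiable_pt_lim_of_derive (f : R -> R -> R) x y a b :
  locally_2d (fun u v => is_derive (fun t => f t v) u (a u v)) x y ->
  is_derive (fun t => f x t) y b ->
  continuous (fun p : R * R => a (fst p) (snd p)) (x, y) ->
  differentiable_pt_lim f x y (a x y) b.
Proof.
intros H1 H2 H3. apply filterdiff_differentiable_pt_lim.
refine (is_derive_filterdiff f x y a b _ H2 H3).
apply locally_2d_locally in H1. exact H1.
Qed.

Lemma continuous_fst_comp (h : R -> R) (p : R * R) :
  continuous h (fst p) -> continuous (fun q : R * R => h (fst q)) p.
Proof. intros H. apply (continuous_comp fst h); auto. apply continuous_fst. Qed.

Lemma continuous_snd_comp (h : R -> R) (p : R * R) :
  continuous h (snd p) -> continuous (fun q : R * R => h (snd q)) p.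
Proof. intros H. apply (continuous_comp snd h); auto. apply continuous_snd. Qed.

Lemma differentiable_pt_lim_prod (h k : R -> R) x y dh dk :
  locally x (fun z => is_derive h z (dh z)) -> continuous dh x ->
  is_derive k y dk ->
  differentiable_pt_lim (fun a b => h a * k b) x y (dh x * k y) (h x * dk).
Proof.
intros H1 H2 H3.
apply (differentiable_pt_lim_of_derive _ x y (fun a b => dh a * k b)).
- apply locally_2d_locally. destruct H1 as [d Hd]. exists d. intros [u v] [Hu _].
  simpl in *. specialize (Hd u Hu).
  replace (dh u * k v) with (dh u * k v + h u * 0) by ring.
  apply (Derive.is_derive_mult h (fun _ => k v)); [exact Hd|apply @is_derive_const].
- apply @is_derive_scal. exact H3.
- apply (continuous_mult (fun q : R * R => dh (fst q)) (fun q : R * R => k (snd q))).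
  + apply continuous_fst_comp; exact H2.
  + apply continuous_snd_comp. apply (ex_derive_continuous k). now exists dk.
Qed.

Definition polar (r t : R) : C := (r * cos t, r * sin t).

Lemma Cmod_polar r t : 0 <= r -> Cmod (polar r t) = r.
Proof.
intros Hr. unfold Cmod, polar. simpl fst; simpl snd.
replace ((r * cos t) ^ 2 + (r * sin t) ^ 2) with (r ^ 2 * (Rsqr (sin t) + Rsqr (cos t)))
  by (unfold Rsqr; ring).
rewrite sin2_cos2, Rmult_1_r. now apply sqrt_pow2.
Qed.

(** In polar coordinates the Cauchy-Riemann equations say that [Re f] differentiated in [r] equals
    [Im f / r] differentiated in [t]. So the form built on these two functions is closed on
    [[r1, r2] x [0, 2 PI]], and the sides [t = 0] and [t = 2 PI] cancel by periodicity. The centre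
    is left out, since the lemma is meant for [f z / z]. *)
Lemma polar_real_part_invariant (f : C -> C) (R0 r1 r2 : R) :
  0 < r1 -> r1 <= r2 -> r2 < R0 ->
  (forall z, 0 < Cmod z < R0 -> exists l, cderiv f z l) ->
  RInt (fun t => fst (f (polar r1 t))) 0 (2 * PI) =
  RInt (fun t => fst (f (polar r2 t))) 0 (2 * PI).
Proof.
intros H1 H12 H2 Hf.
pose (u := fun r t => fst (f (polar r t))).
pose (v := fun r t => snd (f (polar r t)) * / r).
assert (Hpi := PI_RGT_0).
assert (G : form_defect u v r1 0 (r2 - r1) (2 * PI) = 0).
{ apply green_zero; [lra|lra|]. intros r t Hr _.
  destruct (Hf (polar r t)) as [l Hl]; [rewrite Cmod_polar; lra|].
  destruct (cderiv_re_im f _ _ l Hl) as [Du Dv].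
  assert (Dc : differentiable_pt_lim (fun a b => a * cos b) r t (1 * cos t) (r * - sin t)).
  { apply (differentiable_pt_lim_prod (fun a => a) cos r t (fun _ => 1)).
    - apply filter_forall. intros x. apply @is_derive_id.
    - apply continuous_const.
    - auto_derive; auto. ring. }
  assert (Ds : differentiable_pt_lim (fun a b => a * sin b) r t (1 * sin t) (r * cos t)).
  { apply (differentiable_pt_lim_prod (fun a => a) sin r t (fun _ => 1)).
    - apply filter_forall. intros x. apply @is_derive_id.
    - apply continuous_const.
    - auto_derive; auto. ring. }
  assert (DU := differentiable_pt_lim_comp _ _ _ _ _ _ _ _ _ _ _ Du Dc Ds).
  assert (DV := differentiable_pt_lim_comp _ _ _ _ _ _ _ _ _ _ _ Dv Dc Ds).
  assert (Di : differentiable_pt_lim (fun a _ => / a * 1) r t (- / r ^ 2 * 1) (/ r * 0)).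
  { apply (differentiable_pt_lim_prod (fun a => / a) (fun _ => 1) r t (fun a => - / a ^ 2)).
    - assert (Hr2 : 0 < r / 2) by lra.
      exists (mkposreal _ Hr2). intros x Hx. apply Rabs_lt_between in Hx; simpl in Hx.
      unfold minus, plus, opp in Hx; simpl in Hx.
      auto_derive; [lra|]. field. lra.
    - apply (ex_derive_continuous (fun a => - / a ^ 2)). auto_derive.
      apply Rgt_not_eq. nra.
    - apply @is_derive_const. }
  assert (Dm : differentiable_pt_lim (fun a b => a * b)
     (snd (f (r * cos t, r * sin t))) (/ r * 1) (1 * (/ r * 1)) (snd (f (r * cos t, r * sin t)) * 1)).
  { apply (differentiable_pt_lim_prod (fun a => a) (fun a => a) _ _ (fun _ => 1)).
    - apply filter_forall. intros x. apply @is_derive_id.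
    - apply continuous_const.
    - apply @is_derive_id. }
  assert (DW := differentiable_pt_lim_comp _ _ _ _ _ _ _ _ _ _ _ Dm DV Di).
  assert (Hr0 : r <> 0) by lra.
  eexists _, _, _. split; [exact DU|].
  match type of DW with differentiable_pt_lim _ _ _ ?A ?B =>
    match type of DU with differentiable_pt_lim _ _ _ ?A' ?B' =>
    replace A' with B by (field; exact Hr0) end end.
  refine (differentiable_pt_lim_ext _ _ _ _ _ _ _ DW).
  apply locally_2d_forall. intros a b. unfold v, polar. ring. }
unfold form_defect in G.
replace (r1 + (r2 - r1)) with r2 in G by ring.
rewrite Rplus_0_l in G.
rewrite (RInt_ext (fun t => v t (2 * PI)) (fun t => v t 0)) in G.
- unfold u in G. lra.
- intros x _. unfold v, polar. now rewrite cos_2PI, sin_2PI, cos_0, sin_0.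
Qed.

Lemma continuous_polar_re (f : C -> C) r t l : cderiv f (polar r t) l ->
  continuous (fun s => fst (f (polar r s))) t.
Proof.
intros H. destruct (cderiv_re_im f _ _ l H) as [D _].
apply (ex_derive_continuous (fun s => fst (f (polar r s)))).
eexists. apply is_derive_Reals.
apply (derivable_pt_lim_comp_2d _ (fun s => r * cos s) (fun s => r * sin s) t
  _ _ (- r * sin t) (r * cos t) D).
- apply is_derive_Reals. auto_derive; auto. ring.
- apply is_derive_Reals. auto_derive; auto. ring.
Qed.

Lemma ex_RInt_polar_re (f : C -> C) (R0 r : R) : 0 < r < R0 ->
  (forall z, 0 < Cmod z < R0 -> exists l, cderiv f z l) ->
  ex_RInt (fun t => fst (f (polar r t))) 0 (2 * PI).
Proof.
intros Hr Hf. apply (ex_RInt_continuous (fun t => fst (f (polar r t)))).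
intros t _. destruct (Hf (polar r t)) as [l Hl]; [rewrite Cmod_polar; lra|].
eapply continuous_polar_re, Hl.
Qed.

(** The circle mean does not depend on the radius, and continuity at the centre gives its limit as
    the radius shrinks. Differentiability at the centre is not assumed because the quotient [cquot]
    is only known to be continuous there. *)
Lemma re_mean_value (f : C -> C) (R0 r : R) : 0 < r < R0 ->
  (forall z, 0 < Cmod z < R0 -> exists l, cderiv f z l) ->
  (forall eps, 0 < eps -> exists d, 0 < d /\
     forall w, Cmod w < d -> Cmod (f w - f (RtoC 0)) < eps) ->
  RInt (fun t => fst (f (polar r t))) 0 (2 * PI) = 2 * PI * fst (f (RtoC 0)).
Proof.
intros Hr Hf Hc. assert (Hpi := PI_RGT_0).
set (I := RInt _ _ _). set (m := fst (f (RtoC 0))).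
enough (H : I - 2 * PI * m = 0) by lra.
apply (Rabs_small_zero _ (2 * PI)).
intros eps Heps. destruct (Hc eps Heps) as [d [Hd Hd1]].
pose (s := Rmin r (d / 2)).
assert (Hs : 0 < s) by (apply Rmin_pos; lra).
assert (Hsr : s <= r) by apply Rmin_l.
assert (Hsd : s <= d / 2) by apply Rmin_r.
unfold I. rewrite <- (polar_real_part_invariant f R0 s r); auto; try lra.
replace (RInt (fun t => fst (f (polar s t))) 0 (2 * PI) - 2 * PI * m)
  with (RInt (fun t => fst (f (polar s t))) 0 (0 + 2 * PI) - RInt (fun _ => 0) 0 (0 + 2 * PI) - 2 * PI * m)
  by (rewrite RInt_const, Rplus_0_l; unfold scal; simpl; unfold mult; simpl; ring).
rewrite (Rmult_comm eps). apply RInt_diff_bound; [lra| |apply ex_RInt_const|].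
- rewrite Rplus_0_l. apply (ex_RInt_polar_re f R0); auto; lra.
- intros t _. specialize (Hd1 (polar s t)). rewrite Cmod_polar in Hd1 by lra.
  left. eapply Rle_lt_trans; [|apply Hd1; lra].
  eapply Rle_trans; [|apply Rmax_Cmod]. eapply Rle_trans; [|apply Rmax_l].
  right. f_equal. unfold m. simpl. ring.
Qed.

Lemma RInt_eq_0_pointwise (F : R -> R) (a b x : R) : a < x < b ->
  (forall t, a <= t <= b -> continuous F t) ->
  (forall t, a <= t <= b -> 0 <= F t) -> RInt F a b = 0 -> F x = 0.
Proof.
intros Hx Hc Hp HI.
destruct (Rle_lt_or_eq_dec 0 (F x)) as [H|H]; [apply Hp; lra| |auto].
exfalso.
destruct (Hc x ltac:(lra) (fun y => F x / 2 < y)) as [d Hd].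
{ assert (H2 : 0 < F x / 2) by lra. exists (mkposreal _ H2). intros y Hy.
  apply Rabs_lt_between in Hy. unfold minus, plus, opp in Hy; simpl in Hy. lra. }
pose (e := Rmin (d / 2) (Rmin (x - a) (b - x))).
assert (He : 0 < e) by (destruct d as [d Hd0]; repeat apply Rmin_pos; simpl; lra).
assert (He1 : e <= d / 2) by apply Rmin_l.
assert (He2 : e <= x - a) by (eapply Rle_trans; [apply Rmin_r|apply Rmin_l]).
assert (He3 : e <= b - x) by (eapply Rle_trans; [apply Rmin_r|apply Rmin_r]).
assert (Hex : forall s t, a <= s -> s <= t -> t <= b -> ex_RInt F s t).
{ intros s t H1 H2 H3. apply (ex_RInt_continuous F). intros z Hz.
  rewrite Rmin_left, Rmax_right in Hz by lra. apply Hc; lra. }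
rewrite <- (RInt_Chasles F a (x - e) b) in HI by (apply Hex; lra).
rewrite <- (RInt_Chasles F (x - e) (x + e) b) in HI by (apply Hex; lra).
assert (0 <= RInt F a (x - e)) by (apply RInt_ge_0; [lra|apply Hex; lra|intros; apply Hp; lra]).
assert (0 <= RInt F (x + e) b) by (apply RInt_ge_0; [lra|apply Hex; lra|intros; apply Hp; lra]).
assert (0 < RInt F (x - e) (x + e)).
{ apply RInt_gt_0; [lra| |intros; apply Hc; lra].
  intros y Hy. assert (F x / 2 < F y); [|lra].
  apply Hd. apply Rabs_def1; unfold minus, plus, opp; simpl; destruct d; simpl in *; lra. }
unfold plus in HI; simpl in HI. lra.
Qed.

Definition cquot (f : C -> C) (l z : C) : C :=
  if excluded_middle_informative (z = RtoC 0) then l else (f z / z)%C.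

Lemma cquot_0 f l : cquot f l (RtoC 0) = l.
Proof. unfold cquot. destruct excluded_middle_informative; congruence. Qed.

Lemma cquot_neq f l z : z <> RtoC 0 -> cquot f l z = (f z / z)%C.
Proof. unfold cquot. destruct excluded_middle_informative; congruence. Qed.

Lemma Cmod_pos_neq (z : C) : 0 < Cmod z -> z <> RtoC 0.
Proof. apply Cmod_gt_0. Qed.

Lemma cquot_derivable f l z l' : 0 < Cmod z -> cderiv f z l' ->
  exists m, cderiv (cquot f l) z m.
Proof.
intros Hz H. eexists. apply cderiv_ext_loc with (fun w => f w / w)%C.
- exists (Cmod z). split; auto. intros w Hw. rewrite cquot_neq; auto.
  apply Cmod_pos_neq. generalize (Cmod_triangle_rev z (z - w)).
  replace (z - (z - w))%C with w by ring.
  replace (z - w)%C with (- (w - z))%C by ring. rewrite Cmod_opp. lra.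
- apply cderiv_div; [now apply Cmod_pos_neq|exact H|apply cderiv_id].
Qed.

Lemma cquot_continuous f l : f (RtoC 0) = RtoC 0 -> cderiv f (RtoC 0) l ->
  forall eps, 0 < eps -> exists d, 0 < d /\
     forall w, Cmod w < d -> Cmod (cquot f l w - cquot f l (RtoC 0)) < eps.
Proof.
intros H0 H eps Heps. rewrite cderiv_eps in H.
destruct (H (eps / 2)) as [d [Hd Hd1]]; [lra|].
exists d. split; auto. intros w Hw. rewrite cquot_0.
destruct (excluded_middle_informative (w = RtoC 0)) as [->|Hw0].
- rewrite cquot_0. replace (l - l)%C with (RtoC 0) by ring. now rewrite Cmod_0.
- rewrite cquot_neq by auto.
  specialize (Hd1 w). replace (w - 0)%C with w in Hd1 by ring. specialize (Hd1 Hw).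
  replace (f w / w - l)%C with ((f w - f (RtoC 0) - w * l) / w)%C
    by (rewrite H0; field; auto).
  rewrite Cmod_div by auto. assert (H1 : 0 < Cmod w) by now apply Cmod_gt_0.
  apply Rmult_lt_reg_r with (Cmod w); auto.
  unfold Rdiv. rewrite Rmult_assoc, Rinv_l by lra. nra.
Qed.

Lemma fst_conj_mult (l : C) : fst (Cconj l * l)%C = Cmod l ^ 2.
Proof. rewrite Cmod2_alt. destruct l; simpl. ring. Qed.

Lemma fst_le_Cmod (z : C) : fst z <= Cmod z.
Proof. eapply Rle_trans; [apply Rle_abs|apply (re_le_Cmod z)]. Qed.

(** The factor [Cconj l] makes the central value [|l|^2] real and nonnegative, so that the mean
    value property of the real part captures all of it. *)
Lemma mean_value_cquot f l (r : R) : 0 < r < 1 ->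
  (forall z, Cmod z < 1 -> exists m, cderiv f z m) ->
  f (RtoC 0) = RtoC 0 -> cderiv f (RtoC 0) l ->
  ex_RInt (fun t => fst (Cconj l * cquot f l (polar r t))%C) 0 (2 * PI) /\
  RInt (fun t => fst (Cconj l * cquot f l (polar r t))%C) 0 (2 * PI) = 2 * PI * Cmod l ^ 2.
Proof.
intros Hr Hf H0 H.
assert (Hd : forall z, 0 < Cmod z < 1 ->
  exists m, cderiv (fun z => Cconj l * cquot f l z)%C z m).
{ intros z Hz. destruct (Hf z) as [m Hm]; [lra|].
  destruct (cquot_derivable f l z m) as [m' Hm']; [lra|auto|].
  eexists. apply cderiv_scal, Hm'. }
split; [exact (ex_RInt_polar_re (fun z => Cconj l * cquot f l z)%C 1 r Hr Hd)|].
rewrite (re_mean_value (fun z => Cconj l * cquot f l z)%C 1 r Hr Hd).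
- now rewrite cquot_0, fst_conj_mult.
- intros eps Heps.
  assert (Hl := Cmod_ge_0 l).
  destruct (cquot_continuous f l H0 H (eps / (Cmod l + 1))) as [d [Hd0 Hd1]].
  { apply Rdiv_lt_0_compat; lra. }
  exists d. split; auto. intros w Hw. specialize (Hd1 w Hw).
  set (A := cquot f l w) in *. set (B := cquot f l (RtoC 0)) in *.
  replace (Cconj l * A - Cconj l * B)%C with (Cconj l * (A - B))%C by ring.
  rewrite Cmod_mult, Cmod_conj.
  apply (Rmult_lt_compat_l (Cmod l + 1)) in Hd1; [|lra].
  replace ((Cmod l + 1) * (eps / (Cmod l + 1))) with eps in Hd1 by (field; lra).
  assert (Hm := Cmod_ge_0 (A - B)). nra.
Qed.

(** On the circle of radius [s] the integrand of [mean_value_cquot] is at most [|l| / s], so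
    [|l|^2 <= |l| / s]. If [|l| > 1], a radius [s] strictly between [1 / |l|] and 1 contradicts
    this; the midpoint is taken. *)
Lemma schwarz_deriv_le f l :
  (forall z, Cmod z < 1 -> exists m, cderiv f z m) ->
  (forall z, Cmod z < 1 -> Cmod (f z) < 1) ->
  f (RtoC 0) = RtoC 0 -> cderiv f (RtoC 0) l -> Cmod l <= 1.
Proof.
intros Hf Hb H0 H. assert (Hpi := PI_RGT_0). assert (Hl := Cmod_ge_0 l).
destruct (Rle_lt_dec (Cmod l) 1) as [Hle|Hgt]; [auto|exfalso].
pose (r := / Cmod l).
assert (Hr0 : 0 < r) by (apply Rinv_0_lt_compat; lra).
assert (Hrl : r * Cmod l = 1) by (unfold r; apply Rinv_l; lra).
assert (Hr2 : r < 1) by nra.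
assert (Hr1 : 0 < (1 + r) / 2 < 1) by lra.
destruct (mean_value_cquot f l _ Hr1 Hf H0 H) as [Hex HI].
set (s := (1 + r) / 2) in *.
assert (Hle : 2 * PI * Cmod l ^ 2 <= (2 * PI - 0) * (Cmod l / s)).
{ rewrite <- HI.
  replace ((2 * PI - 0) * (Cmod l / s)) with (RInt (fun _ => Cmod l / s) 0 (2 * PI))
    by (rewrite RInt_const; reflexivity).
  apply RInt_le; [lra|exact Hex|apply ex_RInt_const|].
  intros t _. eapply Rle_trans; [apply fst_le_Cmod|].
  assert (Hp : Cmod (polar s t) = s) by (apply Cmod_polar; lra).
  rewrite Cmod_mult, Cmod_conj. unfold Rdiv. apply Rmult_le_compat_l; auto.
  assert (Hn : polar s t <> RtoC 0) by (apply Cmod_gt_0; lra).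
  rewrite cquot_neq, Cmod_div, Hp by auto.
  unfold Rdiv. rewrite <- (Rmult_1_l (/ s)) at 2.
  apply Rmult_le_compat_r; [left; apply Rinv_0_lt_compat; lra|].
  left. apply Hb. lra. }
assert (Hs : Cmod l / s * s = Cmod l) by (field; lra).
set (q := Cmod l / s) in *.
assert (H1 : Cmod l ^ 2 <= q) by (apply Rmult_le_reg_l with (2 * PI); lra).
assert (H2 : Cmod l ^ 2 * s <= Cmod l) by (apply Rle_trans with (q * s); [apply Rmult_le_compat_r; lra|lra]).
assert (H3 : s > r) by (unfold s; lra).
assert (H4 : s * Cmod l > 1) by nra.
nra.
Qed.

Definition mob (a z : C) : C := ((z - a) / (1 - Cconj a * z))%C.

Lemma mob_defect (a z : C) :
  Cmod (1 - Cconj a * z) ^ 2 - Cmod (z - a) ^ 2 = (1 - Cmod a ^ 2) * (1 - Cmod z ^ 2).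
Proof. rewrite !Cmod2_alt. destruct a, z; simpl. ring. Qed.

Lemma Cmod_sq_lt_1 (z : C) : Cmod z < 1 -> Cmod z ^ 2 < 1.
Proof. intros H. generalize (Cmod_ge_0 z). nra. Qed.

Lemma mob_den_neq (a z : C) : Cmod a < 1 -> Cmod z < 1 ->
  (1 - Cconj a * z)%C <> RtoC 0.
Proof.
intros Ha Hz. apply Cmod_gt_0.
apply Cmod_sq_lt_1 in Ha, Hz.
generalize (mob_defect a z) (Cmod_ge_0 (z - a)) (Cmod_ge_0 (1 - Cconj a * z)).
intros. assert (0 < Cmod (1 - Cconj a * z) ^ 2) by nra. nra.
Qed.

Lemma mob_disc (a z : C) : Cmod a < 1 -> Cmod z < 1 -> Cmod (mob a z) < 1.
Proof.
intros Ha Hz. unfold mob. assert (Hn := mob_den_neq a z Ha Hz).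
rewrite Cmod_div by auto. assert (Hp : 0 < Cmod (1 - Cconj a * z)) by now apply Cmod_gt_0.
apply Rmult_lt_reg_r with (Cmod (1 - Cconj a * z)); auto.
unfold Rdiv. rewrite Rmult_assoc, Rinv_l by lra.
apply Cmod_sq_lt_1 in Ha, Hz.
generalize (mob_defect a z) (Cmod_ge_0 (z - a)). nra.
Qed.

Lemma mob_cderiv (a z : C) : Cmod a < 1 -> Cmod z < 1 ->
  cderiv (mob a) z ((1 - Cconj a * a) / ((1 - Cconj a * z) * (1 - Cconj a * z)))%C.
Proof.
intros Ha Hz. assert (Hn := mob_den_neq a z Ha Hz).
eapply cderiv_eq; [unfold mob; cderiv_tac|field; auto].
Qed.

Lemma Cconj_self (a : C) : (Cconj a * a)%C = RtoC (Cmod a ^ 2).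
Proof. rewrite Cmod2_conj. ring. Qed.

Lemma mob_inv (a w : C) : Cmod a < 1 -> Cmod w < 1 -> mob a (mob (- a) w) = w.
Proof.
intros Ha Hw. assert (Ha' : Cmod (- a) < 1) by (rewrite Cmod_opp; auto).
assert (H1 := mob_den_neq (- a) w Ha' Hw).
assert (H2 := mob_den_neq a _ Ha (mob_disc _ _ Ha' Hw)).
assert (H3 : (1 - Cconj a * a)%C <> RtoC 0) by now apply mob_den_neq.
replace (Cconj (- a))%C with (- Cconj a)%C in H1 by (destruct a; unfold Cconj, Copp; simpl; f_equal; ring).
unfold mob in *.
replace (Cconj (- a))%C with (- Cconj a)%C in * by (destruct a; unfold Cconj, Copp; simpl; f_equal; ring).
field_simplify_eq; [ring|]. repeat split; auto.
- intros E. apply H3. rewrite <- E. ring.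
Qed.

Lemma mob_0 (a : C) : Cmod a < 1 -> mob a a = RtoC 0.
Proof.
intros Ha. assert (H := mob_den_neq a a Ha Ha).
unfold mob. field. exact H.
Qed.

Lemma mob_opp_0 (a : C) : mob (- a) (RtoC 0) = a.
Proof. unfold mob. field. Qed.

Lemma Cconj_opp (a : C) : Cconj (- a) = (- Cconj a)%C.
Proof. destruct a; unfold Cconj, Copp; simpl; reflexivity. Qed.

Lemma RtoC_pos_neq (x : R) : 0 < x -> RtoC x <> RtoC 0.
Proof. intros H E. apply (f_equal fst) in E. simpl in E. lra. Qed.

Lemma schwarz_pick_deriv f z l :
  (forall z, Cmod z < 1 -> exists m, cderiv f z m) ->
  (forall z, Cmod z < 1 -> Cmod (f z) < 1) ->
  Cmod z < 1 -> cderiv f z l ->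
  Cmod l * (1 - Cmod z ^ 2) <= 1 - Cmod (f z) ^ 2.
Proof.
intros Hf Hb Hz Hl.
assert (Hz' : Cmod (- z) < 1) by now rewrite Cmod_opp.
assert (Hw := Hb z Hz). set (w := f z) in *.
pose (F := fun u => mob w (f (mob (- z) u))).
assert (H0 : Cmod (RtoC 0) < 1) by (rewrite Cmod_0; lra).
assert (HF : cderiv F (RtoC 0)
  ((1 - Cconj (- z) * - z) / ((1 - Cconj (- z) * 0) * (1 - Cconj (- z) * 0)) * l *
   ((1 - Cconj w * w) / ((1 - Cconj w * w) * (1 - Cconj w * w))))%C).
{ apply (cderiv_comp (mob w) (fun u => f (mob (- z) u))).
  - rewrite mob_opp_0. fold w. now apply mob_cderiv.
  - apply (cderiv_comp f (mob (- z))); [rewrite mob_opp_0; exact Hl|].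
    now apply mob_cderiv. }
apply schwarz_deriv_le in HF.
- rewrite Cconj_opp in HF.
  apply Cmod_sq_lt_1 in Hz. apply Cmod_sq_lt_1 in Hw.
  replace ((1 - - Cconj z * - z) / ((1 - - Cconj z * 0) * (1 - - Cconj z * 0)) * l *
   ((1 - Cconj w * w) / ((1 - Cconj w * w) * (1 - Cconj w * w))))%C
   with (RtoC (1 - Cmod z ^ 2) * l * RtoC (/ (1 - Cmod w ^ 2)))%C in HF.
  2:{ rewrite RtoC_inv, !RtoC_minus, <- !Cconj_self.
      field.
      rewrite Cconj_self, <- RtoC_minus. apply RtoC_pos_neq. lra.
      lra. }
  rewrite !Cmod_mult, !Cmod_R, !Rabs_pos_eq in HF; try lra.
  2:{ left. apply Rinv_0_lt_compat. lra. }
  apply (Rmult_le_compat_r (1 - Cmod w ^ 2)) in HF; [|lra].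
  rewrite Rmult_assoc, Rinv_l in HF by lra. lra.
- intros u Hu. destruct (Hf (mob (- z) u)) as [m Hm]; [now apply mob_disc|].
  eexists. apply (cderiv_comp (mob w) (fun u => f (mob (- z) u))).
  + apply mob_cderiv; auto. apply Hb. now apply mob_disc.
  + apply (cderiv_comp f (mob (- z))); [exact Hm|]. now apply mob_cderiv.
- intros u Hu. apply mob_disc; auto. apply Hb. now apply mob_disc.
- unfold F. rewrite mob_opp_0. fold w. now apply mob_0.
Qed.

Lemma is_derive_re_path (F : C -> C) (a b t : R) l : cderiv F (t * a, t * b) l ->
  is_derive (fun s => fst (F (s * a, s * b))) t (fst (l * (a, b))%C).
Proof.
intros H. destruct (cderiv_re_im F _ _ l H) as [D _].
apply is_derive_Reals.
replace (fst (l * (a, b))%C) with (fst l * a + - snd l * b) by (simpl; ring).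
apply (derivable_pt_lim_comp_2d _ (fun s => s * a) (fun s => s * b) t _ _ _ _ D).
- apply is_derive_Reals. auto_derive; auto. ring.
- apply is_derive_Reals. auto_derive; auto. ring.
Qed.

(* Integrating the infinitesimal inequality along the radius: for a real-valued
   [y] with [y 0 = 0] and [y' (1 - t^2) <= 1 - y^2], the function
   [(t - y) / (1 - t y)] is nondecreasing. *)
Lemma schwarz f z :
  (forall z, Cmod z < 1 -> exists m, cderiv f z m) ->
  (forall z, Cmod z < 1 -> Cmod (f z) < 1) ->
  f (RtoC 0) = RtoC 0 -> Cmod z < 1 -> Cmod (f z) <= Cmod z.
Proof.
intros Hf Hb H0 Hz.
destruct (excluded_middle_informative (f z = RtoC 0)) as [E|Hn].
{ rewrite E, Cmod_0. apply Cmod_ge_0. }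
destruct (excluded_middle_informative (z = RtoC 0)) as [E|Hzn].
{ now rewrite E, H0, Cmod_0. }
assert (Hfz : 0 < Cmod (f z)) by now apply Cmod_gt_0.
assert (HT : 0 < Cmod z) by now apply Cmod_gt_0.
(* The rotation that makes [e * f z] equal to [|f z|], so that the real part [y] takes the value
   [|f z|] at the end of the radius. *)
pose (e := (Cconj (f z) / RtoC (Cmod (f z)))%C).
assert (He : Cmod e = 1).
{ unfold e. rewrite Cmod_div by now apply RtoC_pos_neq.
  rewrite Cmod_conj, Cmod_R, Rabs_pos_eq by lra. field. lra. }
pose (a := fst z / Cmod z). pose (b := snd z / Cmod z).
assert (Hab : a * a + b * b = 1).
{ unfold a, b. assert (H := Cmod2_alt z). unfold Re, Im in H.
  replace (fst z / Cmod z * (fst z / Cmod z) + snd z / Cmod z * (snd z / Cmod z))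
    with ((fst z ^ 2 + snd z ^ 2) / Cmod z ^ 2) by (field; lra).
  rewrite <- H. field. lra. }
assert (Hpath : forall t, 0 <= t -> Cmod (t * a, t * b) = t).
{ intros t Ht. unfold Cmod. simpl fst; simpl snd.
  replace ((t * a) ^ 2 + (t * b) ^ 2) with (t ^ 2 * (a * a + b * b)) by ring.
  rewrite Hab, Rmult_1_r. now apply sqrt_pow2. }
pose (y := fun t => fst (e * f ((t * a)%R, (t * b)%R))%C).
assert (Hy : forall t, 0 <= t <= Cmod z -> y t ^ 2 < 1 /\
  exists m, is_derive y t m /\ m * (1 - t ^ 2) <= 1 - y t ^ 2).
{ intros t Ht. assert (Ht1 : Cmod (t * a, t * b) < 1) by (rewrite Hpath; lra).
  assert (Hyt : y t ^ 2 <= Cmod (f (t * a, t * b)) ^ 2).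
  { replace (Cmod (f (t * a, t * b))) with (Cmod (e * f ((t * a)%R, (t * b)%R)))
      by (rewrite Cmod_mult, He; ring).
    rewrite Cmod2_alt. fold (y t). unfold Re, Im. fold (y t).
    generalize (pow2_ge_0 (snd (e * f ((t * a)%R, (t * b)%R))%C)). lra. }
  assert (Hft := Cmod_sq_lt_1 _ (Hb _ Ht1)).
  split; [lra|].
  destruct (Hf _ Ht1) as [l Hl].
  exists (fst ((e * l) * (a, b))%C). split.
  - apply (is_derive_re_path (fun w => e * f w)%C). now apply cderiv_scal.
  - assert (Hsp := schwarz_pick_deriv f _ l Hf Hb Ht1 Hl). rewrite Hpath in Hsp by lra.
    assert (Hle : fst (e * l * (a, b))%C <= Cmod l).
    { eapply Rle_trans; [apply fst_le_Cmod|]. rewrite !Cmod_mult, He.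
      replace (Cmod (a, b)) with 1.
      - right; ring.
      - unfold Cmod. simpl fst; simpl snd. replace (a ^ 2 + b ^ 2) with 1 by lra.
        now rewrite sqrt_1. }
    apply Rle_trans with (Cmod l * (1 - t ^ 2)); [|lra].
    apply Rmult_le_compat_r; [nra|auto]. }
pose (w := fun t => (t - y t) / (1 - t * y t)).
assert (Hden : forall t, 0 <= t <= Cmod z -> 0 < 1 - t * y t).
{ intros t Ht. destruct (Hy t Ht) as [H _]. nra. }
assert (Hw : forall t, 0 <= t <= Cmod z -> exists m, is_derive w t m /\ 0 <= m).
{ intros t Ht. destruct (Hy t Ht) as [H1 [m [H2 H3]]].
  assert (Hd := Hden t Ht).
  exists ((1 - y t ^ 2 - m * (1 - t ^ 2)) / (1 - t * y t) ^ 2). split.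
  - unfold w.
    assert (Hm : Derive (fun x => y x) t = m) by now apply is_derive_unique.
    auto_derive.
    + repeat split; try (now exists m); try (now apply Rgt_not_eq).
    + rewrite Hm. field. now apply Rgt_not_eq.
  - apply Rmult_le_pos; [lra|]. left. apply Rinv_0_lt_compat. nra. }
assert (Hy0 : y 0 = 0).
{ unfold y. rewrite !Rmult_0_l. change (0, 0) with (RtoC 0). rewrite H0. simpl. ring. }
destruct (MVT_gen w 0 (Cmod z) (fun t => Derive w t)) as [c [Hc1 Hc2]].
- intros t Ht. rewrite Rmin_left, Rmax_right in Ht by lra.
  destruct (Hw t) as [m [Hm _]]; [lra|]. apply Derive_correct. now exists m.
- intros t Ht. rewrite Rmin_left, Rmax_right in Ht by lra.
  destruct (Hw t) as [m [Hm _]]; [lra|].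
  apply continuity_pt_filterlim. apply (ex_derive_continuous w). now exists m.
- rewrite Rmin_left, Rmax_right in Hc1 by lra.
  destruct (Hw c) as [m [Hm Hm0]]; [lra|].
  rewrite (is_derive_unique _ _ _ Hm) in Hc2.
  assert (Hw0 : w 0 = 0) by (unfold w; rewrite Hy0; field).
  assert (HwT : 0 <= w (Cmod z)) by (rewrite Hw0 in Hc2; nra).
  assert (Hd := Hden (Cmod z) ltac:(lra)).
  assert (HyT : y (Cmod z) = Cmod (f z)).
  { unfold y. replace (Cmod z * a, Cmod z * b) with z.
    - unfold e. replace (Cconj (f z) / RtoC (Cmod (f z)) * f z)%C
        with ((Cconj (f z) * f z) / RtoC (Cmod (f z)))%C
        by (field; now apply RtoC_pos_neq).
      rewrite Cconj_self, <- RtoC_div by lra. simpl. field. lra.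
    - unfold a, b. apply injective_projections; cbn [fst snd]; field; lra. }
  unfold w in HwT. rewrite HyT in *.
  apply (Rmult_le_compat_r (1 - Cmod z * Cmod (f z))) in HwT; [|lra].
  rewrite Rmult_0_l in HwT. unfold Rdiv in HwT.
  rewrite Rmult_assoc, Rinv_l in HwT by lra. lra.
Qed.

(** The real part of [Cconj l * f z / z] has mean 1 on each circle and is at most 1 by [schwarz],
    hence equals 1 throughout; a number of modulus at most 1 with real part 1 is 1. *)
Lemma schwarz_deriv_eq f l :
  (forall z, Cmod z < 1 -> exists m, cderiv f z m) ->
  (forall z, Cmod z < 1 -> Cmod (f z) < 1) ->
  f (RtoC 0) = RtoC 0 -> cderiv f (RtoC 0) l -> Cmod l = 1 ->
  forall z, Cmod z < 1 -> f z = (l * z)%C.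
Proof.
assert (Hpi := PI_RGT_0).
(* evaluation on the negative axis, i.e. at the interior point [PI] of the
   parameter interval; the general case follows by a rotation *)
assert (Hneg : forall f l,
  (forall z, Cmod z < 1 -> exists m, cderiv f z m) ->
  (forall z, Cmod z < 1 -> Cmod (f z) < 1) ->
  f (RtoC 0) = RtoC 0 -> cderiv f (RtoC 0) l -> Cmod l = 1 ->
  forall r, 0 < r < 1 -> f (RtoC (- r)) = (l * RtoC (- r))%C).
{ clear f l. intros f l Hf Hb H0 H Hl r Hr.
  destruct (mean_value_cquot f l r Hr Hf H0 H) as [Hex HI].
  rewrite Hl in HI.
  pose (F := fun t => 1 - fst (Cconj l * cquot f l (polar r t))%C).
  assert (Hp : forall t, polar r t <> RtoC 0).
  { intros t. apply Cmod_gt_0. rewrite Cmod_polar; lra. }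
  assert (Hm : forall t, Cmod (Cconj l * cquot f l (polar r t)) <= 1).
  { intros t. rewrite Cmod_mult, Cmod_conj, Hl, Rmult_1_l, cquot_neq, Cmod_div by auto.
    assert (Hs := schwarz f (polar r t) Hf Hb H0). rewrite Cmod_polar in * by lra.
    specialize (Hs ltac:(lra)). apply Rmult_le_reg_r with r; [lra|].
    unfold Rdiv. rewrite Rmult_assoc, Rinv_l; lra. }
  assert (HF : F PI = 0).
  { apply (RInt_eq_0_pointwise F 0 (2 * PI)); [lra| | |].
    - intros t _. apply (continuous_minus (fun _ => 1)); [apply continuous_const|].
      destruct (Hf (polar r t)) as [m Hm']; [rewrite Cmod_polar; lra|].
      destruct (cquot_derivable f l (polar r t) m) as [m' Hm'']; auto.
      { rewrite Cmod_polar; lra. }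
      apply (continuous_polar_re (fun z => Cconj l * cquot f l z)%C r t (Cconj l * m')%C).
      now apply cderiv_scal.
    - intros t _. unfold F. generalize (fst_le_Cmod (Cconj l * cquot f l (polar r t))%C) (Hm t).
      intros; lra.
    - unfold F.
      rewrite (RInt_minus (fun _ => 1) (fun t => fst (Cconj l * cquot f l (polar r t))%C));
        [|apply ex_RInt_const|exact Hex].
      rewrite HI, RInt_const. unfold minus, plus, opp, scal; simpl. unfold mult; simpl. ring. }
  unfold F in HF.
  assert (Hpol : polar r PI = RtoC (- r)).
  { unfold polar. rewrite cos_PI, sin_PI. unfold RtoC. f_equal; ring. }
  specialize (Hm PI). specialize (Hp PI). rewrite Hpol in *.
  rewrite cquot_neq in * by auto.
  set (q := (f (RtoC (- r)) / RtoC (- r))%C) in *.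
  assert (E : (Cconj l * q)%C = RtoC 1).
  { assert (Hm2 : Cmod (Cconj l * q) ^ 2 <= 1) by (generalize (Cmod_ge_0 (Cconj l * q)); nra).
    rewrite Cmod2_alt in Hm2. unfold Re, Im in Hm2.
    apply injective_projections; [change (fst (RtoC 1)) with 1; lra|].
    change (snd (RtoC 1)) with 0.
    replace (fst (Cconj l * q)%C) with 1 in Hm2 by lra. nra. }
  assert (Eq : q = l).
  { replace q with ((l * Cconj l) * q)%C.
    - rewrite <- Cmult_assoc, E. ring.
    - rewrite (Cmult_comm l), Cconj_self, Hl. replace (1 ^ 2) with 1 by ring. ring. }
  rewrite <- Eq. unfold q. field. auto. }
intros Hf Hb H0 H Hl z Hz.
destruct (excluded_middle_informative (z = RtoC 0)) as [->|Hzn].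
{ rewrite H0. ring. }
assert (HT : 0 < Cmod z) by now apply Cmod_gt_0.
assert (HTC := RtoC_pos_neq _ HT).
pose (u := (- z / RtoC (Cmod z))%C).
assert (Hu : Cmod u = 1).
{ unfold u. rewrite Cmod_div, Cmod_opp, Cmod_R, Rabs_pos_eq by (auto; lra). field. lra. }
specialize (Hneg (fun w => f (u * w)%C) (u * l)%C).
assert (Hr : forall w, Cmod w < 1 -> Cmod (u * w) < 1).
{ intros w Hw. rewrite Cmod_mult, Hu. lra. }
assert (Hd : forall w, cderiv (fun w => u * w)%C w u).
{ intros w. assert (H1 := cderiv_scal u (fun w => w) w _ (cderiv_id w)).
  rewrite Cmult_1_r in H1. exact H1. }
assert (E : f (u * RtoC (- Cmod z))%C = (u * l * RtoC (- Cmod z))%C).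
{ apply Hneg.
  - intros w Hw. destruct (Hf (u * w)%C) as [m Hm]; auto.
    eexists. apply (cderiv_comp f (fun w => u * w)%C); eauto.
  - intros w Hw. apply Hb. auto.
  - replace (u * 0)%C with (RtoC 0) by ring. auto.
  - apply (cderiv_comp f (fun w => u * w)%C); auto.
    replace (u * 0)%C with (RtoC 0) by ring. auto.
  - rewrite Cmod_mult, Hu, Hl. ring.
  - lra. }
replace (u * l * RtoC (- Cmod z))%C with (l * (u * RtoC (- Cmod z)))%C in E by ring.
replace (u * RtoC (- Cmod z))%C with z in E; auto.
unfold u. rewrite RtoC_opp. field. auto.
Qed.

(** * Cayley transforms and the Schwarz-Pick lemma on the right half-plane *)

(** The Cayley transform of the disc onto the right half-plane that sends 0 to [a]; its inverse is
    [(z - a) / (z + Cconj a)]. *)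
Definition cay (a z : C) : C := ((a + Cconj a * z) / (1 - z))%C.

Lemma one_minus_neq (z : C) : Cmod z < 1 -> (1 - z)%C <> RtoC 0.
Proof.
intros Hz E. assert (H : z = RtoC 1).
{ replace z with (1 - (1 - z))%C by ring. rewrite E. ring. }
rewrite H, Cmod_1 in Hz. lra.
Qed.

Lemma re_pos_neq (z : C) : 0 < fst z -> z <> RtoC 0.
Proof. intros H E. rewrite E in H. simpl in H. lra. Qed.

Lemma re_div (u w : C) : w <> RtoC 0 ->
  fst (u / w)%C = fst (u * Cconj w)%C / Cmod w ^ 2.
Proof.
intros Hw. assert (H : 0 < Cmod w) by now apply Cmod_gt_0.
assert (H2 : Cmod w ^ 2 <> 0) by (apply Rgt_not_eq; nra).
replace (u / w)%C with ((u * Cconj w) * RtoC (/ Cmod w ^ 2))%C.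
- destruct (u * Cconj w)%C; simpl. field. lra.
- assert (Hc : Cconj w <> RtoC 0).
  { apply Cmod_gt_0. now rewrite Cmod_conj. }
  rewrite RtoC_inv, <- Cconj_self by auto. field. auto.
Qed.

Lemma cay_re (a z : C) : 0 < fst a -> Cmod z < 1 -> 0 < fst (cay a z).
Proof.
intros Ha Hz. unfold cay. assert (Hn := one_minus_neq z Hz).
rewrite re_div by auto.
assert (H : 0 < Cmod (1 - z)) by now apply Cmod_gt_0.
apply Rdiv_lt_0_compat; [|nra].
apply Cmod_sq_lt_1 in Hz. rewrite Cmod2_alt in Hz.
destruct a as [a1 a2], z as [z1 z2]. simpl in *. nra.
Qed.

Lemma cay_0 (a : C) : cay a (RtoC 0) = a.
Proof. unfold cay. field. Qed.

Lemma cay_cderiv (a z : C) : Cmod z < 1 ->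
  cderiv (cay a) z ((a + Cconj a) / ((1 - z) * (1 - z)))%C.
Proof.
intros Hz. assert (Hn := one_minus_neq z Hz).
eapply cderiv_eq; [unfold cay; cderiv_tac|field; auto].
Qed.

Lemma hp_sum_neq (z w : C) : 0 < fst z -> 0 < fst w -> (z + Cconj w)%C <> RtoC 0.
Proof. intros. apply re_pos_neq. destruct z, w; simpl in *. lra. Qed.

Lemma cay_inv (a z : C) : 0 < fst a -> 0 < fst z ->
  Cmod ((z - a) / (z + Cconj a))%C < 1 /\ cay a ((z - a) / (z + Cconj a))%C = z.
Proof.
intros Ha Hz. assert (Hn := hp_sum_neq z a Hz Ha).
assert (H : 0 < Cmod (z + Cconj a)) by now apply Cmod_gt_0.
split.
- rewrite Cmod_div by auto. apply Rmult_lt_reg_r with (Cmod (z + Cconj a)); auto.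
  unfold Rdiv. rewrite Rmult_assoc, Rinv_l by lra.
  assert (Cmod (z - a) ^ 2 < Cmod (z + Cconj a) ^ 2).
  { rewrite !Cmod2_alt. destruct z, a; simpl in *. nra. }
  generalize (Cmod_ge_0 (z - a)). nra.
- unfold cay. assert (Ha2 := hp_sum_neq a a Ha Ha). field. split; auto.
  intros E. apply Ha2. rewrite <- E. ring.
Qed.

Section Pick.
Variable F : C -> C.
Hypothesis HF : forall z : C, 0 < fst z -> exists l, cderiv F z l.
Hypothesis HFb : forall z : C, 0 < fst z -> Cmod (F z) < 1.

Lemma cay_comp_derivable (a : C) : 0 < fst a ->
  forall z, Cmod z < 1 -> exists m, cderiv (fun z => F (cay a z)) z m.
Proof.
intros Ha z Hz. destruct (HF (cay a z)) as [l Hl]; [now apply cay_re|].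
eexists. apply (cderiv_comp F (cay a)); eauto. now apply cay_cderiv.
Qed.

Lemma pick_deriv (a l : C) : 0 < fst a -> cderiv F a l ->
  2 * fst a * Cmod l <= 1 - Cmod (F a) ^ 2.
Proof.
intros Ha Hl. assert (H0 : Cmod (RtoC 0) < 1) by (rewrite Cmod_0; lra).
assert (H := schwarz_pick_deriv (fun z => F (cay a z)) (RtoC 0)
  ((a + Cconj a) / ((1 - 0) * (1 - 0)) * l)%C).
cbv beta in H. rewrite cay_0, Cmod_0 in H.
replace ((a + Cconj a) / ((1 - 0) * (1 - 0)) * l)%C with (RtoC (2 * fst a) * l)%C in H.
2:{ replace (RtoC (2 * fst a)) with (a + Cconj a)%C; [field|].
    destruct a; unfold Cconj, Cplus, RtoC; simpl. f_equal; ring. }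
rewrite Cmod_mult, Cmod_R, Rabs_pos_eq in H by lra.
apply Rle_trans with (2 * fst a * Cmod l * (1 - 0 ^ 2)); [right; ring|].
apply H; auto.
- now apply cay_comp_derivable.
- intros z Hz. apply HFb. now apply cay_re.
- lra.
- replace (RtoC (2 * fst a) * l)%C with ((a + Cconj a) / ((1 - 0) * (1 - 0)) * l)%C.
  + apply (cderiv_comp F (cay a)); [now rewrite cay_0|]. now apply cay_cderiv.
  + replace (RtoC (2 * fst a)) with (a + Cconj a)%C; [field|].
    destruct a; unfold Cconj, Cplus, RtoC; simpl. f_equal; ring.
Qed.

Lemma pick (z a : C) : 0 < fst z -> 0 < fst a ->
  Cmod (mob (F a) (F z)) <= Cmod ((z - a) / (z + Cconj a))%C.
Proof.
intros Hz Ha. destruct (cay_inv a z Ha Hz) as [H1 H2].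
set (u := ((z - a) / (z + Cconj a))%C) in *.
assert (H := schwarz (fun z => mob (F a) (F (cay a z))) u).
cbv beta in H. rewrite H2 in H. apply H; auto.
- intros w Hw. destruct (cay_comp_derivable a Ha w Hw) as [m Hm].
  eexists. apply (cderiv_comp (mob (F a)) (fun z => F (cay a z))); eauto.
  apply mob_cderiv; apply HFb; auto. now apply cay_re.
- intros w Hw. apply mob_disc; apply HFb; auto. now apply cay_re.
- rewrite cay_0. apply mob_0; auto.
Qed.
End Pick.

Lemma plus_one_neq (w : C) : 0 < fst w -> (w + 1)%C <> RtoC 0.
Proof. intros H. apply re_pos_neq. destruct w; simpl in *. lra. Qed.

Lemma hp_to_disc (w : C) : 0 < fst w -> Cmod ((1 - w) / (1 + w))%C < 1.
Proof.
intros Hw. destruct (cay_inv (RtoC 1) w) as [H _]; [simpl; lra|auto|].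
assert (Hn := plus_one_neq w Hw).
replace ((1 - w) / (1 + w))%C with (- ((w - 1) / (w + Cconj 1)))%C.
- now rewrite Cmod_opp.
- replace (Cconj 1) with (RtoC 1) by (unfold Cconj, RtoC; simpl; f_equal; ring).
  field. intros E; apply Hn; rewrite <- E; ring.
Qed.

Lemma hp_to_disc_defect (w : C) : 0 < fst w ->
  1 - Cmod ((1 - w) / (1 + w))%C ^ 2 = 4 * fst w / Cmod (1 + w) ^ 2.
Proof.
intros Hw.
assert (Hn : (1 + w)%C <> RtoC 0).
{ intros E. apply (plus_one_neq w Hw). rewrite <- E. ring. }
assert (H : 0 < Cmod (1 + w)) by now apply Cmod_gt_0.
rewrite Cmod_div by auto.
replace (1 - (Cmod (1 - w) / Cmod (1 + w)) ^ 2) with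
  ((Cmod (1 + w) ^ 2 - Cmod (1 - w) ^ 2) / Cmod (1 + w) ^ 2) by (field; lra).
f_equal. rewrite !Cmod2_alt. destruct w; simpl. ring.
Qed.

Lemma hp_to_disc_cderiv (W : C -> C) (z l : C) : 0 < fst (W z) -> cderiv W z l ->
  cderiv (fun z => (1 - W z) / (1 + W z))%C z (- (RtoC 2 * l / ((1 + W z) * (1 + W z))))%C.
Proof.
intros Hw Hl.
assert (Hn : (1 + W z)%C <> RtoC 0).
{ intros E. apply (plus_one_neq (W z) Hw). rewrite <- E. ring. }
eapply cderiv_eq; [cderiv_tac|field; auto].
Qed.

Lemma pick_deriv_hp (W : C -> C) (a l : C) :
  (forall z : C, 0 < fst z -> exists l, cderiv W z l) ->
  (forall z : C, 0 < fst z -> 0 < fst (W z)) ->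
  0 < fst a -> cderiv W a l -> fst a * Cmod l <= fst (W a).
Proof.
intros HW HWp Ha Hl. assert (Hwa := HWp a Ha).
assert (Hn : (1 + W a)%C <> RtoC 0).
{ intros E. apply (plus_one_neq (W a) Hwa). rewrite <- E. ring. }
assert (Hp : 0 < Cmod (1 + W a)) by now apply Cmod_gt_0.
assert (H := pick_deriv (fun z => (1 - W z) / (1 + W z))%C).
specialize (H ltac:(intros z Hz; destruct (HW z Hz) as [m Hm]; eexists;
  apply hp_to_disc_cderiv; eauto)).
specialize (H ltac:(intros z Hz; apply hp_to_disc; auto)).
specialize (H a _ Ha (hp_to_disc_cderiv W a l Hwa Hl)).
cbv beta in H. rewrite hp_to_disc_defect in H by auto.
rewrite Cmod_opp, Cmod_div, !Cmod_mult, Cmod_R, Rabs_pos_eq in H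
  by (try lra; now apply Cmult_neq_0).
apply Rmult_le_reg_r with (4 / Cmod (1 + W a) ^ 2).
- apply Rdiv_lt_0_compat; nra.
- eapply Rle_trans; [eapply Rle_trans; [|exact H]|]; right; field; lra.
Qed.

(** * The half-plane chart of the symmetrized bidisc *)

(** For the point with roots [z], [w], let [u] and [v] be the images of [om z] and [om w] under
    [x -> (1 + x) / (1 - x)]. Then [chart_z = (u + v) / 2] and [chart_g = ((u - v) / 2)^2], both
    symmetric in the roots and hence rational in [s] and [p]. *)
Definition chart_den (om s p : C) : C := (1 - om * s + om * om * p)%C.
Definition chart_z (om s p : C) : C := ((1 - om * om * p) / chart_den om s p)%C.
Definition chart_g (om s p : C) : C :=
  (chart_z om s p * chart_z om s p - (1 + om * s + om * om * p) / chart_den om s p)%C.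

(** In terms of [u] and [v] this is [(1 + u) (1 + v)], and [4 / chart_q] is [chart_den]; it is
    therefore the common denominator of the inverse chart [point_s], [point_p]. *)
Definition chart_q (z g : C) : C := ((z + 1) * (z + 1) - g)%C.
Definition point_s (om z g : C) : C :=
  (Cconj om * (RtoC 2 - RtoC 4 * (z + 1) / chart_q z g))%C.
Definition point_p (om z g : C) : C :=
  (Cconj om * Cconj om * (RtoC 1 - RtoC 4 * z / chart_q z g))%C.

(** For [g = r^2] the inequality reads [(Re r)^2 < (Re z)^2]: both [z + r] and [z - r], which are
    [u] and [v], lie in the right half-plane. *)
Definition chart_dom (z g : C) : Prop :=
  0 < fst z /\ Cmod g + fst g < 2 * fst z ^ 2.

Lemma circle_conj (om : C) : circle om -> (Cconj om * om)%C = RtoC 1.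
Proof. intros H. rewrite Cconj_self, H. f_equal. ring. Qed.

Lemma circle_neq (om : C) : circle om -> om <> RtoC 0.
Proof. intros H. apply Cmod_gt_0. rewrite H. lra. Qed.

Lemma circle_Cconj (om : C) : circle om -> Cconj om = (/ om)%C.
Proof.
intros H. assert (Hn := circle_neq om H).
replace (Cconj om) with ((Cconj om * om) / om)%C by (field; auto).
rewrite circle_conj by auto. field. auto.
Qed.

Lemma chart_dom_mean (u v : C) : 0 < fst u -> 0 < fst v ->
  chart_dom ((u + v) / RtoC 2)%C (((u - v) / RtoC 2) * ((u - v) / RtoC 2))%C.
Proof.
intros Hu Hv.
assert (E : forall z : C, (z / RtoC 2)%C = (fst z / 2, snd z / 2)).
{ intros z. replace (/ RtoC 2)%C with (RtoC (/ 2)) by (rewrite RtoC_inv; auto).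
  unfold Cdiv. replace (/ RtoC 2)%C with (RtoC (/ 2)) by (rewrite RtoC_inv; auto).
  destruct z; unfold RtoC, Cmult; simpl. f_equal; field. }
rewrite !E. split; [simpl; lra|].
rewrite Cmod_mult. replace (Cmod _ * Cmod _) with (Cmod (fst (u - v)%C / 2, snd (u - v)%C / 2) ^ 2) by ring.
rewrite Cmod2_alt. destruct u as [u1 u2], v as [v1 v2]. simpl in *. nra.
Qed.

Lemma disc_mult_circle (om z : C) : circle om -> Cmod z < 1 -> Cmod (om * z) < 1.
Proof. intros H Hz. rewrite Cmod_mult, H. lra. Qed.

Lemma disc_to_hp (z : C) : Cmod z < 1 -> 0 < fst ((1 + z) / (1 - z))%C.
Proof.
intros Hz. generalize (cay_re (RtoC 1) z). unfold cay.
replace (Cconj 1) with (RtoC 1) by (unfold Cconj, RtoC; simpl; f_equal; ring).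
rewrite Cmult_1_l. intros H. apply H; auto. simpl; lra.
Qed.

Lemma chart_den_roots (om z w : C) :
  chart_den om (z + w) (z * w) = ((1 - om * z) * (1 - om * w))%C.
Proof. unfold chart_den. ring. Qed.

Lemma chart_roots (om z w : C) : circle om -> Cmod z < 1 -> Cmod w < 1 ->
  chart_den om (z + w) (z * w) <> RtoC 0 /\
  chart_dom (chart_z om (z + w) (z * w)) (chart_g om (z + w) (z * w)).
Proof.
intros Ho Hz Hw.
assert (Hz' := disc_mult_circle om z Ho Hz). assert (Hw' := disc_mult_circle om w Ho Hw).
assert (N1 := one_minus_neq _ Hz'). assert (N2 := one_minus_neq _ Hw').
assert (N3 : RtoC 2 <> RtoC 0) by (apply RtoC_pos_neq; lra).
unfold chart_g, chart_z. rewrite chart_den_roots.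
split; [now apply Cmult_neq_0|].
assert (H := chart_dom_mean _ _ (disc_to_hp _ Hz') (disc_to_hp _ Hw')).
set (Z := (om * z)%C) in *. set (W := (om * w)%C) in *.
replace (om * om * (z * w))%C with (Z * W)%C by (unfold Z, W; ring).
replace (om * (z + w))%C with (Z + W)%C by (unfold Z, W; ring).
replace ((1 - Z * W) / ((1 - Z) * (1 - W)))%C
 with (((1 + Z) / (1 - Z) + (1 + W) / (1 - W)) / RtoC 2)%C by (field; auto).
replace (((1 + Z) / (1 - Z) + (1 + W) / (1 - W)) / 2 *
     (((1 + Z) / (1 - Z) + (1 + W) / (1 - W)) / 2) -
     (1 + (Z + W) + Z * W) / ((1 - Z) * (1 - W)))%C
 with (((1 + Z) / (1 - Z) - (1 + W) / (1 - W)) / RtoC 2 *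
     (((1 + Z) / (1 - Z) - (1 + W) / (1 - W)) / RtoC 2))%C; auto.
field; auto.
Qed.

Lemma point_chart (om s p : C) : circle om -> chart_den om s p <> RtoC 0 ->
  point_s om (chart_z om s p) (chart_g om s p) = s /\
  point_p om (chart_z om s p) (chart_g om s p) = p.
Proof.
intros Ho Hd. assert (Hn := circle_neq om Ho).
assert (N4 : RtoC 4 <> RtoC 0) by (apply RtoC_pos_neq; lra).
assert (Hq : chart_q (chart_z om s p) (chart_g om s p) = (RtoC 4 / chart_den om s p)%C).
{ unfold chart_q, chart_g, chart_z.
  set (A := chart_den om s p) in *.
  replace (1 + om * s + om * om * p)%C with (RtoC 2 + RtoC 2 * (om * om * p) - A)%C
    by (unfold A, chart_den; ring).
  field; auto. }
unfold point_s, point_p. rewrite !Hq. unfold chart_z.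
set (A := chart_den om s p) in *.
rewrite circle_Cconj by auto. split.
- transitivity ((1 + om * om * p - A) / om)%C; [|unfold A, chart_den; field; auto].
  field; auto.
- field; auto.
Qed.

Lemma chart_point (om z g : C) : circle om -> chart_q z g <> RtoC 0 ->
  chart_den om (point_s om z g) (point_p om z g) = (RtoC 4 / chart_q z g)%C /\
  chart_z om (point_s om z g) (point_p om z g) = z /\
  chart_g om (point_s om z g) (point_p om z g) = g.
Proof.
intros Ho Hq. assert (Hn := circle_neq om Ho).
assert (N4 : RtoC 4 <> RtoC 0) by (apply RtoC_pos_neq; lra).
assert (Hd : chart_den om (point_s om z g) (point_p om z g) = (RtoC 4 / chart_q z g)%C).
{ unfold chart_den, point_s, point_p. rewrite circle_Cconj by auto. field. auto. }
assert (Hz : chart_z om (point_s om z g) (point_p om z g) = z).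
{ unfold chart_z. rewrite Hd. unfold point_p. rewrite circle_Cconj by auto. field. auto. }
split; [exact Hd|split; [exact Hz|]].
unfold chart_g. rewrite Hz, Hd. unfold point_s, point_p. rewrite circle_Cconj by auto.
set (q := chart_q z g) in *.
replace g with ((z + 1) * (z + 1) - q)%C by (unfold q, chart_q; ring).
field. auto.
Qed.

Lemma Csqrt_exists (g : C) : exists r, (r * r)%C = g.
Proof.
set (m := Cmod g).
assert (Hm2 : m ^ 2 = fst g ^ 2 + snd g ^ 2) by (unfold m; rewrite Cmod2_alt; auto).
assert (Hm := Cmod_ge_0 g). fold m in Hm.
assert (H1 : 0 <= (m + fst g) / 2) by nra.
assert (H2 : 0 <= (m - fst g) / 2) by nra.
assert (S1 := sqrt_sqrt _ H1). assert (S2 := sqrt_sqrt _ H2).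
assert (P1 := sqrt_pos ((m + fst g) / 2)). assert (P2 := sqrt_pos ((m - fst g) / 2)).
set (a := sqrt ((m + fst g) / 2)) in *. set (b := sqrt ((m - fst g) / 2)) in *.
assert (E : (a * b * 2) ^ 2 = snd g ^ 2).
{ replace ((a * b * 2) ^ 2) with (4 * (a * a) * (b * b)) by ring. rewrite S1, S2.
  replace (4 * ((m + fst g) / 2) * ((m - fst g) / 2)) with (m ^ 2 - fst g ^ 2) by field. lra. }
assert (H0 : 0 <= a * b) by now apply Rmult_le_pos.
destruct (Rle_lt_dec 0 (snd g)) as [Hs|Hs].
- exists (a, b). apply injective_projections; simpl; [lra|]. nra.
- exists (a, - b). apply injective_projections; simpl; [lra|]. nra.
Qed.

Lemma chart_dom_roots (z g : C) : chart_dom z g ->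
  exists u v : C, 0 < fst u /\ 0 < fst v /\ (u + v = RtoC 2 * z)%C /\ (u * v = z * z - g)%C.
Proof.
intros [Hz Hg]. destruct (Csqrt_exists g) as [r Hr].
exists (z + r)%C, (z - r)%C.
assert (H : fst r ^ 2 < fst z ^ 2).
{ rewrite <- Hr, Cmod_mult in Hg.
  replace (Cmod r * Cmod r) with (Cmod r ^ 2) in Hg by ring.
  rewrite Cmod2_alt in Hg. destruct r; simpl in *. lra. }
repeat split.
- destruct z, r; simpl in *. nra.
- destruct z, r; simpl in *. nra.
- ring.
- rewrite <- Hr. ring.
Qed.

Lemma one_plus_neq (w : C) : 0 < fst w -> (1 + w)%C <> RtoC 0.
Proof. intros H. apply re_pos_neq. destruct w; simpl in *. lra. Qed.

Lemma chart_q_neq (z g : C) : chart_dom z g -> chart_q z g <> RtoC 0.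
Proof.
intros H. destruct (chart_dom_roots z g H) as (u & v & Hu & Hv & E1 & E2).
replace (chart_q z g) with ((1 + u) * (1 + v))%C.
- apply Cmult_neq_0; now apply one_plus_neq.
- unfold chart_q. replace ((1 + u) * (1 + v))%C with (1 + (u + v) + u * v)%C by ring.
  rewrite E1, E2. ring.
Qed.

Lemma point_in_symbidisc (om z g : C) : circle om -> chart_dom z g ->
  symbidisc (point_s om z g, point_p om z g).
Proof.
intros Ho H. destruct (chart_dom_roots z g H) as (u & v & Hu & Hv & E1 & E2).
assert (N1 := one_plus_neq u Hu). assert (N2 := one_plus_neq v Hv).
assert (Eq : chart_q z g = ((1 + u) * (1 + v))%C).
{ unfold chart_q. replace ((1 + u) * (1 + v))%C with (1 + (u + v) + u * v)%C by ring.
  rewrite E1, E2. ring. }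
assert (N3 : RtoC 2 <> RtoC 0) by (apply RtoC_pos_neq; lra).
exists (Cconj om * - ((1 - u) / (1 + u)))%C, (Cconj om * - ((1 - v) / (1 + v)))%C.
assert (Ho' : circle (Cconj om)) by (unfold circle; now rewrite Cmod_conj).
split; [|split].
- apply disc_mult_circle; auto. rewrite Cmod_opp. now apply hp_to_disc.
- apply disc_mult_circle; auto. rewrite Cmod_opp. now apply hp_to_disc.
- unfold point_s, point_p. rewrite Eq.
  assert (Ez : z = ((u + v) / RtoC 2)%C) by (rewrite E1; field; auto).
  rewrite Ez. f_equal; field; auto.
Qed.

Lemma symbidisc_chart (om : C) (x : C2) : circle om -> symbidisc x ->
  chart_den om (fst x) (snd x) <> RtoC 0 /\
  chart_dom (chart_z om (fst x) (snd x)) (chart_g om (fst x) (snd x)) /\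
  x = (point_s om (chart_z om (fst x) (snd x)) (chart_g om (fst x) (snd x)),
       point_p om (chart_z om (fst x) (snd x)) (chart_g om (fst x) (snd x))).
Proof.
intros Ho (z & w & Hz & Hw & ->). cbn [fst snd].
destruct (chart_roots om z w Ho Hz Hw) as [H1 H2].
destruct (point_chart om (z + w)%C (z * w)%C Ho H1) as [E1 E2].
split; [exact H1|split; [exact H2|]].
f_equal; symmetry; [exact E1|exact E2].
Qed.

(** * Quadratic graphs in the chart *)

(** On the imaginary axis [quad a b c (i t) = - (a t^2 + b t + c)], so the sign condition says that
    [quad] is nonpositive there. Strictness at [a = 1] keeps the graph inside [chart_dom]. *)
Definition admissible (a b c : R) : Prop :=
  0 <= a <= 1 /\ (forall t, 0 <= a * t ^ 2 + b * t + c) /\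
  (a = 1 -> forall t, 0 < a * t ^ 2 + b * t + c).

Definition quad (a b c : R) (z : C) : C := (a * z * z + Ci * b * z - c)%C.
Definition dquad (a b : R) (z : C) : C := (2 * a * z + Ci * b)%C.

Lemma nonneg_quadratic_lead k2 k1 k0 :
  (forall t, 0 <= k2 * t ^ 2 + k1 * t + k0) -> 0 <= k2.
Proof.
intros H. destruct (Rle_lt_dec 0 k2) as [|Hn]; [auto|exfalso].
(* Large enough for [k2 * T ^ 2] to outweigh [k0]; adding the values at [T] and [- T] removes
   [k1]. *)
pose (T := 1 + Rabs k0 / - k2).
assert (H1 := H T). assert (H2 := H (- T)).
assert (Hk := Rabs_pos k0). assert (Hk0 := Rle_abs k0).
assert (HT : k2 * T = k2 - Rabs k0) by (unfold T; field; lra).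
assert (HT1 : 1 <= T).
{ unfold T. assert (0 <= Rabs k0 / - k2); [|lra].
  apply Rmult_le_pos; auto. left. apply Rinv_0_lt_compat. lra. }
assert (k2 * T ^ 2 <= k2 * T) by nra. nra.
Qed.

(** Take [s] with [|s| = T] and [k3 * s] negative, where [|k3| T = |k3| + S] and [S] is the sum of
    the moduli of the other coefficients. Then the cubic term is [- (|k3| + S) T^2], while the
    others add up to at most [S T^2]. *)
Lemma nonneg_cubic_lead k3 k2 k1 k0 :
  (forall t, 0 <= k3 * t ^ 3 + k2 * t ^ 2 + k1 * t + k0) -> k3 = 0.
Proof.
intros H. destruct (Req_dec k3 0) as [|Hn]; [auto|exfalso].
assert (Hp := Rabs_pos_lt k3 Hn).
assert (A0 := Rabs_pos k0). assert (A1 := Rabs_pos k1). assert (A2 := Rabs_pos k2).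
pose (S := Rabs k0 + Rabs k1 + Rabs k2).
pose (T := 1 + S / Rabs k3).
assert (HS : 0 <= S) by (unfold S; lra).
assert (HT : Rabs k3 * T = Rabs k3 + S) by (unfold T; field; lra).
assert (HT1 : 1 <= T).
{ unfold T. assert (0 <= S / Rabs k3); [|lra].
  apply Rmult_le_pos; auto. left. now apply Rinv_0_lt_compat. }
assert (E : exists s, Rabs s = T /\ k3 * s = - (Rabs k3 * T)).
{ destruct (Rle_lt_dec 0 k3).
  - exists (- T). rewrite Rabs_Ropp, !Rabs_pos_eq by lra. split; [auto|ring].
  - exists T. rewrite Rabs_pos_eq, Rabs_left by lra. split; [auto|ring]. }
destruct E as [s [Hs1 Hs2]]. specialize (H s).
assert (Es : s ^ 2 = T ^ 2) by (rewrite <- Hs1; symmetry; apply pow2_abs).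
assert (B1 : k1 * s <= Rabs k1 * T).
{ rewrite <- Hs1, <- Rabs_mult. apply Rle_abs. }
assert (B2 : k2 * s ^ 2 <= Rabs k2 * T ^ 2).
{ rewrite Es. apply Rmult_le_compat_r; [nra|apply Rle_abs]. }
assert (B0 := Rle_abs k0).
assert (B3 : k3 * s ^ 3 = - ((Rabs k3 + S) * T ^ 2)).
{ replace (k3 * s ^ 3) with ((k3 * s) * s ^ 2) by ring. rewrite Hs2, Es, HT. ring. }
assert (HT2 : T <= T ^ 2) by nra.
assert (C1 : Rabs k1 * T <= Rabs k1 * T ^ 2) by (apply Rmult_le_compat_l; lra).
assert (C0 : Rabs k0 * 1 <= Rabs k0 * T ^ 2) by (apply Rmult_le_compat_l; lra).
unfold S in B3. nra.
Qed.

Lemma nonneg_quadratic_discr a b c :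
  (forall t, 0 <= a * t ^ 2 + b * t + c) -> b ^ 2 <= 4 * a * c.
Proof.
intros H. assert (Ha := nonneg_quadratic_lead a b c H).
destruct (Req_dec a 0) as [E|E].
- subst a. destruct (Req_dec b 0) as [->|Hb]; [lra|exfalso].
  specialize (H (- (c + 1) / b)).
  replace (0 * (- (c + 1) / b) ^ 2 + b * (- (c + 1) / b) + c) with (- 1) in H by (field; auto).
  lra.
- specialize (H (- b / (2 * a))).
  replace (a * (- b / (2 * a)) ^ 2 + b * (- b / (2 * a)) + c)
    with ((4 * a * c - b ^ 2) * / (4 * a)) in H by (field; auto).
  assert (Hi : 0 < / (4 * a)) by (apply Rinv_0_lt_compat; lra). nra.
Qed.

Lemma pos_quadratic_discr a b c : 0 < a ->
  (forall t, 0 < a * t ^ 2 + b * t + c) -> b ^ 2 < 4 * a * c.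
Proof.
intros Ha H.
specialize (H (- b / (2 * a))).
replace (a * (- b / (2 * a)) ^ 2 + b * (- b / (2 * a)) + c)
    with ((4 * a * c - b ^ 2) * / (4 * a)) in H by (field; lra).
assert (Hi : 0 < / (4 * a)) by (apply Rinv_0_lt_compat; lra). nra.
Qed.

Lemma quad_parts a b c (z : C) :
  fst (quad a b c z) = a * (fst z ^ 2 - snd z ^ 2) - b * snd z - c /\
  snd (quad a b c z) = 2 * a * fst z * snd z + b * fst z.
Proof. destruct z; simpl; split; ring. Qed.

Lemma dquad_parts a b (z : C) :
  fst (dquad a b z) = 2 * a * fst z /\ snd (dquad a b z) = 2 * a * snd z + b.
Proof. destruct z; simpl; split; ring. Qed.

Lemma quad_cderiv a b c z : cderiv (quad a b c) z (dquad a b z).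
Proof.
eapply cderiv_eq; [unfold quad; cderiv_tac|unfold dquad; ring].
Qed.

#[local] Hint Resolve quad_cderiv : cderiv.

Lemma chart_dom_sq (z g : C) : chart_dom z g <->
  0 < fst z /\ fst g < 2 * fst z ^ 2 /\ snd g ^ 2 < 4 * fst z ^ 2 * (fst z ^ 2 - fst g).
Proof.
unfold chart_dom. assert (H := Cmod2_alt g). unfold Re, Im in H.
assert (Hp := Cmod_ge_0 g). split; intros [H1 H2]; (split; [auto|]).
- split; [lra|nra].
- nra.
Qed.

(** With [z = x + i y], the squared chart inequality becomes, up to the factor [x^2], positivity of
    [4 (1 - a) (x^2 + a y^2 + b y + c) + (4 a c - b^2)]. For [a < 1] the first term is positive; for
    [a = 1] only the discriminant is left, and it is strict. *)
Lemma quad_chart_dom a b c z : admissible a b c -> 0 < fst z ->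
  chart_dom z (quad a b c z).
Proof.
intros ([Ha0 Ha1] & HN & Hs) Hz. apply chart_dom_sq. split; [auto|].
destruct (quad_parts a b c z) as [-> ->].
assert (D := nonneg_quadratic_discr a b c HN).
set (x := fst z) in *. set (y := snd z). assert (HNy := HN y).
assert (Hx2 : 0 < x ^ 2) by nra.
assert (E : 4 * x ^ 2 * (x ^ 2 - (a * (x ^ 2 - y ^ 2) - b * y - c)) - (2 * a * x * y + b * x) ^ 2
  = x ^ 2 * (4 * (1 - a) * (x ^ 2 + (a * y ^ 2 + b * y + c)) + (4 * a * c - b ^ 2))) by ring.
split; [nra|].
enough (0 < 4 * (1 - a) * (x ^ 2 + (a * y ^ 2 + b * y + c)) + (4 * a * c - b ^ 2)) by nra.
destruct (Req_dec a 1) as [E1|E1].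
- assert (D1 := pos_quadratic_discr a b c ltac:(lra) (Hs E1)).
  rewrite E1 in *. lra.
- assert (0 < (1 - a) * (x ^ 2 + (a * y ^ 2 + b * y + c))) by (apply Rmult_lt_0_compat; lra).
  lra.
Qed.

(** The right side minus the left side is a polynomial in [t] without quartic term, with cubic
    coefficient [2 x (c2 x - G2)]. Nonnegativity for all real [t] makes that coefficient vanish, and
    the rest factors as [x^2 (2 x - c1) (c1 t^2 - 2 G2 t + c1 x^2 - 2 G1 x)]. *)
Lemma tangent_real x G1 G2 c1 c2 :
  0 < x -> G1 < 2 * x ^ 2 -> G2 ^ 2 < 4 * x ^ 2 * (x ^ 2 - G1) ->
  (forall t, x ^ 2 * ((x ^ 2 - t ^ 2 - c1 * x + c2 * t + G1) ^ 2 +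
                      (2 * x * t - c1 * t - c2 * x + G2) ^ 2)
             <= (x ^ 3 + x * t ^ 2 - G1 * x - G2 * t) ^ 2) ->
  G2 = x * c2 /\ 0 <= c1 <= 2 * x /\
  (forall t, 0 <= c1 * t ^ 2 - 2 * G2 * t + c1 * x ^ 2 - 2 * G1 * x) /\
  (c1 = 2 * x -> forall t, 0 < c1 * t ^ 2 - 2 * G2 * t + c1 * x ^ 2 - 2 * G1 * x).
Proof.
intros Hx HG1 HG2 H.
assert (Hd : c2 * x - G2 = 0).
{ apply Rmult_eq_reg_l with (2 * x); [|lra]. rewrite Rmult_0_r.
  pose (d := c2 * x - G2). pose (e := G2 + c2 * x).
  pose (A := 2 * x ^ 3 - c1 * x ^ 2). pose (B := c1 * x ^ 2 - 2 * G1 * x).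
  apply (nonneg_cubic_lead _ (2 * x * A - d * e - x ^ 2 * (2 * x - c1) ^ 2)
     (d * B - A * e + 2 * x ^ 2 * (2 * x - c1) * d) (A * B - x ^ 2 * d ^ 2)).
  intros t. specialize (H t). apply Rle_minus in H.
  apply Ropp_le_cancel. rewrite Ropp_0.
  eapply Rle_trans; [|exact H]. right. unfold A, B, d, e. ring. }
assert (E2 : G2 = x * c2) by lra.
split; [exact E2|].
assert (Hq : forall t, 0 <= (2 * x - c1) * (c1 * t ^ 2 - 2 * G2 * t + c1 * x ^ 2 - 2 * G1 * x)).
{ intros t. specialize (H t). rewrite E2 in *.
  apply Rmult_le_reg_l with (x ^ 2); [nra|]. rewrite Rmult_0_r.
  apply Rle_minus in H. apply Ropp_le_cancel. rewrite Ropp_0.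
  eapply Rle_trans; [|exact H]. right. ring. }
(* Here the first factor vanishes and the inequality carries no information; the strict sign comes
   from [HG2], the chart domain. *)
assert (Hpos : c1 = 2 * x -> forall t, 0 < c1 * t ^ 2 - 2 * G2 * t + c1 * x ^ 2 - 2 * G1 * x).
{ intros -> t.
  assert (0 < 2 * x * (2 * x * t ^ 2 - 2 * G2 * t + 2 * x * x ^ 2 - 2 * G1 * x)).
  { replace (2 * x * (2 * x * t ^ 2 - 2 * G2 * t + 2 * x * x ^ 2 - 2 * G1 * x))
    with ((2 * x * t - G2) ^ 2 + (4 * x ^ 2 * (x ^ 2 - G1) - G2 ^ 2)) by ring.
    generalize (pow2_ge_0 (2 * x * t - G2)). lra. }
  nra. }
assert (Hle : c1 <= 2 * x).
{ destruct (Rle_lt_dec c1 (2 * x)) as [|Hn]; [auto|exfalso].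
  enough (0 <= - c1) by lra.
  apply (nonneg_quadratic_lead _ (2 * G2) (2 * G1 * x - c1 * x ^ 2)).
  intros t. specialize (Hq t). nra. }
assert (Hall : forall t, 0 <= c1 * t ^ 2 - 2 * G2 * t + c1 * x ^ 2 - 2 * G1 * x).
{ intros t. destruct (Req_dec c1 (2 * x)) as [E|E]; [left; now apply Hpos|].
  specialize (Hq t). apply Rmult_le_reg_l with (2 * x - c1); lra. }
split; [|auto]. split; [|auto].
apply (nonneg_quadratic_lead c1 (- 2 * G2) (c1 * x ^ 2 - 2 * G1 * x)).
intros t. specialize (Hall t). lra.
Qed.

(* The hypothesis says that the hyperbolic derivative, in the direction
   [(1, gamma)], of [zeta - g / (zeta - i t)] never exceeds that of [zeta]. *)
Lemma tangent_quad (z g gamma : C) : chart_dom z g ->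
  (forall t : R, fst z * Cmod ((z - Ci * t) * (z - Ci * t) - gamma * (z - Ci * t) + g)
     <= fst z * Cmod (z - Ci * t) ^ 2 - fst (g * Cconj (z - Ci * t))%C) ->
  exists a b c, admissible a b c /\ g = quad a b c z /\ gamma = dquad a b z.
Proof.
intros Hd H. apply chart_dom_sq in Hd. destruct Hd as [Hx [H1 H2]].
assert (HR : forall t : R, fst z ^ 2 * ((fst z ^ 2 - t ^ 2 - fst gamma * fst z + snd gamma * t + fst g) ^ 2 +
                      (2 * fst z * t - fst gamma * t - snd gamma * fst z + snd g) ^ 2)
             <= (fst z ^ 3 + fst z * t ^ 2 - fst g * fst z - snd g * t) ^ 2).
{ intros t. specialize (H (snd z - t)).
  assert (L : 0 <= fst z * Cmod ((z - Ci * (snd z - t)%R) * (z - Ci * (snd z - t)%R)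
     - gamma * (z - Ci * (snd z - t)%R) + g)).
  { apply Rmult_le_pos; [lra|apply Cmod_ge_0]. }
  assert (Sq := pow_incr _ _ 2 (conj L H)).
  rewrite Rpow_mult_distr, !Cmod2_alt in Sq.
  destruct z as [x y], g as [g1 g2], gamma as [c1 c2]. simpl in Sq |- *.
  ring_simplify in Sq. ring_simplify. exact Sq. }
destruct (tangent_real _ _ _ _ _ Hx H1 H2 HR) as (E & Hc & Hall & Hs).
destruct z as [x y], g as [g1 g2], gamma as [c1 c2]. cbn [fst snd] in *.
(* Solves [gamma = 2 a z + i b] for [a], [b] and the real part of [g = quad a b c z] for [c]. The
   imaginary part of the latter then holds because of the relation [E]. *)
set (a := c1 / (2 * x)). set (b := c2 - 2 * a * y).
set (c := a * (x ^ 2 - y ^ 2) - b * y - g1).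
assert (Ea : c1 = 2 * a * x) by (unfold a; field; lra).
assert (EN : forall t, 2 * x * (a * t ^ 2 + b * t + c) =
  c1 * (y - t) ^ 2 - 2 * g2 * (y - t) + c1 * x ^ 2 - 2 * g1 * x).
{ intros t. rewrite E, Ea. unfold c, b. ring. }
exists a, b, c. split; [|split].
- repeat split.
  + unfold a. apply Rmult_le_pos; [lra|]. left. apply Rinv_0_lt_compat. lra.
  + apply Rmult_le_reg_l with (2 * x); lra.
  + intros t. specialize (Hall (y - t)). rewrite <- EN in Hall.
    apply Rmult_le_reg_l with (2 * x); lra.
  + intros Ea1 t. specialize (Hs ltac:(rewrite Ea, Ea1; ring) (y - t)).
    rewrite <- EN in Hs. apply Rmult_lt_reg_l with (2 * x); lra.
- destruct (quad_parts a b c (x, y)) as [P1 P2]. apply injective_projections.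
  + rewrite P1. cbn [fst snd]. unfold c. ring.
  + rewrite P2. cbn [fst snd]. rewrite E. unfold b. ring.
- destruct (dquad_parts a b (x, y)) as [P1 P2]. apply injective_projections.
  + rewrite P1. cbn [fst snd]. lra.
  + rewrite P2. cbn [fst snd]. unfold b. ring.
Qed.

(** * Chain rules for curves in C^2 *)

Lemma cderiv_filterdiff (f : C -> C) (z l : C) :
  cderiv f z l <->
  @filterdiff C_AbsRing C_NormedModule C_NormedModule f (locally z) (fun y => Cmult y l).
Proof.
split; intros [H1 H2].
- split.
  { destruct (@is_linear_scal_l C_AbsRing C_NormedModule l) as [A B D].
    constructor; [exact A|exact B|exact D]. }
  intros x Hx.
  assert (E : z = x) by (apply (is_filter_lim_locally_unique (K := C_AbsRing) (V := C_NormedModule)); auto).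
  subst x. intros eps. apply locally_C. exact (H2 z (fun P HP => HP) eps).
- split; [apply @is_linear_scal_l|].
  intros x Hx.
  apply (is_filter_lim_locally_unique (K := C_AbsRing)
           (V := AbsRing_NormedModule C_AbsRing)) in Hx. subst x.
  intros eps. apply locally_C. exact (H2 z (fun P HP => HP) eps).
Qed.

Lemma C_linear_scal (l : C -> C) : @is_linear C_AbsRing C_NormedModule C_NormedModule l ->
  forall y, l y = (y * l (RtoC 1))%C.
Proof.
intros H y. assert (E := linear_scal l H y (RtoC 1)).
change (scal y (RtoC 1)) with (y * RtoC 1)%C in E. rewrite Cmult_1_r in E. exact E.
Qed.

Lemma holomorphic_curve (k : C -> C2) (z : C) :
  @ex_filterdiff C_AbsRing C_NormedModule C2 k (locally z) ->
  exists s p, cderiv (fun w => fst (k w)) z s /\ cderiv (fun w => snd (k w)) z p.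
Proof.
intros [l Hl].
assert (L1 := @is_linear_fst C_AbsRing C_NormedModule C_NormedModule).
assert (L2 := @is_linear_snd C_AbsRing C_NormedModule C_NormedModule).
assert (H1 := filterdiff_comp' k fst z l fst Hl (filterdiff_linear fst L1)).
assert (H2 := filterdiff_comp' k snd z l snd Hl (filterdiff_linear snd L2)).
eexists _, _; split; apply cderiv_filterdiff; (eapply filterdiff_ext_lin; [eassumption|]).
- intros y. exact (C_linear_scal _ (proj1 H1) y).
- intros y. exact (C_linear_scal _ (proj1 H2) y).
Qed.

Lemma cderiv_comp2 (F : C2 -> C) (S P : C -> C) (z s p : C) (L : C2 -> C) :
  @filterdiff C_AbsRing C2 C_NormedModule F (locally (S z, P z)) L ->
  cderiv S z s -> cderiv P z p -> cderiv (fun w => F (S w, P w)) z (L (s, p)).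
Proof.
intros HF HS HP. apply cderiv_filterdiff in HS. apply cderiv_filterdiff in HP.
apply cderiv_filterdiff.
assert (HF' : filterdiff (fun t : prod_NormedModule C_AbsRing C_NormedModule C_NormedModule =>
    (fun a b => F (a, b)) (fst t) (snd t)) (locally (S z, P z)) (fun t => (fun a b => L (a, b)) (fst t) (snd t))).
{ eapply filterdiff_ext; [|eapply filterdiff_ext_lin; [exact HF|]].
  - intros [a b]; reflexivity.
  - intros [a b]; reflexivity. }
assert (H := filterdiff_comp'_2 S P (fun a b => F (a, b)) z _ _ (fun a b => L (a, b)) HS HP HF').
eapply filterdiff_ext_lin; [exact H|].
intros y. simpl.
change ((y * s)%C, (y * p)%C) with (@scal C_AbsRing C2 y (s, p)).
apply (linear_scal L (proj1 HF)).
Qed.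

(** The derivative of [chart_q] in the direction [(z', g')]; [dpoint_s] and [dpoint_p] are the
    corresponding derivatives of [point_s] and [point_p]. *)
Definition dpoint_den (z z' g' : C) : C := (RtoC 2 * (z + 1) * z' - g')%C.

Definition dpoint_s (om z g z' g' : C) : C :=
  (- (Cconj om * (RtoC 4 * (z' * chart_q z g - (z + 1) * dpoint_den z z' g'))
      / (chart_q z g * chart_q z g)))%C.

Definition dpoint_p (om z g z' g' : C) : C :=
  (- (Cconj om * Cconj om * (RtoC 4 * (z' * chart_q z g - z * dpoint_den z z' g'))
      / (chart_q z g * chart_q z g)))%C.

Lemma point_cderiv (om : C) (Z G : C -> C) (w z' g' : C) :
  chart_q (Z w) (G w) <> RtoC 0 -> cderiv Z w z' -> cderiv G w g' ->
  cderiv (fun w => point_s om (Z w) (G w)) w (dpoint_s om (Z w) (G w) z' g') /\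
  cderiv (fun w => point_p om (Z w) (G w)) w (dpoint_p om (Z w) (G w) z' g').
Proof.
intros Hq HZ HG.
split; (eapply cderiv_eq; [unfold point_s, point_p, chart_q; cderiv_tac|]);
  unfold dpoint_s, dpoint_p, dpoint_den, chart_q in *; field; auto.
Qed.

Lemma dpoint_scal (om z g z' g' c : C) :
  dpoint_s om z g (c * z')%C (c * g')%C = (c * dpoint_s om z g z' g')%C /\
  dpoint_p om z g (c * z')%C (c * g')%C = (c * dpoint_p om z g z' g')%C.
Proof.
unfold dpoint_s, dpoint_p, dpoint_den, Cdiv. split; ring.
Qed.

Lemma chart_cderiv (om : C) (S P : C -> C) (w s p : C) :
  chart_den om (S w) (P w) <> RtoC 0 -> cderiv S w s -> cderiv P w p ->
  (exists z', cderiv (fun w => chart_z om (S w) (P w)) w z') /\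
  (exists g', cderiv (fun w => chart_g om (S w) (P w)) w g').
Proof.
intros Hd HS HP.
assert (HD : exists d, cderiv (fun w => chart_den om (S w) (P w)) w d).
{ eexists. unfold chart_den. cderiv_tac. }
destruct HD as [d HD].
assert (HZ : exists z', cderiv (fun w => chart_z om (S w) (P w)) w z').
{ eexists. unfold chart_z. cderiv_tac. }
split; auto. destruct HZ as [z' HZ].
eexists. unfold chart_g. cderiv_tac.
Qed.

(** * The functions [Phi] in the chart *)

(** The quotient [tnum / tden] is the half-plane form of Phi at the parameter [om * eta^2],
    [eta = cs + i sn]. For [sn <> 0] it is [z - g / (z - i t)] with [t = - cs / sn], and for
    [sn = 0] it is [z]; the homogeneous form treats all parameters together. *)
Definition tden (cs sn : R) (z : C) : C := (RtoC cs - Ci * sn * z)%C.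
Definition tnum (cs sn : R) (z g : C) : C := (z * tden cs sn z + Ci * sn * g)%C.

(** This is [Re (tnum / tden) > 0] with the denominator cleared. With [u = cs + sn y], four times
    [x] times the left side is [(2 x u - sn g2)^2] plus [sn^2] times the quantity that
    [chart_dom_sq] makes positive; when [sn = 0] the square itself is [4 x^2 cs^2]. *)
Lemma tnum_tden_pos cs sn (z g : C) : cs ^ 2 + sn ^ 2 = 1 -> chart_dom z g ->
  0 < fst (tnum cs sn z g * Cconj (tden cs sn z))%C.
Proof.
intros Hu Hd. apply chart_dom_sq in Hd. destruct Hd as [Hx [H1 H2]].
unfold tnum, tden. destruct z as [x y], g as [g1 g2]. simpl in *.
match goal with |- 0 < ?A => replace A with
  (x * (cs + sn * y) ^ 2 - sn * (cs + sn * y) * g2 + sn ^ 2 * (x ^ 3 - g1 * x)) by ring end.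
set (u := cs + sn * y).
assert (E : 4 * x * (x * u ^ 2 - sn * u * g2 + sn ^ 2 * (x ^ 3 - g1 * x)) =
  (2 * x * u - sn * g2) ^ 2 + sn ^ 2 * (4 * x ^ 2 * (x ^ 2 - g1) - g2 ^ 2)) by ring.
enough (0 < (2 * x * u - sn * g2) ^ 2 + sn ^ 2 * (4 * x ^ 2 * (x ^ 2 - g1) - g2 ^ 2)) by nra.
destruct (Req_dec sn 0) as [->|Hn].
- unfold u. assert (0 < cs ^ 2) by nra.
  replace ((2 * x * (cs + 0 * y) - 0 * g2) ^ 2 + 0 ^ 2 * (4 * x ^ 2 * (x ^ 2 - g1) - g2 ^ 2))
    with (4 * x ^ 2 * cs ^ 2) by ring. apply Rmult_lt_0_compat; nra.
- assert (0 < sn ^ 2) by (apply pow2_gt_0; auto).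
  assert (0 < sn ^ 2 * (4 * x ^ 2 * (x ^ 2 - g1) - g2 ^ 2)) by (apply Rmult_lt_0_compat; simpl in *; lra).
  generalize (pow2_ge_0 (2 * x * u - sn * g2)). lra.
Qed.

Lemma Cmod_sum_diff (t n : C) :
  Cmod (t + n) ^ 2 - Cmod (t - n) ^ 2 = 4 * fst (n * Cconj t)%C.
Proof. rewrite !Cmod2_alt. destruct t, n; simpl. ring. Qed.

Lemma tden_plus_tnum_neq cs sn z g : cs ^ 2 + sn ^ 2 = 1 -> chart_dom z g ->
  (tden cs sn z + tnum cs sn z g)%C <> RtoC 0.
Proof.
intros Hu Hd E. assert (H := tnum_tden_pos cs sn z g Hu Hd).
assert (H2 := Cmod_sum_diff (tden cs sn z) (tnum cs sn z g)).
rewrite E, Cmod_0 in H2. generalize (pow2_ge_0 (Cmod (tden cs sn z - tnum cs sn z g))).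
simpl in *. lra.
Qed.

Lemma Phi_point (om z g : C) (cs sn : R) : circle om -> cs ^ 2 + sn ^ 2 = 1 -> chart_dom z g ->
  Phi (om * ((cs, sn) * (cs, sn))) (point_s om z g, point_p om z g) =
  (Cconj om * ((tden cs sn z - tnum cs sn z g) / (tden cs sn z + tnum cs sn z g)))%C.
Proof.
intros Ho Hu Hd. assert (Hq := chart_q_neq z g Hd).
assert (Hs := tden_plus_tnum_neq cs sn z g Hu Hd).
set (eta := (cs, sn) : C).
assert (Hn := circle_neq om Ho).
assert (He1 : eta <> RtoC 0).
{ intros E. apply (f_equal Cmod) in E. unfold eta, Cmod in E. simpl fst in E; simpl snd in E.
  rewrite Hu, sqrt_1 in E.
  replace (0 ^ 2 + 0 ^ 2) with 0 in E by ring. rewrite sqrt_0 in E. lra. }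
(* Multiplying numerator and denominator by [4 eta] replaces [cs] and [sn] by [eta^2 + 1] and
   [eta^2 - 1], that is, by polynomials in the parameter of Phi. *)
assert (Ec : (RtoC 2 * cs * eta)%C = (eta * eta + 1)%C).
{ unfold eta. apply injective_projections; simpl; [|ring].
  simpl in Hu; lra. }
assert (Es : (RtoC 2 * (Ci * sn) * eta)%C = (eta * eta - 1)%C).
{ unfold eta. apply injective_projections; simpl; [|ring].
  simpl in Hu; lra. }
unfold Phi, fst, snd. unfold tnum, tden in *.
unfold point_s, point_p. rewrite circle_Cconj by auto.
set (T := (cs - Ci * sn * z)%C) in *.
set (N := (z * T + Ci * sn * g)%C) in *.
assert (E1 : (RtoC 4 * eta * (T + N))%C = (RtoC 2 * chart_q z g - eta * eta * (RtoC 2 * chart_q z g - RtoC 4 * (z + 1)))%C).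
{ unfold N, T.
  replace (RtoC 4 * eta * (cs - Ci * sn * z + (z * (cs - Ci * sn * z) + Ci * sn * g)))%C with
   (RtoC 2 * ((RtoC 2 * cs * eta) * (1 + z) - (RtoC 2 * (Ci * sn) * eta) * (z + z * z - g)))%C by ring.
  rewrite Ec, Es. unfold chart_q. ring. }
assert (E2 : (RtoC 4 * eta * (T - N))%C = (RtoC 2 * (eta * eta) * (chart_q z g - RtoC 4 * z) - (RtoC 2 * chart_q z g - RtoC 4 * (z + 1)))%C).
{ unfold N, T.
  replace (RtoC 4 * eta * (cs - Ci * sn * z - (z * (cs - Ci * sn * z) + Ci * sn * g)))%C with
   (RtoC 2 * ((RtoC 2 * cs * eta) * (1 - z) - (RtoC 2 * (Ci * sn) * eta) * (z - z * z + g)))%C by ring.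
  rewrite Ec, Es. unfold chart_q. ring. }
assert (N4 : RtoC 4 <> RtoC 0) by (apply RtoC_pos_neq; lra).
assert (H4 : (RtoC 4 * eta * (T + N))%C <> RtoC 0) by (repeat apply Cmult_neq_0; auto).
transitivity (/ om * ((RtoC 4 * eta * (T - N)) / (RtoC 4 * eta * (T + N))))%C; [|field; auto].
rewrite E1 in *. rewrite E2. field. auto.
Qed.

(** The Wronskian of [tnum] and [tden] along [(z', g')], that is, [tden^2] times the derivative of
    their quotient. Accordingly [hspeed] is the speed of [W = tnum / tden] in the hyperbolic metric
    [|dW| / (2 Re W)]. *)
Definition hderiv (cs sn : R) (z g z' g' : C) : C :=
  (z' * (tden cs sn z * tden cs sn z) + Ci * sn * g' * tden cs sn z
   + Ci * sn * (Ci * sn) * g * z')%C.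

Definition hspeed (cs sn : R) (z g z' g' : C) : R :=
  Cmod (hderiv cs sn z g z' g') / (2 * fst (tnum cs sn z g * Cconj (tden cs sn z))%C).

Lemma Phi_curve (om : C) (cs sn : R) (S P Z G : C -> C) (z0 z' g' : C) (d : R) :
  circle om -> cs ^ 2 + sn ^ 2 = 1 -> 0 < d ->
  (forall w, Cmod (w - z0) < d -> chart_dom (Z w) (G w) /\
     S w = point_s om (Z w) (G w) /\ P w = point_p om (Z w) (G w)) ->
  cderiv Z z0 z' -> cderiv G z0 g' ->
  exists l, cderiv (fun w => Phi (om * ((cs, sn) * (cs, sn))) (S w, P w)) z0 l /\
    Cmod l / (1 - Cmod (Phi (om * ((cs, sn) * (cs, sn))) (S z0, P z0)) ^ 2) =
    hspeed cs sn (Z z0) (G z0) z' g'.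
Proof.
intros Ho Hu Hd H HZ HG.
assert (HPhi : forall w, Cmod (w - z0) < d ->
  (Cconj om * ((tden cs sn (Z w) - tnum cs sn (Z w) (G w)) /
      (tden cs sn (Z w) + tnum cs sn (Z w) (G w))))%C =
  Phi (om * ((cs, sn) * (cs, sn))) (S w, P w)).
{ intros w Hw. destruct (H w Hw) as (H1 & -> & ->). now rewrite Phi_point. }
assert (H0 : Cmod (z0 - z0) < d).
{ replace (z0 - z0)%C with (RtoC 0) by ring. now rewrite Cmod_0. }
destruct (H z0 H0) as [Hdom _].
assert (Hn := tden_plus_tnum_neq cs sn _ _ Hu Hdom).
assert (HT : cderiv (fun w => tden cs sn (Z w)) z0 (- (Ci * sn * z'))%C).
{ eapply cderiv_eq; [unfold tden; cderiv_tac|ring]. }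
assert (HN : cderiv (fun w => tnum cs sn (Z w) (G w)) z0
  (z' * tden cs sn (Z z0) + Z z0 * - (Ci * sn * z') + Ci * sn * g')%C).
{ unfold tnum. cderiv_tac. }
assert (D := cderiv_scal (Cconj om) _ _ _ (cderiv_div
  (fun w => tden cs sn (Z w) - tnum cs sn (Z w) (G w))%C
  (fun w => tden cs sn (Z w) + tnum cs sn (Z w) (G w))%C z0 _ _ Hn (cderiv_minus _ _ _ _ _ HT HN) (cderiv_plus _ _ _ _ _ HT HN))).
eexists. split.
- eapply cderiv_ext_loc; [|exact D]. exists d. split; auto.
- rewrite <- (HPhi z0 H0). cbv beta in *.
  assert (Hp : 0 < Cmod (tden cs sn (Z z0) + tnum cs sn (Z z0) (G z0))) by now apply Cmod_gt_0.
  assert (Hre := tnum_tden_pos cs sn _ _ Hu Hdom).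
  assert (Hsd := Cmod_sum_diff (tden cs sn (Z z0)) (tnum cs sn (Z z0) (G z0))).
  match goal with |- Cmod (_ * (?A / _))%C / _ = _ =>
    replace A with (RtoC (-2) * hderiv cs sn (Z z0) (G z0) z' g')%C
      by (unfold hderiv, tnum; replace (RtoC (-2)) with (- RtoC 2)%C by (rewrite <- RtoC_opp; f_equal; lra); ring) end.
  unfold hspeed.
  set (T := tden cs sn (Z z0)) in *. set (N := tnum cs sn (Z z0) (G z0)) in *.
  rewrite !Cmod_mult, !Cmod_div, !Cmod_mult, !Cmod_conj, Ho by (auto; now apply Cmult_neq_0).
  rewrite Cmod_R, Rabs_left by lra.
  set (h := Cmod (hderiv _ _ _ _ _ _)).
  replace (1 - (1 * (Cmod (T - N) / Cmod (T + N))) ^ 2) with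
    (4 * fst (N * Cconj T)%C / Cmod (T + N) ^ 2).
  + field. simpl in *; lra.
  + rewrite <- Hsd. field. lra.
Qed.

Lemma unit_circle_angle (cs sn : R) : cs ^ 2 + sn ^ 2 = 1 ->
  exists t, 0 <= t <= 2 * PI /\ cs = cos t /\ sn = sin t.
Proof.
intros H. assert (Hc : -1 <= cs <= 1) by (split; nra).
assert (Hb := acos_bound cs). assert (Hpi := PI_RGT_0).
assert (Hs : sin (acos cs) = sqrt (1 - cs²)) by now apply sin_acos.
assert (E : 1 - cs² = sn ^ 2) by (unfold Rsqr; lra). rewrite E in Hs.
destruct (Rle_lt_dec 0 sn).
- exists (acos cs). rewrite cos_acos, Hs, sqrt_pow2 by auto. repeat split; auto; lra.
- exists (2 * PI - acos cs).
  rewrite cos_minus, sin_minus, cos_2PI, sin_2PI, cos_acos, Hs by auto.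
  replace (sn ^ 2) with ((- sn) ^ 2) by ring. rewrite sqrt_pow2 by lra.
  repeat split; lra.
Qed.

Lemma hspeed_max (z g z' g' : C) : chart_dom z g ->
  exists t0, forall cs sn, cs ^ 2 + sn ^ 2 = 1 ->
    hspeed cs sn z g z' g' <= hspeed (cos t0) (sin t0) z g z' g'.
Proof.
intros Hd.
assert (Hu : forall t, cos t ^ 2 + sin t ^ 2 = 1).
{ intros t. generalize (sin2_cos2 t). unfold Rsqr. intros; lra. }
assert (Hpos : forall cs sn, cs ^ 2 + sn ^ 2 = 1 -> 0 <= hspeed cs sn z g z' g').
{ intros cs sn H. apply Rmult_le_pos; [apply Cmod_ge_0|].
  left. apply Rinv_0_lt_compat. generalize (tnum_tden_pos cs sn z g H Hd).
  simpl in *; lra. }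
(* The squared speed is a quotient of polynomials in [cos t] and [sin t] with nonvanishing
   denominator, hence differentiable, so a maximum exists on the compact interval. *)
pose (f := fun t => (fst (hderiv (cos t) (sin t) z g z' g') ^ 2 + snd (hderiv (cos t) (sin t) z g z' g') ^ 2) /
   (2 * fst (tnum (cos t) (sin t) z g * Cconj (tden (cos t) (sin t) z))%C) ^ 2).
assert (Hf : forall t, f t = hspeed (cos t) (sin t) z g z' g' ^ 2).
{ intros t. unfold f, hspeed.
  assert (H := tnum_tden_pos _ _ z g (Hu t) Hd).
  assert (Hm := Cmod2_alt (hderiv (cos t) (sin t) z g z' g')). unfold Re, Im in Hm.
  rewrite <- Hm. field. lra. }
assert (Hc : forall t, 0 <= t <= 2 * PI -> continuity_pt f t).
{ intros t _. apply continuity_pt_filterlim. apply (ex_derive_continuous f).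
  assert (H := tnum_tden_pos _ _ z g (Hu t) Hd).
  unfold f. unfold Rdiv. apply @ex_derive_mult.
  - unfold hderiv, tden. simpl. auto_derive. auto.
  - apply ex_derive_inv.
    + unfold tnum, tden. simpl. auto_derive. auto.
    + apply Rgt_not_eq. nra. }
destruct (continuity_ab_maj f 0 (2 * PI)) as [t0 [Ht0 _]]; auto.
{ generalize PI_RGT_0; lra. }
exists t0. intros cs sn H. destruct (unit_circle_angle cs sn H) as (t & Ht & -> & ->).
specialize (Ht0 t Ht). rewrite !Hf in Ht0.
generalize (Hpos _ _ (Hu t)) (Hpos _ _ (Hu t0)). intros.
apply Rsqr_incr_0; unfold Rsqr; simpl in Ht0; lra.
Qed.

(** * Rigidity of graphs over the half-plane *)

Lemma eq_of_zero_derive (f : R -> R) (u v : R) :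
  (forall t, Rmin u v <= t <= Rmax u v -> is_derive f t 0) -> f u = f v.
Proof.
intros H. destruct (Rtotal_order u v) as [L|[->|L]]; auto.
- apply (eq_is_derive f u v); auto. intros t Ht. apply H.
  rewrite Rmin_left, Rmax_right; lra.
- symmetry. apply (eq_is_derive f v u); auto. intros t Ht. apply H.
  rewrite Rmin_right, Rmax_left; lra.
Qed.

Lemma cderiv_partials (f : C -> C) (x y : R) (l : C) : cderiv f (x, y) l ->
  is_derive (fun t => fst (f (t, y))) x (fst l) /\
  is_derive (fun t => snd (f (t, y))) x (snd l) /\
  is_derive (fun t => fst (f (x, t))) y (- snd l) /\
  is_derive (fun t => snd (f (x, t))) y (fst l).
Proof.
intros H. destruct (cderiv_re_im f x y l H) as [D1 D2].
assert (I : forall t, derivable_pt_lim (fun s => s) t 1) by (intros; apply derivable_pt_lim_id).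
assert (K : forall a t, derivable_pt_lim (fun s => a) t 0) by (intros; apply derivable_pt_lim_const).
split; [|split; [|split]]; apply is_derive_Reals.
- replace (fst l) with (fst l * 1 + - snd l * 0) by ring.
  exact (derivable_pt_lim_comp_2d _ (fun t => t) (fun _ => y) x _ _ _ _ D1 (I x) (K y x)).
- replace (snd l) with (snd l * 1 + fst l * 0) by ring.
  exact (derivable_pt_lim_comp_2d _ (fun t => t) (fun _ => y) x _ _ _ _ D2 (I x) (K y x)).
- replace (- snd l) with (fst l * 0 + - snd l * 1) by ring.
  exact (derivable_pt_lim_comp_2d _ (fun _ => x) (fun t => t) y _ _ _ _ D1 (K x y) (I y)).
- replace (fst l) with (snd l * 0 + fst l * 1) by ring.
  exact (derivable_pt_lim_comp_2d _ (fun _ => x) (fun t => t) y _ _ _ _ D2 (K x y) (I y)).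
Qed.

(* With [g = U + i V], the hypothesis is the equation [V = x V_x], so that
   [V = x beta(y)]; the Cauchy-Riemann equations then force [beta'' = 0]. *)
Lemma quadratic_of_radial_im (g g' : C -> C) :
  (forall z : C, 0 < fst z -> cderiv g z (g' z)) ->
  (forall z : C, 0 < fst z -> snd (g z) = fst z * snd (g' z)) ->
  exists a b c, forall z : C, 0 < fst z -> g z = quad a b c z.
Proof.
intros Hd Him.
assert (Hpar : forall x y, 0 < x ->
  is_derive (fun t => fst (g (t, y))) x (fst (g' (x, y))) /\
  is_derive (fun t => snd (g (t, y))) x (snd (g' (x, y))) /\
  is_derive (fun t => fst (g (x, t))) y (- snd (g' (x, y))) /\
  is_derive (fun t => snd (g (x, t))) y (fst (g' (x, y)))).
{ intros x y Hx. apply cderiv_partials. apply Hd. exact Hx. }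
assert (E1 : forall x y, 0 < x -> snd (g (x, y)) = x * snd (g (1, y))).
{ intros x y Hx.
  assert (H : snd (g (x, y)) / x = snd (g (1, y)) / 1).
  { apply (eq_of_zero_derive (fun t => snd (g (t, y)) / t)).
    intros t Ht. assert (Ht0 : 0 < t).
    { apply Rlt_le_trans with (Rmin x 1); [|lra]. apply Rmin_pos; lra. }
    destruct (Hpar t y Ht0) as (_ & D & _ & _).
    replace 0 with ((snd (g' (t, y)) * t - snd (g (t, y)) * 1) / t ^ 2).
    - apply (is_derive_div (fun t => snd (g (t, y))) (fun t => t)); [exact D|apply @is_derive_id|lra].
    - rewrite (Him (t, y)) by exact Ht0. cbn [fst]. field. lra. }
  rewrite Rdiv_1_r in H. rewrite <- H. field. lra. }
assert (E2 : forall x y, 0 < x -> snd (g' (x, y)) = snd (g (1, y))).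
{ intros x y Hx. apply Rmult_eq_reg_l with x; [|lra].
  rewrite <- E1 by auto. symmetry. apply (Him (x, y)). exact Hx. }
assert (E3 : forall x y, 0 < x -> fst (g' (x, y)) = x * fst (g' (1, y))).
{ intros x y Hx.
  destruct (Hpar x y Hx) as (_ & _ & _ & D1).
  destruct (Hpar 1 y Rlt_0_1) as (_ & _ & _ & D2).
  apply is_derive_unique in D1. rewrite <- D1. apply is_derive_unique.
  apply (is_derive_ext (fun t => x * snd (g (1, t)))).
  - intros t. symmetry. now apply E1.
  - apply (is_derive_scal (fun t => snd (g (1, t)))). exact D2. }
assert (E4 : forall x y, 0 < x ->
  fst (g (x, y)) = fst (g (1, y)) + fst (g' (1, y)) * (x ^ 2 - 1) / 2).
{ intros x y Hx.
  assert (H : fst (g (x, y)) - fst (g' (1, y)) * x ^ 2 / 2 = fst (g (1, y)) - fst (g' (1, y)) * 1 ^ 2 / 2).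
  { apply (eq_of_zero_derive (fun t => fst (g (t, y)) - fst (g' (1, y)) * t ^ 2 / 2)).
    intros t Ht. assert (Ht0 : 0 < t).
    { apply Rlt_le_trans with (Rmin x 1); [|lra]. apply Rmin_pos; lra. }
    destruct (Hpar t y Ht0) as (D & _ & _ & _).
    rewrite E3 in D by auto.
    replace 0 with (t * fst (g' (1, y)) - fst (g' (1, y)) * t) by ring.
    apply (is_derive_minus (fun t => fst (g (t, y))) (fun t => fst (g' (1, y)) * t ^ 2 / 2)); [exact D|].
    auto_derive; auto. field. }
  lra. }
(* By [E4] the increment of [Re g] from [x = 1] to [x = 2] is 3/2 of [Re g' (1, y)]. Its derivative
   in [y] vanishes because [Im g'] is independent of [x], so no second derivative has to be
   taken. *)
assert (E5 : forall y, fst (g' (1, y)) = fst (g' (1, 0))).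
{ intros y.
  assert (H : fst (g (2, y)) - fst (g (1, y)) = fst (g (2, 0)) - fst (g (1, 0))).
  { apply (eq_of_zero_derive (fun t => fst (g (2, t)) - fst (g (1, t)))).
    intros t _.
    destruct (Hpar 2 t Rlt_0_2) as (_ & _ & D1 & _). destruct (Hpar 1 t Rlt_0_1) as (_ & _ & D2 & _).
    rewrite E2 in D1, D2 by lra.
    replace 0 with (- snd (g (1, t)) - - snd (g (1, t))) by ring.
    apply (is_derive_minus (fun t => fst (g (2, t))) (fun t => fst (g (1, t)))); auto. }
  rewrite (E4 2 y), (E4 2 0) in H by lra. lra. }
set (a := fst (g' (1, 0)) / 2).
set (b := snd (g (1, 0))).
assert (E6 : forall y, snd (g (1, y)) = 2 * a * y + b).
{ intros y.
  assert (H : snd (g (1, y)) - 2 * a * y = snd (g (1, 0)) - 2 * a * 0).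
  { apply (eq_of_zero_derive (fun t => snd (g (1, t)) - 2 * a * t)).
    intros t _. destruct (Hpar 1 t Rlt_0_1) as (_ & _ & _ & D). rewrite E5 in D.
    replace 0 with (fst (g' (1, 0)) - 2 * a) by (unfold a; field).
    apply (is_derive_minus (fun t => snd (g (1, t))) (fun t => 2 * a * t)); auto.
    auto_derive; auto. ring. }
  unfold b. lra. }
assert (E7 : forall y, fst (g (1, y)) = fst (g (1, 0)) - a * y ^ 2 - b * y).
{ intros y.
  assert (H : fst (g (1, y)) + a * y ^ 2 + b * y = fst (g (1, 0)) + a * 0 ^ 2 + b * 0).
  { apply (eq_of_zero_derive (fun t => fst (g (1, t)) + a * t ^ 2 + b * t)).
    intros t _. destruct (Hpar 1 t Rlt_0_1) as (_ & _ & D & _). rewrite E2, E6 in D by lra.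
    replace 0 with (- (2 * a * t + b) + 2 * a * t + b) by ring.
    apply (is_derive_plus (fun t => fst (g (1, t)) + a * t ^ 2) (fun t => b * t)).
    - apply (is_derive_plus (fun t => fst (g (1, t))) (fun t => a * t ^ 2)); auto.
      auto_derive; auto. ring.
    - auto_derive; auto. ring. }
  lra. }
exists a, b, (a - fst (g (1, 0))). intros [x y] Hx. cbn [fst] in Hx.
destruct (quad_parts a b (a - fst (g (1, 0))) (x, y)) as [P1 P2].
apply injective_projections.
- rewrite P1. cbn [fst snd]. rewrite E4, E7, E5 by auto. unfold a. field.
- rewrite P2. cbn [fst snd]. rewrite E1, E6 by auto. ring.
Qed.

Lemma chart_cross_pos (z g : C) (t : R) : chart_dom z g ->
  0 < fst (z - g / (z - Ci * t))%C /\
  fst (z - g / (z - Ci * t))%C * Cmod (z - Ci * t) ^ 2 =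
    fst z * Cmod (z - Ci * t) ^ 2 - fst (g * Cconj (z - Ci * t))%C.
Proof.
intros Hd. assert (Hx := proj1 Hd).
assert (Hw : (z - Ci * t)%C <> RtoC 0).
{ apply re_pos_neq. destruct z; simpl in *. lra. }
assert (Hp : 0 < Cmod (z - Ci * t)) by now apply Cmod_gt_0.
assert (E : fst (z - g / (z - Ci * t))%C =
  fst z - fst (g * Cconj (z - Ci * t))%C / Cmod (z - Ci * t) ^ 2).
{ rewrite <- re_div by auto. destruct z, (g / _)%C; reflexivity. }
assert (E2 : fst (z - g / (z - Ci * t))%C * Cmod (z - Ci * t) ^ 2 =
    fst z * Cmod (z - Ci * t) ^ 2 - fst (g * Cconj (z - Ci * t))%C).
{ rewrite E. field. lra. }
split; [|exact E2].
apply Rmult_lt_reg_r with (Cmod (z - Ci * t) ^ 2); [nra|].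
rewrite E2, Rmult_0_l, Cmod2_alt.
apply chart_dom_sq in Hd. destruct Hd as [_ [H1 H2]].
destruct z as [x y], g as [g1 g2]. simpl in *.
set (u := y - t).
match goal with |- 0 < ?A => replace A with
  (x * u ^ 2 - u * g2 + (x ^ 3 - g1 * x)) by (unfold u; ring) end.
assert (E3 : 4 * x * (x * u ^ 2 - u * g2 + (x ^ 3 - g1 * x)) =
  (2 * x * u - g2) ^ 2 + (4 * x ^ 2 * (x ^ 2 - g1) - g2 ^ 2)) by ring.
generalize (pow2_ge_0 (2 * x * u - g2)). intros.
assert (0 < 4 * x * (x * u ^ 2 - u * g2 + (x ^ 3 - g1 * x))) by (rewrite E3; lra).
nra.
Qed.

Lemma hp_open (z w : C) : Cmod (w - z) < fst z -> 0 < fst w.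
Proof.
intros H. assert (H1 := fst_le_Cmod (z - w)).
replace (z - w)%C with (- (w - z))%C in H1 by ring. rewrite Cmod_opp in H1.
destruct z, w; simpl in *. lra.
Qed.

(** Schwarz-Pick for the half-plane maps [z - g z / (z - i t)] lets [tangent_quad] find, at each
    point, an admissible quadratic with the same value and derivative. It depends on the point a
    priori; [quadratic_of_radial_im] turns the family into a single one. *)
Lemma chart_graph_quadratic (g : C -> C) :
  (forall z : C, 0 < fst z -> exists l, cderiv g z l) ->
  (forall z : C, 0 < fst z -> chart_dom z (g z)) ->
  exists a b c, admissible a b c /\ forall z : C, 0 < fst z -> g z = quad a b c z.
Proof.
intros Hd Hdom.
assert (Hd' : forall z : C, 0 < fst z -> cderiv g z (C_derive g z)).
{ intros z Hz. destruct (Hd z Hz) as [l Hl]. now rewrite (cderiv_C_derive g z l Hl). }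
assert (Hw : forall (z : C) (t : R), 0 < fst z -> (z - Ci * t)%C <> RtoC 0).
{ intros z t Hz. apply re_pos_neq. destruct z; simpl in *. lra. }
assert (HW : forall (z : C) (t : R) l, 0 < fst z -> cderiv g z l ->
  cderiv (fun z => z - g z / (z - Ci * t))%C z
   (1 - (l * (z - Ci * t) - g z) / ((z - Ci * t) * (z - Ci * t)))%C).
{ intros z t l Hz Hl. specialize (Hw z t Hz).
  eapply cderiv_eq; [cderiv_tac|field; auto]. }
assert (Htan : forall z : C, 0 < fst z ->
  exists a b c, admissible a b c /\ g z = quad a b c z /\ C_derive g z = dquad a b z).
{ intros z Hz. apply tangent_quad; [now apply Hdom|]. intros t.
  destruct (chart_cross_pos z (g z) t (Hdom z Hz)) as [_ <-].
  assert (P := pick_deriv_hp (fun z => z - g z / (z - Ci * t))%C z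
    (1 - (C_derive g z * (z - Ci * t) - g z) / ((z - Ci * t) * (z - Ci * t)))%C).
  specialize (P ltac:(intros u Hu; eexists; apply HW; auto)).
  specialize (P ltac:(intros u Hu; apply chart_cross_pos; auto) Hz (HW z t _ Hz (Hd' z Hz))).
  cbv beta in P.
  assert (Hn := Hw z t Hz).
  replace ((z - Ci * t) * (z - Ci * t) - C_derive g z * (z - Ci * t) + g z)%C
   with ((1 - (C_derive g z * (z - Ci * t) - g z) / ((z - Ci * t) * (z - Ci * t)))
     * ((z - Ci * t) * (z - Ci * t)))%C by (field; auto).
  rewrite (Cmod_mult (1 - _)%C), (Cmod_mult (z - Ci * t)).
  replace (Cmod (z - Ci * t) * Cmod (z - Ci * t)) with (Cmod (z - Ci * t) ^ 2) by ring.
  rewrite <- Rmult_assoc. apply Rmult_le_compat_r; auto. apply pow2_ge_0. }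
destruct (quadratic_of_radial_im g (C_derive g) Hd') as (a & b & c & Hg).
{ intros z Hz. destruct (Htan z Hz) as (a & b & c & _ & E1 & E2).
  rewrite E1, E2. destruct (quad_parts a b c z) as [_ ->].
  destruct (dquad_parts a b z) as [_ ->]. ring. }
exists a, b, c. split; auto.
(* Admissibility of the global coefficients is inherited from the tangent quadratic at 1, since the
   value and derivative there determine [a], [b] and [c]. *)
assert (H1 : 0 < fst (RtoC 1)) by (simpl; lra).
destruct (Htan (RtoC 1) H1) as (a' & b' & c' & Hadm & E1 & E2).
assert (E3 : C_derive g (RtoC 1) = dquad a b (RtoC 1)).
{ apply cderiv_C_derive. apply (cderiv_ext_loc (quad a b c)).
  - exists 1. split; [lra|]. intros w Hw1. symmetry. apply Hg.
    apply (hp_open (RtoC 1)). exact Hw1.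
  - apply quad_cderiv. }
rewrite E3 in E2. rewrite (Hg (RtoC 1) H1) in E1.
destruct (quad_parts a b c (RtoC 1)) as [P1 _]. destruct (quad_parts a' b' c' (RtoC 1)) as [P1' _].
destruct (dquad_parts a b (RtoC 1)) as [P2 P3]. destruct (dquad_parts a' b' (RtoC 1)) as [P2' P3'].
rewrite E1 in P1. rewrite E2 in P2, P3. simpl fst in *; simpl snd in *.
assert (a = a') by lra. subst a'. assert (b = b') by lra. subst b'.
assert (c = c') by lra. now subst c'.
Qed.

(** * The normal form of complex geodesics *)

Lemma hspeed_0 (z g z' g' : C) :
  hspeed 1 0 z g z' g' = Cmod z' / (2 * fst z).
Proof.
unfold hspeed, hderiv, tnum, tden. f_equal.
- f_equal. ring.
- f_equal. destruct z, g; simpl. ring.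
Qed.

Lemma tden_slope (z : C) (t k : R) : tden (- t * k) k z = (- (Ci * k) * (z - Ci * t))%C.
Proof.
unfold tden. apply injective_projections; destruct z; simpl; ring.
Qed.

Lemma hspeed_slope (z g gamma z' : C) (t k : R) : chart_dom z g -> k <> 0 ->
  hspeed (- t * k) k z g z' (gamma * z')%C =
  Cmod z' * (Cmod ((z - Ci * t) * (z - Ci * t) - gamma * (z - Ci * t) + g)
     / (2 * (fst z * Cmod (z - Ci * t) ^ 2 - fst (g * Cconj (z - Ci * t))%C))).
Proof.
intros Hd Hk. assert (Hx := proj1 Hd).
destruct (chart_cross_pos z g t Hd) as [H1 H2].
assert (Hw : (z - Ci * t)%C <> RtoC 0).
{ apply re_pos_neq. destruct z; simpl in *. lra. }
assert (Hp : 0 < Cmod (z - Ci * t) ^ 2).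
{ apply pow_lt. now apply Cmod_gt_0. }
assert (Hpos : 0 < fst z * Cmod (z - Ci * t) ^ 2 - fst (g * Cconj (z - Ci * t))%C).
{ rewrite <- H2. now apply Rmult_lt_0_compat. }
unfold hspeed, hderiv, tnum. rewrite tden_slope.
assert (Hk2 : 0 < k ^ 2) by (apply pow2_gt_0; auto).
set (w := (z - Ci * t)%C) in *.
assert (EN : fst ((z * (- (Ci * k) * w) + Ci * k * g) * Cconj (- (Ci * k) * w))%C =
  k ^ 2 * (fst z * Cmod w ^ 2 - fst (g * Cconj w)%C)).
{ rewrite Cmod2_alt. destruct z, g, w; simpl. ring. }
rewrite EN.
assert (ED : (z' * (- (Ci * k) * w * (- (Ci * k) * w)) +
   Ci * k * (gamma * z') * (- (Ci * k) * w) + Ci * k * (Ci * k) * g * z')%C =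
   (RtoC (- k ^ 2) * (z' * (w * w - gamma * w + g)))%C).
{ replace (RtoC (- k ^ 2)) with (Ci * k * (Ci * k))%C.
  - ring.
  - apply injective_projections; simpl; ring. }
rewrite ED, !Cmod_mult, Cmod_R, Rabs_left by lra.
field. lra.
Qed.

Definition chart_curve (om : C) (a b c : R) (z : C) : C2 :=
  (point_s om z (quad a b c z), point_p om z (quad a b c z)).

Lemma chart_curve_in (om : C) (a b c : R) (z : C) : circle om -> admissible a b c ->
  0 < fst z -> symbidisc (chart_curve om a b c z).
Proof. intros Ho Ha Hz. apply point_in_symbidisc; auto. now apply quad_chart_dom. Qed.

Definition dcurve_s om a b c z := dpoint_s om z (quad a b c z) (RtoC 1) (dquad a b z).
Definition dcurve_p om a b c z := dpoint_p om z (quad a b c z) (RtoC 1) (dquad a b z).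

Lemma chart_curve_cderiv (om : C) (a b c : R) (z : C) : admissible a b c -> 0 < fst z ->
  cderiv (fun w => point_s om w (quad a b c w)) z (dcurve_s om a b c z) /\
  cderiv (fun w => point_p om w (quad a b c w)) z (dcurve_p om a b c z).
Proof.
intros Ha Hz.
apply (point_cderiv om (fun w => w) (quad a b c)).
- apply chart_q_neq. now apply quad_chart_dom.
- apply cderiv_id.
- apply quad_cderiv.
Qed.

Lemma holomorphic_curve_comp (F : C2 -> C) (om : C) (a b c : R) :
  circle om -> admissible a b c ->
  @holomorphic_map C2 C_NormedModule symbidisc Defs.disc F ->
  (forall z : C, 0 < fst z -> exists L,
     @filterdiff C_AbsRing C2 C_NormedModule F (locally (chart_curve om a b c z)) L /\
     cderiv (fun w => F (chart_curve om a b c w)) z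
       (L (dcurve_s om a b c z, dcurve_p om a b c z))) /\
  (forall z : C, 0 < fst z -> Cmod (F (chart_curve om a b c z)) < 1).
Proof.
intros Ho Ha [HF HFd]. split; intros z Hz.
- destruct (HF _ (chart_curve_in om a b c z Ho Ha Hz)) as [L HL].
  exists L. split; auto.
  destruct (chart_curve_cderiv om a b c z Ha Hz) as [H1 H2].
  apply (cderiv_comp2 F (fun w => point_s om w (quad a b c w))
    (fun w => point_p om w (quad a b c w)) z _ _ L); auto.
- apply HFd. now apply chart_curve_in.
Qed.

Lemma mob_inj (a u w : C) : Cmod a < 1 -> Cmod u < 1 -> Cmod w < 1 ->
  mob a u = mob a w -> u = w.
Proof.
intros Ha Hu Hw E. assert (Ha' : Cmod (- a) < 1) by now rewrite Cmod_opp.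
assert (H := fun u H => mob_inv (- a) u Ha' H).
assert (En : (- - a)%C = a) by ring. rewrite En in H.
rewrite <- (H u Hu), <- (H w Hw), E. reflexivity.
Qed.

Lemma cayley_inj (u w : C) : 0 < fst u -> 0 < fst w ->
  ((1 - u) / (1 + u))%C = ((1 - w) / (1 + w))%C -> u = w.
Proof.
intros Hu Hw E. assert (N1 := one_plus_neq u Hu). assert (N2 := one_plus_neq w Hw).
assert (N3 : RtoC 2 <> RtoC 0) by (apply RtoC_pos_neq; lra).
assert (E2 : forall v, (1 + v)%C <> RtoC 0 -> v = (RtoC 2 / (1 + (1 - v) / (1 + v)) - 1)%C).
{ intros v Hv. field. split; auto. intros H. apply N3. rewrite <- H. ring. }
rewrite (E2 u N1), (E2 w N2), E. reflexivity.
Qed.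

Lemma mob_comp_deriv_norm (h : C -> C) (l : C) :
  (forall z, Cmod z < 1 -> Cmod (h z) < 1) -> cderiv h (RtoC 0) l ->
  exists m, cderiv (fun z => mob (h (RtoC 0)) (h z)) (RtoC 0) m /\
    Cmod m * (1 - Cmod (h (RtoC 0)) ^ 2) = Cmod l.
Proof.
intros Hb Hl. assert (H0 : Cmod (RtoC 0) < 1) by (rewrite Cmod_0; lra).
assert (Ha := Hb _ H0). set (a := h (RtoC 0)) in *.
eexists. split.
- apply (cderiv_comp (mob a) h); [apply mob_cderiv; exact Ha|exact Hl].
- assert (Hs := Cmod_sq_lt_1 _ Ha).
  change (h (RtoC 0)) with a. rewrite Cconj_self, <- RtoC_minus.
  assert (Hn : RtoC (1 - Cmod a ^ 2) <> RtoC 0) by (apply RtoC_pos_neq; lra).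
  rewrite Cmod_mult, Cmod_div, Cmod_mult, Cmod_R, Rabs_pos_eq by (try lra; now apply Cmult_neq_0).
  field. lra.
Qed.

Section Geodesic.
Variables (k : C -> C2) (f : C2 -> C).
Hypothesis Hk : @holomorphic C_NormedModule C2 Defs.disc k.
Hypothesis Hks : forall z, Cmod z < 1 -> symbidisc (k z).
Hypothesis Hf : @holomorphic_map C2 C_NormedModule symbidisc Defs.disc f.
Hypothesis Hfk : forall z, Cmod z < 1 -> f (k z) = z.

Let S (z : C) : C := fst (k z).
Let P (z : C) : C := snd (k z).
Let Z (om z : C) : C := chart_z om (S z) (P z).
Let G (om z : C) : C := chart_g om (S z) (P z).

Lemma geodesic_chart (om : C) : circle om -> forall z, Cmod z < 1 ->
  chart_dom (Z om z) (G om z) /\ S z = point_s om (Z om z) (G om z) /\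
  P z = point_p om (Z om z) (G om z) /\
  (exists z', cderiv (Z om) z z') /\ (exists g', cderiv (G om) z g').
Proof.
intros Ho z Hz. destruct (symbidisc_chart om (k z) Ho (Hks z Hz)) as (H1 & H2 & H3).
split; [exact H2|]. split; [exact (f_equal fst H3)|]. split; [exact (f_equal snd H3)|].
destruct (holomorphic_curve k z (Hk z Hz)) as (s & p & Hs & Hp).
exact (chart_cderiv om S P z s p H1 Hs Hp).
Qed.

Lemma geodesic_speed (om : C) (cs sn : R) (z' g' : C) : circle om -> cs ^ 2 + sn ^ 2 = 1 ->
  cderiv (Z om) (RtoC 0) z' -> cderiv (G om) (RtoC 0) g' ->
  let Psi := fun w => Phi (om * ((cs, sn) * (cs, sn))) (S w, P w) in
  Cmod (C_derive Psi (RtoC 0)) / (1 - Cmod (Psi (RtoC 0)) ^ 2) =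
  hspeed cs sn (Z om (RtoC 0)) (G om (RtoC 0)) z' g'.
Proof.
intros Ho Hu HZ HG Psi.
destruct (Phi_curve om cs sn S P (Z om) (G om) (RtoC 0) z' g' 1 Ho Hu Rlt_0_1) as [l [Hl <-]]; auto.
- intros w Hw. replace (w - 0)%C with w in Hw by ring.
  destruct (geodesic_chart om Ho w Hw) as (H1 & H2 & H3 & _). auto.
- apply cderiv_C_derive in Hl. unfold Psi. rewrite Hl. reflexivity.
Qed.

Lemma geodesic_maximal_chart : exists om z' g', circle om /\
  cderiv (Z om) (RtoC 0) z' /\ cderiv (G om) (RtoC 0) g' /\
  forall cs sn, cs ^ 2 + sn ^ 2 = 1 ->
    hspeed cs sn (Z om (RtoC 0)) (G om (RtoC 0)) z' g' <=
    hspeed 1 0 (Z om (RtoC 0)) (G om (RtoC 0)) z' g'.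
Proof.
assert (H0 : Cmod (RtoC 0) < 1) by (rewrite Cmod_0; lra).
assert (C1 : circle (RtoC 1)) by (unfold circle; apply Cmod_1).
destruct (geodesic_chart (RtoC 1) C1 _ H0) as (D1 & _ & _ & [z1 HZ1] & [g1 HG1]).
destruct (hspeed_max _ _ z1 g1 D1) as [t0 Ht0].
set (c0 := cos t0) in *. set (s0 := sin t0) in *.
assert (Hu0 : c0 ^ 2 + s0 ^ 2 = 1).
{ generalize (sin2_cos2 t0). unfold Rsqr. fold c0 s0. intros; lra. }
set (om := ((c0, s0) * (c0, s0))%C).
assert (Co : circle om).
{ unfold circle, om. rewrite Cmod_mult.
  replace (Cmod (c0, s0)) with 1; [ring|]. unfold Cmod. simpl fst; simpl snd.
  now rewrite Hu0, sqrt_1. }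
destruct (geodesic_chart om Co _ H0) as (D2 & _ & _ & [z2 HZ2] & [g2 HG2]).
exists om, z2, g2. repeat (split; [assumption|]).
intros cs sn Hu.
assert (Hu1 : 1 ^ 2 + 0 ^ 2 = 1) by ring.
(* [c2 + i s2 = (c0 + i s0) (cs + i sn)]: the parameters based at [om] are those based at 1, rotated
   so that [(1, 0)] corresponds to the maximizer [(c0, s0)]. *)
set (c2 := c0 * cs - s0 * sn). set (s2 := c0 * sn + s0 * cs).
assert (Hu2 : c2 ^ 2 + s2 ^ 2 = 1).
{ replace (c2 ^ 2 + s2 ^ 2) with ((c0 ^ 2 + s0 ^ 2) * (cs ^ 2 + sn ^ 2)) by (unfold c2, s2; ring).
  rewrite Hu0, Hu. ring. }
rewrite <- (geodesic_speed om cs sn z2 g2 Co Hu HZ2 HG2).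
rewrite <- (geodesic_speed om 1 0 z2 g2 Co Hu1 HZ2 HG2).
specialize (Ht0 c2 s2 Hu2).
rewrite <- (geodesic_speed (RtoC 1) c2 s2 z1 g1 C1 Hu2 HZ1 HG1) in Ht0.
rewrite <- (geodesic_speed (RtoC 1) c0 s0 z1 g1 C1 Hu0 HZ1 HG1) in Ht0.
replace (1 * ((c2, s2) * (c2, s2)))%C with (om * ((cs, sn) * (cs, sn)))%C in Ht0.
2:{ unfold om, c2, s2. apply injective_projections; simpl; ring. }
replace (1 * ((c0, s0) * (c0, s0)))%C with (om * ((1, 0) * (1, 0)))%C in Ht0; [exact Ht0|].
unfold om. apply injective_projections; simpl; ring.
Qed.

(** The chain rule for [f (k w) = w] at 0, with the velocity of [k] written in the chart. *)
Lemma geodesic_velocity (om z' g' : C) : circle om ->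
  cderiv (Z om) (RtoC 0) z' -> cderiv (G om) (RtoC 0) g' ->
  forall L, @filterdiff C_AbsRing C2 C_NormedModule f (locally (k (RtoC 0))) L ->
  L (dpoint_s om (Z om (RtoC 0)) (G om (RtoC 0)) z' g',
     dpoint_p om (Z om (RtoC 0)) (G om (RtoC 0)) z' g') = RtoC 1.
Proof.
intros Ho HZ HG L HL.
assert (H0 : Cmod (RtoC 0) < 1) by (rewrite Cmod_0; lra).
destruct (geodesic_chart om Ho _ H0) as (D & E1 & E2 & _).
destruct (point_cderiv om (Z om) (G om) (RtoC 0) z' g' (chart_q_neq _ _ D) HZ HG) as [Hs Hp].
assert (E : k (RtoC 0) = (point_s om (Z om (RtoC 0)) (G om (RtoC 0)), point_p om (Z om (RtoC 0)) (G om (RtoC 0)))).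
{ rewrite <- E1, <- E2. unfold S, P. apply surjective_pairing. }
rewrite E in HL.
assert (H := cderiv_comp2 f (fun w => point_s om (Z om w) (G om w)) (fun w => point_p om (Z om w) (G om w))
  (RtoC 0) _ _ L HL Hs Hp).
apply (cderiv_unique _ _ _ _ H).
apply (cderiv_ext_loc (fun w => w)); [|apply cderiv_id].
exists 1. split; [lra|]. intros w Hw. replace (w - 0)%C with w in Hw by ring.
destruct (geodesic_chart om Ho w Hw) as (_ & F1 & F2 & _).
rewrite <- F1, <- F2. rewrite <- (Hfk w Hw) at 1. f_equal. unfold S, P. apply surjective_pairing.
Qed.

(** Maximality of the speed at [om] is the hypothesis of [tangent_quad], so some admissible
    [chart_curve] passes through [k 0] in the direction of [k]. Composed with [f] it maps the
    half-plane to the disc, vanishes at the base point and has derivative [1 / z'] there, because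
    [f] inverts [k]. Schwarz-Pick for this composition is the claimed lower bound. *)
Lemma geodesic_extremal_chart : exists om z', circle om /\
  cderiv (Z om) (RtoC 0) z' /\ 2 * fst (Z om (RtoC 0)) <= Cmod z'.
Proof.
destruct geodesic_maximal_chart as (om & z' & g' & Ho & HZ & HG & Hmax).
exists om, z'. split; [auto|split; [auto|]].
assert (H0 : Cmod (RtoC 0) < 1) by (rewrite Cmod_0; lra).
destruct (geodesic_chart om Ho _ H0) as (D & E1 & E2 & _).
assert (HL := proj1 Hf (k (RtoC 0)) (Hks _ H0)). destruct HL as [L HL].
assert (HL1 := geodesic_velocity om z' g' Ho HZ HG L HL).
assert (Ek : k (RtoC 0) = (point_s om (Z om (RtoC 0)) (G om (RtoC 0)), point_p om (Z om (RtoC 0)) (G om (RtoC 0)))).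
{ rewrite <- E1, <- E2. unfold S, P. apply surjective_pairing. }
set (z0 := Z om (RtoC 0)) in *. set (g0 := G om (RtoC 0)) in *.
assert (Hx := proj1 D).
(* If [z' = 0], the maximal speed is 0; the parameter [(0, 1)] then gives [g' = 0], so [k] has zero
   velocity at 0, against [geodesic_velocity]. *)
assert (Hz' : z' <> RtoC 0).
{ intros Ez. subst z'.
  assert (Hg : g' = RtoC 0).
  { specialize (Hmax 0 1 ltac:(ring)). rewrite hspeed_0, Cmod_0 in Hmax.
    unfold Rdiv in Hmax. rewrite Rmult_0_l in Hmax.
    assert (Hp := tnum_tden_pos 0 1 z0 g0 ltac:(ring) D).
    unfold hspeed in Hmax.
    set (den := 2 * fst (tnum 0 1 z0 g0 * Cconj (tden 0 1 z0))%C) in *.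
    assert (Hden : 0 < den) by (unfold den; simpl in *; lra).
    apply (Rmult_le_compat_r den) in Hmax; [|lra].
    unfold Rdiv in Hmax. rewrite Rmult_assoc, Rinv_l, Rmult_1_r, Rmult_0_l in Hmax by lra.
    assert (Hc : hderiv 0 1 z0 g0 (RtoC 0) g' = RtoC 0).
    { apply Cmod_eq_0. generalize (Cmod_ge_0 (hderiv 0 1 z0 g0 (RtoC 0) g')). intros; lra. }
    unfold hderiv, tden in Hc.
    replace (0 * ((0 - Ci * 1 * z0) * (0 - Ci * 1 * z0)) +
       Ci * 1 * g' * (0 - Ci * 1 * z0) + Ci * 1 * (Ci * 1) * g0 * 0)%C with (g' * z0)%C in Hc
      by (apply injective_projections; destruct g', z0; simpl; ring).
    assert (Hz0 := re_pos_neq z0 Hx).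
    replace g' with ((g' * z0) / z0)%C by (field; auto). rewrite Hc. field. auto. }
  subst g'.
  destruct (dpoint_scal om z0 g0 (RtoC 0) (RtoC 0) (RtoC 0)) as [F1 F2].
  rewrite !Cmult_0_l in F1, F2. rewrite F1, F2 in HL1.
  assert (HL0 : L (RtoC 0, RtoC 0) = RtoC 0) by exact (linear_zero L (proj1 HL)).
  rewrite HL1 in HL0.
  apply (f_equal fst) in HL0. simpl in HL0. lra. }
assert (Hzp : 0 < Cmod z') by now apply Cmod_gt_0.
set (gamma := (g' / z')%C).
assert (Eg : g' = (gamma * z')%C) by (unfold gamma; field; auto).
destruct (tangent_quad z0 g0 gamma D) as (a & b & c & Hadm & Eg0 & Egm).
{ intros t.
  assert (Ht : 0 < 1 + t ^ 2) by nra.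
  assert (Hsq := sqrt_lt_R0 _ Ht).
  (* Normalizes [(- t, 1)] to the unit circle, to test the maximality at slope [t]. *)
  set (q := / sqrt (1 + t ^ 2)).
  assert (Hq : 0 < q) by (now apply Rinv_0_lt_compat).
  assert (Hq2 : q ^ 2 * (1 + t ^ 2) = 1).
  { unfold q. rewrite <- (sqrt_sqrt (1 + t ^ 2)) at 2 by lra. field. lra. }
  specialize (Hmax (- t * q) q ltac:(lra)).
  rewrite hspeed_0, Eg, hspeed_slope in Hmax by (auto; lra).
  destruct (chart_cross_pos z0 g0 t D) as [H1 H2].
  assert (Hw : 0 < Cmod (z0 - Ci * t)).
  { apply Cmod_gt_0. apply re_pos_neq. destruct z0; simpl in *. lra. }
  assert (Hpos : 0 < fst z0 * Cmod (z0 - Ci * t) ^ 2 - fst (g0 * Cconj (z0 - Ci * t))%C).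
  { rewrite <- H2. apply Rmult_lt_0_compat; auto. nra. }
  set (X := Cmod _) in Hmax at 2.
  set (Y := fst z0 * Cmod (z0 - Ci * t) ^ 2 - fst (g0 * Cconj (z0 - Ci * t))%C) in *.
  fold X.
  apply (Rmult_le_compat_r (2 * Y * fst z0 / Cmod z')) in Hmax.
  - replace (Cmod z' * (X / (2 * Y)) * (2 * Y * fst z0 / Cmod z')) with (fst z0 * X) in Hmax
      by (field; lra).
    replace (Cmod z' / (2 * fst z0) * (2 * Y * fst z0 / Cmod z')) with Y in Hmax
      by (field; lra).
    exact Hmax.
  - left. apply Rdiv_lt_0_compat; auto. apply Rmult_lt_0_compat; lra. }
destruct (holomorphic_curve_comp f om a b c Ho Hadm Hf) as [HF1 HF2].
assert (Ecurve : chart_curve om a b c z0 = k (RtoC 0)).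
{ unfold chart_curve. rewrite <- Eg0. symmetry. exact Ek. }
destruct (HF1 z0 Hx) as [L2 [HL2 HD]].
rewrite Ecurve in HL2.
assert (HL3 := geodesic_velocity om z' g' Ho HZ HG L2 HL2). fold z0 g0 in HL3.
assert (Hp := pick_deriv (fun w => f (chart_curve om a b c w))).
specialize (Hp ltac:(intros u Hu; destruct (HF1 u Hu) as [M [_ HM]]; eauto) HF2 z0 _ Hx HD).
cbv beta in Hp. rewrite Ecurve, Hfk, Cmod_0 in Hp by auto.
assert (E1L : (z' * L2 (dcurve_s om a b c z0, dcurve_p om a b c z0))%C = RtoC 1).
{ rewrite <- HL3.
  destruct (dpoint_scal om z0 g0 (RtoC 1) gamma z') as [F1 F2].
  rewrite Cmult_1_r, (Cmult_comm z' gamma), <- Eg in F1, F2. rewrite F1, F2.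
  unfold dcurve_s, dcurve_p. rewrite <- Eg0, <- Egm.
  symmetry. exact (linear_scal L2 (proj1 HL2) z'
    (dpoint_s om z0 g0 (RtoC 1) gamma, dpoint_p om z0 g0 (RtoC 1) gamma)). }
apply (f_equal Cmod) in E1L. rewrite Cmod_mult, Cmod_1 in E1L.
set (m := Cmod (L2 (dcurve_s om a b c z0, dcurve_p om a b c z0))) in *.
apply (Rmult_le_compat_l (Cmod z')) in Hp; [|lra].
replace (Cmod z' * (2 * fst z0 * m)) with (2 * fst z0 * (Cmod z' * m)) in Hp by ring.
rewrite E1L in Hp. lra.
Qed.

Lemma geodesic_quadratic : exists om a b c, circle om /\ admissible a b c /\
  (forall z, Cmod z < 1 -> exists zeta : C, 0 < fst zeta /\ k z = chart_curve om a b c zeta) /\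
  (forall zeta : C, 0 < fst zeta -> exists z, Cmod z < 1 /\ k z = chart_curve om a b c zeta).
Proof.
destruct geodesic_extremal_chart as (om & z' & Ho & HZ & Hle).
assert (H0 : Cmod (RtoC 0) < 1) by (rewrite Cmod_0; lra).
assert (HC := geodesic_chart om Ho).
assert (Hpos : forall z, Cmod z < 1 -> 0 < fst (Z om z)).
{ intros z Hz. destruct (HC z Hz) as (D & _). apply D. }
set (h := fun z => ((1 - Z om z) / (1 + Z om z))%C).
assert (Hhb : forall z, Cmod z < 1 -> Cmod (h z) < 1).
{ intros z Hz. apply hp_to_disc. auto. }
assert (Hhd : forall z, Cmod z < 1 -> exists m, cderiv h z m).
{ intros z Hz. destruct (HC z Hz) as (_ & _ & _ & [m Hm] & _).
  eexists. apply hp_to_disc_cderiv; eauto. }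
assert (Hh0 := hp_to_disc_cderiv (Z om) (RtoC 0) z' (Hpos _ H0) HZ). fold h in Hh0.
destruct (mob_comp_deriv_norm h _ Hhb Hh0) as [m [Hm Hmn]].
assert (Ha := Hhb _ H0).
set (a := h (RtoC 0)) in *.
assert (Hmd : forall z, Cmod z < 1 -> exists l, cderiv (fun z => mob a (h z)) z l).
{ intros z Hz. destruct (Hhd z Hz) as [l Hl]. eexists.
  apply (cderiv_comp (mob a) h); [apply mob_cderiv; auto|exact Hl]. }
assert (Hmb : forall z, Cmod z < 1 -> Cmod (mob a (h z)) < 1).
{ intros z Hz. apply mob_disc; auto. }
assert (Hm0 : mob a (h (RtoC 0)) = RtoC 0) by (apply mob_0; auto).
(* The Schwarz lemma gives one inequality. The other is [2 Re Z <= |z'|] of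
   [geodesic_extremal_chart], transported by the Cayley and Moebius maps, which preserve hyperbolic
   speed. *)
assert (Hm1 : Cmod m = 1).
{ apply Rle_antisym; [now apply (schwarz_deriv_le _ _ Hmd Hmb)|].
  unfold a, h in Hmn. rewrite hp_to_disc_defect in Hmn by auto.
  assert (N := one_plus_neq _ (Hpos _ H0)).
  assert (Np : 0 < Cmod (1 + Z om 0)) by now apply Cmod_gt_0.
  rewrite Cmod_opp, Cmod_div, !Cmod_mult, Cmod_R, Rabs_pos_eq in Hmn
    by (try lra; now apply Cmult_neq_0).
  assert (Hx := Hpos _ H0).
  assert (E : Cmod m * (2 * fst (Z om (RtoC 0))) = Cmod z').
  { apply (f_equal (fun r => r * (Cmod (1 + Z om 0) ^ 2 / 2))) in Hmn.
    replace (Cmod m * (4 * fst (Z om 0) / Cmod (1 + Z om 0) ^ 2) * (Cmod (1 + Z om 0) ^ 2 / 2))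
      with (Cmod m * (2 * fst (Z om (RtoC 0)))) in Hmn by (field; lra).
    rewrite Hmn. field. lra. }
  apply Rmult_le_reg_r with (2 * fst (Z om (RtoC 0))); lra. }
assert (Hrot := schwarz_deriv_eq _ m Hmd Hmb Hm0 Hm Hm1). cbv beta in Hrot.
assert (Ecm : (Cconj m * m)%C = RtoC 1) by now apply circle_conj.
(* The inverse of [Z om]: undo the Cayley transform, apply [mob a] and rotate back by [Cconj m]. *)
set (psi := fun zeta : C => (Cconj m * mob a ((1 - zeta) / (1 + zeta)))%C).
assert (Hpsi : forall zeta : C, 0 < fst zeta -> Cmod (psi zeta) < 1).
{ intros zeta Hzeta. unfold psi. apply disc_mult_circle.
  - unfold circle. now rewrite Cmod_conj.
  - apply mob_disc; auto. now apply hp_to_disc. }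
assert (HZpsi : forall zeta : C, 0 < fst zeta -> Z om (psi zeta) = zeta).
{ intros zeta Hzeta. apply cayley_inj; auto.
  apply (mob_inj a); auto.
  - now apply (Hhb (psi zeta)), Hpsi.
  - now apply hp_to_disc.
  - fold (h (psi zeta)). rewrite Hrot by auto. unfold psi.
    replace (m * (Cconj m * mob a ((1 - zeta) / (1 + zeta))))%C
      with ((Cconj m * m) * mob a ((1 - zeta) / (1 + zeta)))%C by ring.
    rewrite Ecm. ring. }
assert (HpsiZ : forall z, Cmod z < 1 -> psi (Z om z) = z).
{ intros z Hz. unfold psi. fold (h z). rewrite Hrot by auto.
  rewrite Cmult_assoc, Ecm. ring. }
assert (Hpsid : forall zeta : C, 0 < fst zeta -> exists l, cderiv psi zeta l).
{ intros zeta Hzeta. eexists. apply cderiv_scal.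
  apply (cderiv_comp (mob a) (fun zeta => (1 - zeta) / (1 + zeta))%C).
  - apply mob_cderiv; auto. now apply hp_to_disc.
  - apply (hp_to_disc_cderiv (fun z => z)); auto. apply cderiv_id. }
destruct (chart_graph_quadratic (fun zeta => G om (psi zeta))) as (q2 & q1 & q0 & Hadm & Hq).
{ intros zeta Hzeta. destruct (Hpsid zeta Hzeta) as [l Hl].
  destruct (HC (psi zeta) (Hpsi zeta Hzeta)) as (_ & _ & _ & _ & [g' Hg']).
  eexists. apply (cderiv_comp (G om) psi); eauto. }
{ intros zeta Hzeta. destruct (HC (psi zeta) (Hpsi zeta Hzeta)) as (D & _).
  rewrite HZpsi in D by auto. exact D. }
assert (Hcurve : forall z, Cmod z < 1 -> k z = chart_curve om q2 q1 q0 (Z om z)).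
{ intros z Hz. unfold chart_curve. rewrite <- Hq by auto. rewrite HpsiZ by auto.
  destruct (HC z Hz) as (_ & E1 & E2 & _). rewrite <- E1, <- E2.
  unfold S, P. apply surjective_pairing. }
exists om, q2, q1, q0. split; [auto|split; [auto|split]].
- intros z Hz. exists (Z om z). auto.
- intros zeta Hzeta. exists (psi zeta). split; auto.
  rewrite Hcurve, HZpsi by auto. reflexivity.
Qed.
End Geodesic.

Theorem geodesic_normal_form (D : C2 -> Prop) : complex_geodesic D ->
  exists om a b c, circle om /\ admissible a b c /\
    forall x, D x <-> exists z : C, 0 < fst z /\ x = chart_curve om a b c z.
Proof.
intros (k & [Hk Hks] & (f & Hf & Hfk) & HD).
destruct (geodesic_quadratic k f Hk Hks Hf Hfk) as (om & a & b & c & Ho & Ha & H1 & H2).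
exists om, a, b, c. split; [auto|split; [auto|]].
intros x. rewrite HD. split.
- intros (z & Hz & ->). destruct (H1 z Hz) as (zeta & Hzeta & E). eauto.
- intros (zeta & Hzeta & ->). destruct (H2 zeta Hzeta) as (z & Hz & E). exists z. split; auto.
Qed.

(** * Convergence of sequences in C and C^2 *)

(** Stated with the [Cmod] balls used by [cderiv]; [filterlim_ctends] and [closure_ctends] translate
    from the product structure of [C2]. *)
Definition ctends (u : nat -> C) (l : C) : Prop :=
  filterlim u eventually (@locally (AbsRing_UniformSpace C_AbsRing) l).

Lemma ctends_eps (u : nat -> C) (l : C) : ctends u l <->
  forall eps, 0 < eps -> exists N, forall n, (N <= n)%nat -> Cmod (u n - l) < eps.
Proof.
split.
- intros H eps Heps. apply (H (fun w => Cmod (w - l) < eps)).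
  now exists (mkposreal eps Heps).
- intros H Q [eps HQ]. destruct (H eps (cond_pos eps)) as [N HN].
  exists N. intros n Hn. apply HQ, (HN n Hn).
Qed.

Lemma ctends_const (c : C) : ctends (fun _ => c) c.
Proof. apply (filterlim_const (U := AbsRing_UniformSpace C_AbsRing)). Qed.

Lemma ctends_plus u v l m : ctends u l -> ctends v m ->
  ctends (fun n => u n + v n)%C (l + m)%C.
Proof.
intros Hu Hv. apply (filterlim_comp_2 u v Cplus Hu Hv).
apply (filterlim_plus (V := AbsRing_NormedModule C_AbsRing)).
Qed.

Lemma ctends_mult u v l m : ctends u l -> ctends v m ->
  ctends (fun n => u n * v n)%C (l * m)%C.
Proof.
intros Hu Hv. apply (filterlim_comp_2 u v Cmult Hu Hv).
apply (filterlim_mult (K := C_AbsRing)).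
Qed.

Lemma ctends_minus u v l m : ctends u l -> ctends v m ->
  ctends (fun n => u n - v n)%C (l - m)%C.
Proof.
intros Hu Hv. apply ctends_plus; auto. apply (filterlim_comp _ _ _ v Copp _ _ _ Hv).
apply (filterlim_opp (V := AbsRing_NormedModule C_AbsRing)).
Qed.

Lemma ctends_cderiv (f : C -> C) u l d : cderiv f l d -> ctends u l ->
  ctends (fun n => f (u n)) (f l).
Proof.
intros Hf Hu. apply (filterlim_comp _ _ _ u f _ _ _ Hu).
apply (ex_derive_continuous (V := AbsRing_NormedModule C_AbsRing)). now exists d.
Qed.

Lemma ctends_div u v l m : m <> RtoC 0 -> ctends u l -> ctends v m ->
  ctends (fun n => u n / v n)%C (l / m)%C.
Proof.
intros Hm Hu Hv. apply ctends_mult; auto.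
exact (ctends_cderiv (fun z => / z)%C v m _ (cderiv_inv_id m Hm) Hv).
Qed.

Ltac ctends_tac :=
  lazymatch goal with
  | |- ctends (fun _ => ?k) _ => apply ctends_const
  | |- ctends (fun n => @?u n + @?v n)%C _ => apply (ctends_plus u v); ctends_tac
  | |- ctends (fun n => @?u n - @?v n)%C _ => apply (ctends_minus u v); ctends_tac
  | |- ctends (fun n => @?u n * @?v n)%C _ => apply (ctends_mult u v); ctends_tac
  | |- ctends (fun n => @?u n / @?v n)%C _ => apply (ctends_div u v); [auto|ctends_tac|ctends_tac]
  | _ => assumption
  end.

Lemma ctends_unique u l m : ctends u l -> ctends u m -> l = m.
Proof.
apply (filterlim_locally_unique (V := AbsRing_NormedModule C_AbsRing)).
Qed.

Lemma ctends_ext (u v : nat -> C) l : (forall n, u n = v n) -> ctends u l -> ctends v l.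
Proof. apply filterlim_ext. Qed.

Lemma ctends_zero u l : (forall n, u n = RtoC 0) -> ctends u l -> l = RtoC 0.
Proof.
intros H Hu. apply (ctends_unique u); auto.
apply (ctends_ext (fun _ => RtoC 0)); [auto|apply ctends_const].
Qed.

Lemma C_ball_Cmod (x y : C) (eps : R) : 0 < eps ->
  @ball C_UniformSpace x eps y -> Cmod (y - x) < 2 * eps.
Proof.
intros Heps H.
assert (H2 := C_NormedModule_mixin_compat2 x y (mkposreal eps Heps) H).
change (minus y x) with (y - x)%C in H2. simpl in H2.
assert (sqrt 2 < 2).
{ assert (Hs := sqrt_sqrt 2 ltac:(lra)). assert (Hp := sqrt_pos 2). nra. }
nra.
Qed.

Lemma filterlim_ctends (u : nat -> C2) (x : C2) :
  filterlim u eventually (locally x) ->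
  ctends (fun n => fst (u n)) (fst x) /\ ctends (fun n => snd (u n)) (snd x).
Proof.
intros H. split; apply ctends_eps; intros eps Heps.
all: assert (He2 : 0 < eps / 2) by lra.
all: destruct (H (ball x (mkposreal _ He2))) as [N HN]; [now exists (mkposreal _ He2)|].
all: exists N; intros n Hn; destruct (HN n Hn) as [B1 B2]; simpl in B1, B2.
all: replace eps with (2 * (eps / 2)) by field; apply C_ball_Cmod; auto.
Qed.

Lemma closure_ctends (V : C2 -> Prop) (x : C2) : closure V x <->
  exists u : nat -> C2, (forall n, V (u n)) /\
    ctends (fun n => fst (u n)) (fst x) /\ ctends (fun n => snd (u n)) (snd x).
Proof.
split.
- intros H.
  assert (Hn : forall n : nat, 0 < / (INR n + 1)).
  { intros n. apply Rinv_0_lt_compat. generalize (pos_INR n). lra. }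
  assert (Hc : forall n : nat, exists y, ball x (/ (INR n + 1)) y /\ V y).
  { intros n. exact (H (mkposreal _ (Hn n))). }
  exists (fun n => proj1_sig (constructive_indefinite_description _ (Hc n))).
  assert (Hu : forall n, ball x (/ (INR n + 1)) (proj1_sig (constructive_indefinite_description _ (Hc n))) /\
     V (proj1_sig (constructive_indefinite_description _ (Hc n)))).
  { intros n. destruct constructive_indefinite_description as [y Hy]. exact Hy. }
  set (u := fun n => proj1_sig (constructive_indefinite_description _ (Hc n))) in *.
  split; [intros n; apply Hu|].
  assert (HN : forall eps, 0 < eps -> exists N, forall n, (N <= n)%nat -> 2 * / (INR n + 1) < eps).
  { intros eps Heps. destruct (archimed_cor1 (eps / 2)) as [N [HN1 HN2]]; [lra|].
    exists N. intros n Hn2.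
    assert (/ (INR n + 1) <= / INR N).
    { apply Rinv_le_contravar; [apply lt_0_INR; lia|]. apply le_INR in Hn2. lra. }
    lra. }
  split; apply ctends_eps; intros eps Heps; destruct (HN eps Heps) as [N H1]; exists N; intros n Hn2;
    specialize (H1 n Hn2); destruct (Hu n) as [[B1 B2] _].
  + eapply Rlt_trans; [|exact H1]. apply C_ball_Cmod; auto.
  + eapply Rlt_trans; [|exact H1]. apply C_ball_Cmod; auto.
- intros (u & Hu & H1 & H2) eps. rewrite ctends_eps in H1, H2.
  destruct (H1 eps (cond_pos eps)) as [N1 E1]. destruct (H2 eps (cond_pos eps)) as [N2 E2].
  exists (u (max N1 N2)). split; auto.
  split; apply C_NormedModule_mixin_compat1; [apply E1|apply E2]; lia.
Qed.

(** * Equations of a geodesic *)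

Definition chart_num (om p : C) : C := (1 - om * om * p)%C.

(** With [A = chart_den] and [B = chart_num] one has [zeta = B / A] and
    [g = ((A + B)^2 - 4 A) / A^2], so this is the equation [g = quad a b c zeta] multiplied by
    [A^2]. Being polynomial in [s] and [p], it passes to the closure, also where [A = 0]. *)
Definition geodesic_eq (om : C) (a b c : R) (s p : C) : Prop :=
  let A := chart_den om s p in
  let B := chart_num om p in
  ((A + B) * (A + B) - RtoC 4 * A - (a * (B * B) + Ci * b * (A * B) - c * (A * A)))%C = RtoC 0.

Lemma chart_curve_values (om : C) (a b c : R) (z : C) :
  circle om -> admissible a b c -> 0 < fst z ->
  let q := chart_q z (quad a b c z) in
  q <> RtoC 0 /\
  chart_den om (fst (chart_curve om a b c z)) (snd (chart_curve om a b c z)) = (RtoC 4 / q)%C /\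
  chart_num om (snd (chart_curve om a b c z)) = (RtoC 4 * z / q)%C.
Proof.
intros Ho Ha Hz q.
assert (Hq : q <> RtoC 0) by (apply chart_q_neq; now apply quad_chart_dom).
destruct (chart_point om z (quad a b c z) Ho Hq) as (E1 & E2 & _).
split; [auto|split; [exact E1|]].
unfold chart_z in E2. rewrite E1 in E2. fold q in E2.
assert (N4 : RtoC 4 <> RtoC 0) by (apply RtoC_pos_neq; lra).
transitivity (z * (RtoC 4 / q))%C; [|field; auto].
rewrite <- E2 at 2. unfold chart_num, chart_curve. cbn [snd]. field. auto.
Qed.

Lemma chart_curve_eq (om : C) (a b c : R) (z : C) :
  circle om -> admissible a b c -> 0 < fst z ->
  geodesic_eq om a b c (fst (chart_curve om a b c z)) (snd (chart_curve om a b c z)).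
Proof.
intros Ho Ha Hz. destruct (chart_curve_values om a b c z Ho Ha Hz) as (Hq & E1 & E2).
unfold geodesic_eq. rewrite E1, E2. set (q := chart_q z (quad a b c z)) in *.
transitivity (RtoC 16 * (((z + 1) * (z + 1) - quad a b c z) - q) / (q * q))%C.
- unfold quad. replace (RtoC 16) with (RtoC 4 * RtoC 4)%C by (rewrite <- RtoC_mult; f_equal; ring).
  field. auto.
- unfold q, chart_q. field. auto.
Qed.

Lemma geodesic_eq_curve (om : C) (a b c : R) (x : C2) : circle om -> symbidisc x ->
  geodesic_eq om a b c (fst x) (snd x) ->
  exists z : C, 0 < fst z /\ x = chart_curve om a b c z.
Proof.
intros Ho Hx He. destruct (symbidisc_chart om x Ho Hx) as (HA & HD & E).
exists (chart_z om (fst x) (snd x)). split; [apply HD|].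
unfold chart_curve.
replace (quad a b c (chart_z om (fst x) (snd x))) with (chart_g om (fst x) (snd x)); [exact E|].
unfold geodesic_eq in He. unfold chart_g, quad, chart_z. fold (chart_num om (snd x)).
set (B := chart_num om (snd x)) in *.
replace (1 + om * fst x + om * om * snd x)%C with (RtoC 4 - RtoC 2 * B - chart_den om (fst x) (snd x))%C
  by (unfold B, chart_num, chart_den; change (fst x) with ((fst x) : C); ring).
set (A := chart_den om (fst x) (snd x)) in *.
replace (RtoC 4 - RtoC 2 * B - A)%C with
  ((B * B - (a * (B * B) + Ci * b * (A * B) - c * (A * A)) -
   ((A + B) * (A + B) - RtoC 4 * A - (a * (B * B) + Ci * b * (A * B) - c * (A * A)))) / A)%C
  by (field; auto).
rewrite He. field. auto.
Qed.

(** For [a = 1] the terms in [B^2] cancel and [geodesic_eq] is [A] times this affine expression.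
    Unlike [geodesic_eq], it fails at [A = B = 0], which is how the point at infinity is excluded
    from a flat geodesic. *)
Lemma chart_curve_eq_flat (om : C) (b c : R) (z : C) :
  circle om -> admissible 1 b c -> 0 < fst z ->
  ((RtoC 2 - Ci * b) * chart_num om (snd (chart_curve om 1 b c z)) +
   (1 + c) * chart_den om (fst (chart_curve om 1 b c z)) (snd (chart_curve om 1 b c z)) - RtoC 4)%C
  = RtoC 0.
Proof.
intros Ho Ha Hz. destruct (chart_curve_values om 1 b c z Ho Ha Hz) as (Hq & E1 & E2).
rewrite E1, E2. set (q := chart_q z (quad 1 b c z)) in *.
transitivity (RtoC 4 * (((RtoC 2 - Ci * b) * z + 1 + c) - q) / q)%C; [field; auto|].
unfold q at 1, chart_q, quad. field. auto.
Qed.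

Lemma chart_den_ctends om (u : nat -> C2) (x : C2) :
  ctends (fun n => fst (u n)) (fst x) -> ctends (fun n => snd (u n)) (snd x) ->
  ctends (fun n => chart_den om (fst (u n)) (snd (u n))) (chart_den om (fst x) (snd x)) /\
  ctends (fun n => chart_num om (snd (u n))) (chart_num om (snd x)).
Proof.
intros H1 H2. unfold chart_den, chart_num. split; ctends_tac.
Qed.

Section Closure.
Variables (om : C) (a b c : R) (D : C2 -> Prop).
Hypothesis Ho : circle om.
Hypothesis Ha : admissible a b c.
Hypothesis HD : forall x, D x <-> exists z : C, 0 < fst z /\ x = chart_curve om a b c z.

Lemma closure_geodesic_eq (x : C2) : closure D x -> geodesic_eq om a b c (fst x) (snd x).
Proof.
intros H. apply closure_ctends in H. destruct H as (u & Hu & H1 & H2).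
destruct (chart_den_ctends om u x H1 H2) as [HA HB].
unfold geodesic_eq.
set (A := fun n => chart_den om (fst (u n)) (snd (u n))) in *.
set (B := fun n => chart_num om (snd (u n))) in *.
apply (ctends_zero (fun n => (A n + B n) * (A n + B n) - RtoC 4 * A n
    - (a * (B n * B n) + Ci * b * (A n * B n) - c * (A n * A n)))%C).
- intros n. destruct (proj1 (HD (u n)) (Hu n)) as (z & Hz & E).
  unfold A, B. rewrite E. now apply chart_curve_eq.
- ctends_tac.
Qed.

Lemma closure_geodesic_eq_flat (x : C2) : a = 1 -> closure D x ->
  ((RtoC 2 - Ci * b) * chart_num om (snd x) + (1 + c) * chart_den om (fst x) (snd x) - RtoC 4)%C
  = RtoC 0.
Proof.
intros Ea H. apply closure_ctends in H. destruct H as (u & Hu & H1 & H2).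
destruct (chart_den_ctends om u x H1 H2) as [HA HB].
apply (ctends_zero (fun n => (RtoC 2 - Ci * b) * chart_num om (snd (u n)) +
   (1 + c) * chart_den om (fst (u n)) (snd (u n)) - RtoC 4)%C).
- intros n. destruct (proj1 (HD (u n)) (Hu n)) as (z & Hz & E).
  rewrite E. revert Ha. rewrite Ea. intros Ha'. now apply chart_curve_eq_flat.
- ctends_tac.
Qed.

(** Needed for infinitesimal data, where contact only makes the base point a limit of points of
    [D]. *)
Lemma geodesic_closed_in (x : C2) : symbidisc x -> closure D x -> D x.
Proof. intros Hx H. apply HD. apply geodesic_eq_curve; auto. now apply closure_geodesic_eq. Qed.
End Closure.

(** * Chords, tangents and contact *)

(** The divided difference of [chart_q] along the curve. Up to the factor
    [- 4 (w - z) / (q(z) q(w))], with [q] the value of [chart_q] on the curve, the chord from [z] to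
    [w] is [(chord_s, chord_p)], which remains meaningful at [w = z], where it gives the tangent
    direction. *)
Definition slope (a b : R) (z w : C) : C := (z + w + RtoC 2 - a * (z + w) - Ci * b)%C.
Definition chord_s (om : C) (a b c : R) (z w : C) : C :=
  (Cconj om * (chart_q z (quad a b c z) - (z + 1) * slope a b z w))%C.
Definition chord_p (om : C) (a b c : R) (z w : C) : C :=
  (Cconj om * Cconj om * (chart_q z (quad a b c z) - z * slope a b z w))%C.

Lemma chart_curve_chord (om : C) (a b c : R) (z w : C) :
  circle om -> admissible a b c -> 0 < fst z -> 0 < fst w ->
  ((fst (chart_curve om a b c w) - fst (chart_curve om a b c z)) * chord_p om a b c z w -
   (snd (chart_curve om a b c w) - snd (chart_curve om a b c z)) * chord_s om a b c z w)%C = RtoC 0.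
Proof.
intros Ho Ha Hz Hw.
assert (Hq1 := chart_q_neq _ _ (quad_chart_dom a b c z Ha Hz)).
assert (Hq2 := chart_q_neq _ _ (quad_chart_dom a b c w Ha Hw)).
unfold chart_curve. cbn [fst snd]. unfold point_s, point_p, chord_s, chord_p.
assert (E : chart_q w (quad a b c w) = (chart_q z (quad a b c z) + (w - z) * slope a b z w)%C).
{ unfold chart_q, quad, slope. ring. }
set (q2 := chart_q w (quad a b c w)) in *. set (q := chart_q z (quad a b c z)) in *.
set (m := slope a b z w) in *.
transitivity (Cconj om * Cconj om * Cconj om * RtoC 4 / (q * q2) *
  ((- ((w + 1) * q - (z + 1) * q2)) * (q - z * m) - (- (w * q - z * q2)) * (q - (z + 1) * m)))%C.
- field. auto.
- rewrite E. unfold Cdiv. ring.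
Qed.

(** Without their unit factors the components are [q - (z + 1) m] and [q - z m], and [q] is
    recovered as [(z + 1) (q - z m) - z (q - (z + 1) m)]. *)
Lemma chord_neq (om : C) (a b c : R) (z : C) :
  circle om -> admissible a b c -> 0 < fst z ->
  chord_s om a b c z z = RtoC 0 -> chord_p om a b c z z = RtoC 0 -> False.
Proof.
intros Ho Ha Hz E1 E2.
assert (Hq := chart_q_neq _ _ (quad_chart_dom a b c z Ha Hz)).
assert (Hc : Cconj om <> RtoC 0) by (apply Cmod_gt_0; rewrite Cmod_conj, Ho; lra).
unfold chord_s, chord_p in *. apply Hq.
set (q := chart_q z (quad a b c z)) in *. set (m := slope a b z z) in *.
replace q with ((z + 1) * ((Cconj om * Cconj om * (q - z * m)) / (Cconj om * Cconj om))
   - z * ((Cconj om * (q - (z + 1) * m)) / Cconj om))%C by (field; auto).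
rewrite E1, E2. field. auto.
Qed.

Lemma dcurve_chord (om : C) (a b c : R) (z : C) :
  dcurve_s om a b c z = (- RtoC 4 / (chart_q z (quad a b c z) * chart_q z (quad a b c z)) * chord_s om a b c z z)%C /\
  dcurve_p om a b c z = (- RtoC 4 / (chart_q z (quad a b c z) * chart_q z (quad a b c z)) * chord_p om a b c z z)%C.
Proof.
assert (E : dpoint_den z (RtoC 1) (dquad a b z) = slope a b z z).
{ unfold dpoint_den, slope, dquad. ring. }
unfold dcurve_s, dcurve_p, dpoint_s, dpoint_p, chord_s, chord_p. rewrite E.
unfold Cdiv. split; ring.
Qed.

Lemma C_collinear (a1 a2 b1 b2 : C) : (b1 = RtoC 0 -> b2 = RtoC 0 -> False) ->
  (a1 * b2 - a2 * b1)%C = RtoC 0 -> exists mu : C, a1 = (mu * b1)%C /\ a2 = (mu * b2)%C.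
Proof.
intros Hn E.
destruct (excluded_middle_informative (b1 = RtoC 0)) as [Z1|Z1].
- destruct (excluded_middle_informative (b2 = RtoC 0)) as [Z2|Z2]; [tauto|].
  exists (a2 / b2)%C. split; [|field; auto].
  replace a1 with ((a1 * b2 - a2 * b1 + a2 * b1) / b2)%C by (field; auto).
  rewrite E, Z1. field. auto.
- exists (a1 / b1)%C. split; [field; auto|].
  replace a2 with ((a1 * b2 - (a1 * b2 - a2 * b1)) / b1)%C by (field; auto).
  rewrite E. field. auto.
Qed.

Section Contact.
Variables (om : C) (a b c : R) (D : C2 -> Prop).
Hypothesis Ho : circle om.
Hypothesis Ha : admissible a b c.
Hypothesis HD : forall x, D x <-> exists z : C, 0 < fst z /\ x = chart_curve om a b c z.

Lemma chord_ctends (u v : nat -> C) (z : C) : ctends u z -> ctends v z ->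
  ctends (fun n => chord_s om a b c (u n) (v n)) (chord_s om a b c z z) /\
  ctends (fun n => chord_p om a b c (u n) (v n)) (chord_p om a b c z z).
Proof.
intros Hu Hv.
assert (Hq := ctends_cderiv (quad a b c) u z _ (quad_cderiv a b c z) Hu).
unfold chord_s, chord_p, chart_q, slope. split; ctends_tac.
Qed.

Lemma chart_z_ctends (u : nat -> C2) (z : C) : 0 < fst z ->
  ctends (fun n => fst (u n)) (fst (chart_curve om a b c z)) ->
  ctends (fun n => snd (u n)) (snd (chart_curve om a b c z)) ->
  ctends (fun n => chart_z om (fst (u n)) (snd (u n))) z.
Proof.
intros Hz H1 H2.
destruct (chart_den_ctends om u _ H1 H2) as [HA HB].
destruct (chart_curve_values om a b c z Ho Ha Hz) as (Hq & E1 & E2).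
rewrite E1 in HA. rewrite E2 in HB.
assert (N4 : RtoC 4 <> RtoC 0) by (apply RtoC_pos_neq; lra).
set (q := chart_q z (quad a b c z)) in *.
replace z with ((RtoC 4 * z / q) / (RtoC 4 / q))%C by (field; auto).
apply (ctends_div (fun n => chart_num om (snd (u n))) (fun n => chart_den om (fst (u n)) (snd (u n)))); auto.
intros E. apply N4. replace (RtoC 4) with (RtoC 4 / q * q)%C by (field; auto).
rewrite E. ring.
Qed.

Lemma chart_curve_z (z : C) : 0 < fst z ->
  chart_z om (fst (chart_curve om a b c z)) (snd (chart_curve om a b c z)) = z.
Proof.
intros Hz. apply chart_point; auto. apply chart_q_neq. now apply quad_chart_dom.
Qed.

(** The parameters of [xn] and [yn] are recovered continuously by [chart_z] and converge to that of
    the base point. The normalized secants are parallel to the chord vectors, which converge to a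
    nonzero tangent vector; so [v0], and with it [v], is a multiple of that tangent. *)
Lemma contacts_param (delta : datum C2) :
  datum_in symbidisc delta -> nondegenerate delta -> contacts delta D ->
  (exists z1 z2 : C, 0 < fst z1 /\ 0 < fst z2 /\ z1 <> z2 /\
     delta = Discrete (chart_curve om a b c z1) (chart_curve om a b c z2)) \/
  (exists z l : C, 0 < fst z /\ l <> RtoC 0 /\
     delta = Infinitesimal (chart_curve om a b c z)
       ((l * dcurve_s om a b c z)%C, (l * dcurve_p om a b c z)%C)).
Proof.
destruct delta as [x y|x v]; cbn [datum_in nondegenerate contacts].
- intros _ Hn [Hx Hy]. left.
  apply HD in Hx, Hy. destruct Hx as (z1 & H1 & ->). destruct Hy as (z2 & H2 & ->).
  exists z1, z2. repeat split; auto. intros E. apply Hn. now rewrite E.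
- intros Hx Hv [[E _]|(xn & yn & v0 & HV & Lx & Ly & Lv & Hnorm & [k Hk])]; [contradiction|].
  right. apply filterlim_ctends in Lx, Ly, Lv.
  destruct Lx as [Lx1 Lx2]. destruct Ly as [Ly1 Ly2]. destruct Lv as [Lv1 Lv2].
  assert (Dx : D x).
  { apply (geodesic_closed_in om a b c D Ho Ha HD); auto.
    apply closure_ctends. exists xn. repeat split; auto. intros n; apply HV. }
  apply HD in Dx. destruct Dx as (z & Hz & ->).
  set (zn := fun n => chart_z om (fst (xn n)) (snd (xn n))).
  set (wn := fun n => chart_z om (fst (yn n)) (snd (yn n))).
  assert (Hzn : forall n, 0 < fst (zn n) /\ xn n = chart_curve om a b c (zn n)).
  { intros n. destruct (HV n) as (Hn & _). apply HD in Hn. destruct Hn as (u & Hu & E).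
    unfold zn. rewrite E, chart_curve_z by auto. auto. }
  assert (Hwn : forall n, 0 < fst (wn n) /\ yn n = chart_curve om a b c (wn n)).
  { intros n. destruct (HV n) as (_ & Hn & _). apply HD in Hn. destruct Hn as (u & Hu & E).
    unfold wn. rewrite E, chart_curve_z by auto. auto. }
  assert (Tz : ctends zn z) by now apply chart_z_ctends.
  assert (Tw : ctends wn z) by now apply chart_z_ctends.
  destruct (chord_ctends zn wn z Tz Tw) as [Ts Tp].
  assert (E0 : (fst v0 * chord_p om a b c z z - snd v0 * chord_s om a b c z z)%C = RtoC 0).
  { apply (ctends_zero (fun n =>
      fst (scal (RtoC (/ norm (minus (yn n) (xn n)))) (minus (yn n) (xn n))) * chord_p om a b c (zn n) (wn n) -
      snd (scal (RtoC (/ norm (minus (yn n) (xn n)))) (minus (yn n) (xn n))) * chord_s om a b c (zn n) (wn n))%C).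
    - intros n. set (r := RtoC (/ norm (minus (yn n) (xn n)))).
      change (fst (scal r (minus (yn n) (xn n)))) with (r * (fst (yn n) - fst (xn n)))%C.
      change (snd (scal r (minus (yn n) (xn n)))) with (r * (snd (yn n) - snd (xn n)))%C.
      destruct (Hzn n) as [P1 ->]. destruct (Hwn n) as [P2 ->].
      assert (E := chart_curve_chord om a b c (zn n) (wn n) Ho Ha P1 P2).
      set (s1 := fst (chart_curve om a b c (wn n))) in *. set (s2 := fst (chart_curve om a b c (zn n))) in *.
      set (p1 := snd (chart_curve om a b c (wn n))) in *. set (p2 := snd (chart_curve om a b c (zn n))) in *.
      transitivity (r * ((s1 - s2) * chord_p om a b c (zn n) (wn n) - (p1 - p2) * chord_s om a b c (zn n) (wn n)))%C;
        [ring|].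
      rewrite E. ring.
    - ctends_tac. }
  assert (Hq := chart_q_neq _ _ (quad_chart_dom a b c z Ha Hz)).
  destruct (dcurve_chord om a b c z) as [Es Ep].
  set (cs := chord_s om a b c z z) in *. set (cp := chord_p om a b c z z) in *.
  set (q := chart_q z (quad a b c z)) in *.
  assert (N4 : RtoC 4 <> RtoC 0) by (apply RtoC_pos_neq; lra).
  assert (Hmu : exists mu : C, fst v0 = (mu * cs)%C /\ snd v0 = (mu * cp)%C).
  { apply C_collinear; auto. intros Zs Zp. exact (chord_neq om a b c z Ho Ha Hz Zs Zp). }
  destruct Hmu as (mu & M1 & M2).
  (* Inverts the factor [- 4 / q^2] between the chord vector and the derivative of the curve in
     [dcurve_chord]. *)
  set (l := (- (k * mu * (q * q)) / RtoC 4)%C).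
  assert (Ev : v = ((l * dcurve_s om a b c z)%C, (l * dcurve_p om a b c z)%C)).
  { rewrite Hk, Es, Ep. rewrite (surjective_pairing v0).
    change (scal k (fst v0, snd v0)) with ((k * fst v0)%C, (k * snd v0)%C).
    rewrite M1, M2. unfold l. f_equal; field; auto. }
  exists z, l. split; [auto|split].
  + intros El. apply Hv. rewrite Ev, El, !Cmult_0_l. reflexivity.
  + now rewrite <- Ev.
Qed.
End Contact.

(** * The royal variety and its intersection with the closure of a geodesic *)

Definition royal_point (z : C) : C2 := ((RtoC 2 * z)%C, (z * z)%C).

Lemma inv_INR_ctends : ctends (fun n => RtoC (/ (INR n + 1))) (RtoC 0).
Proof.
apply ctends_eps. intros eps Heps. destruct (archimed_cor1 eps Heps) as [N [HN1 HN2]].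
exists N. intros n Hn.
assert (Hp : 0 < INR N) by (apply lt_0_INR; lia).
assert (/ (INR n + 1) <= / INR N).
{ apply Rinv_le_contravar; auto. apply le_INR in Hn. lra. }
replace (RtoC (/ (INR n + 1)) - 0)%C with (RtoC (/ (INR n + 1))) by ring.
rewrite Cmod_R, Rabs_pos_eq; [lra|].
left. apply Rinv_0_lt_compat. generalize (pos_INR n). lra.
Qed.

Lemma ctends_Cmod_le (u : nat -> C) l M : ctends u l -> (forall n, Cmod (u n) <= M) -> Cmod l <= M.
Proof.
intros H HM. rewrite ctends_eps in H. apply le_epsilon. intros eps Heps. destruct (H eps Heps) as [N HN].
specialize (HN N (le_n N)). specialize (HM N).
assert (H1 := Cmod_triangle_rev l (u N)).
replace (l - u N)%C with (- (u N - l))%C in H1 by ring. rewrite Cmod_opp in H1. lra.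
Qed.

Lemma closure_royal (x : C2) :
  closure royal_variety x <-> exists z : C, Cmod z <= 1 /\ x = royal_point z.
Proof.
assert (N2 : RtoC 2 <> RtoC 0) by (apply RtoC_pos_neq; lra).
rewrite closure_ctends. split.
- intros (u & Hu & H1 & H2).
  set (zn := fun n => (fst (u n) / RtoC 2)%C).
  assert (Hz : forall n, Cmod (zn n) <= 1 /\ (RtoC 2 * zn n)%C = fst (u n) /\ (zn n * zn n)%C = snd (u n)).
  { intros n. destruct (Hu n) as (z & Hz & E). unfold zn. rewrite E. cbn [fst snd].
    replace (RtoC 2 * z / RtoC 2)%C with z by (field; auto). repeat split; auto. lra. }
  exists (fst x / RtoC 2)%C.
  assert (T : ctends zn (fst x / RtoC 2)%C).
  { apply (ctends_div (fun n => fst (u n)) (fun _ => RtoC 2)); auto. apply ctends_const. }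
  split.
  + apply (ctends_Cmod_le zn); auto. intros n; apply Hz.
  + rewrite (surjective_pairing x) at 1. unfold royal_point. f_equal.
    * set (s := fst x : C). change (s = (RtoC 2 * (s / RtoC 2))%C). field. auto.
    * apply (ctends_unique (fun n => snd (u n))); auto.
      apply (ctends_ext (fun n => zn n * zn n)%C); [intros n; apply Hz|ctends_tac].
- intros (z & Hz & ->).
  set (zn := fun n : nat => (z * (1 - RtoC (/ (INR n + 1))))%C).
  assert (Hzn : forall n, Cmod (zn n) < 1).
  { intros n. assert (Hn := pos_INR n).
    assert (H1 : 0 < / (INR n + 1) <= 1).
    { split; [apply Rinv_0_lt_compat; lra|]. rewrite <- Rinv_1 at 2. apply Rinv_le_contravar; lra. }
    unfold zn. rewrite Cmod_mult, <- RtoC_minus, Cmod_R, Rabs_pos_eq by lra.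
    generalize (Cmod_ge_0 z). nra. }
  assert (T : ctends zn z).
  { assert (K := inv_INR_ctends). replace z with (z * (1 - 0))%C by ring. unfold zn. ctends_tac. }
  exists (fun n => royal_point (zn n)). split; [|split].
  + intros n. exists (zn n). split; auto.
  + unfold royal_point. cbn [fst]. ctends_tac.
  + unfold royal_point. cbn [snd]. ctends_tac.
Qed.

Definition cayley (z : C) : C := ((z - 1) / (z + 1))%C.

Lemma re_nonneg_plus_one_neq (z : C) : 0 <= fst z -> (z + 1)%C <> RtoC 0.
Proof. intros H. apply re_pos_neq. destruct z; simpl in *. lra. Qed.

Lemma cayley_defect (z : C) : 0 <= fst z ->
  (1 - Cmod (cayley z) ^ 2) * Cmod (z + 1) ^ 2 = 4 * fst z.
Proof.
intros Hz. assert (Hn := re_nonneg_plus_one_neq z Hz).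
assert (Hp : 0 < Cmod (z + 1)) by now apply Cmod_gt_0.
unfold cayley. rewrite Cmod_div by auto.
replace ((1 - (Cmod (z - 1) / Cmod (z + 1)) ^ 2) * Cmod (z + 1) ^ 2)
  with (Cmod (z + 1) ^ 2 - Cmod (z - 1) ^ 2) by (field; lra).
rewrite !Cmod2_alt. destruct z; simpl. ring.
Qed.

Lemma cayley_lt (z : C) : 0 < fst z -> Cmod (cayley z) < 1.
Proof.
intros Hz. assert (H := cayley_defect z ltac:(lra)).
assert (Hp : 0 < Cmod (z + 1) ^ 2).
{ apply pow_lt, Cmod_gt_0, re_nonneg_plus_one_neq. lra. }
assert (Hk : 0 < 1 - Cmod (cayley z) ^ 2) by (apply Rmult_lt_reg_r with (Cmod (z + 1) ^ 2); lra).
generalize (Cmod_ge_0 (cayley z)). intros. nra.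
Qed.

Lemma cayley_eq (z : C) : fst z = 0 -> Cmod (cayley z) = 1.
Proof.
intros Hz. assert (H := cayley_defect z ltac:(lra)).
assert (Hp : 0 < Cmod (z + 1) ^ 2).
{ apply pow_lt, Cmod_gt_0, re_nonneg_plus_one_neq. lra. }
generalize (Cmod_ge_0 (cayley z)). intros. rewrite Hz, Rmult_0_r in H.
assert (1 - Cmod (cayley z) ^ 2 = 0) by (apply (Rmult_eq_reg_r (Cmod (z + 1) ^ 2)); lra).
nra.
Qed.

Lemma cayley_neq_1 (z : C) : 0 <= fst z -> cayley z <> RtoC 1.
Proof.
intros Hz E. assert (Hn := re_nonneg_plus_one_neq z Hz). unfold cayley in E.
assert (E2 : (z - 1)%C = (z + 1)%C).
{ replace (z - 1)%C with ((z - 1) / (z + 1) * (z + 1))%C by (field; auto). rewrite E. ring. }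
apply (f_equal fst) in E2. destruct z; simpl in E2. lra.
Qed.

Lemma cayley_surj (y : C) : Cmod y <= 1 -> y <> RtoC 1 ->
  exists z : C, 0 <= fst z /\ cayley z = y /\ z = ((1 + y) / (1 - y))%C.
Proof.
intros Hy Hn.
assert (Hn' : (1 - y)%C <> RtoC 0).
{ intros E. apply Hn. replace y with (1 - (1 - y))%C by ring. rewrite E. ring. }
assert (N2 : RtoC 2 <> RtoC 0) by (apply RtoC_pos_neq; lra).
exists ((1 + y) / (1 - y))%C. split; [|split; auto].
- rewrite re_div by auto.
  assert (Hp : 0 < Cmod (1 - y)) by now apply Cmod_gt_0.
  apply Rmult_le_pos; [|left; apply Rinv_0_lt_compat; nra].
  assert (Cmod y ^ 2 <= 1) by (generalize (Cmod_ge_0 y); nra).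
  rewrite Cmod2_alt in H. destruct y as [y1 y2]. simpl in *. lra.
- unfold cayley. field. split; auto.
  intros E. apply N2. rewrite <- E. ring.
Qed.

Section RoyalIntersection.
Variables (om : C) (a b c : R) (D : C2 -> Prop).
Hypothesis Ho : circle om.
Hypothesis Ha : admissible a b c.
Hypothesis HD : forall x, D x <-> exists z : C, 0 < fst z /\ x = chart_curve om a b c z.

(** The point of the curve at a zero [z] of [quad], also for [z] on the imaginary axis. The value 1,
    which [cayley] omits, stands for [z] at infinity and gives [royal_point (Cconj om)]. *)
Definition end_point (z : C) : C2 := royal_point (Cconj om * cayley z)%C.

Lemma end_point_in_closure (z : C) : 0 <= fst z -> quad a b c z = RtoC 0 -> closure D (end_point z).
Proof.
intros Hz Hq. apply closure_ctends.
(* The shift keeps the parameters in the open half-plane even when [z] is on its boundary. Since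
   [chart_q] is [(z + 1)^2], hence nonzero, at [z], the formulas of the curve are still
   differentiable there. *)
set (zn := fun n : nat => (z + RtoC (/ (INR n + 1)))%C).
assert (T : ctends zn z).
{ assert (K := inv_INR_ctends). rewrite <- (Cplus_0_r z). unfold zn. ctends_tac. }
assert (Hzn : forall n, 0 < fst (zn n)).
{ intros n. assert (H : 0 < / (INR n + 1)) by (apply Rinv_0_lt_compat; generalize (pos_INR n); lra).
  unfold zn. destruct z; simpl in *. lra. }
assert (Hn := re_nonneg_plus_one_neq z Hz).
assert (Eq : chart_q z (quad a b c z) = ((z + 1) * (z + 1))%C).
{ unfold chart_q. rewrite Hq. ring. }
assert (Hqn : chart_q z (quad a b c z) <> RtoC 0).
{ rewrite Eq. now apply Cmult_neq_0. }
destruct (point_cderiv om (fun w => w) (quad a b c) z _ _ Hqn (cderiv_id z) (quad_cderiv a b c z)) as [Hs Hp].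
exists (fun n => chart_curve om a b c (zn n)). split; [|split].
- intros n. apply HD. exists (zn n). auto.
- replace (fst (end_point z)) with (point_s om z (quad a b c z)).
  + apply (ctends_cderiv (fun w => point_s om w (quad a b c w)) zn z _ Hs T).
  + unfold point_s, end_point, royal_point, cayley. rewrite Eq. cbn [fst].
    replace (RtoC 4) with (RtoC 2 * RtoC 2)%C by (rewrite <- RtoC_mult; f_equal; ring).
    field. auto.
- replace (snd (end_point z)) with (point_p om z (quad a b c z)).
  + apply (ctends_cderiv (fun w => point_p om w (quad a b c w)) zn z _ Hp T).
  + unfold point_p, end_point, royal_point, cayley. rewrite Eq. cbn [snd].
    replace (RtoC 4) with (RtoC 2 * RtoC 2)%C by (rewrite <- RtoC_mult; f_equal; ring).
    field. auto.
Qed.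

Lemma infinite_point_in_closure : a < 1 -> closure D (royal_point (Cconj om)).
Proof.
intros Ha1. apply closure_ctends.
set (en := fun n : nat => RtoC (/ (INR n + 1))).
set (zn := fun n : nat => RtoC (INR n + 1)).
assert (Hn : forall n, 0 < INR n + 1) by (intros n; generalize (pos_INR n); lra).
assert (Hzn : forall n, 0 < fst (zn n)) by (intros n; apply Hn).
assert (He : forall n, zn n <> RtoC 0 /\ en n = (/ zn n)%C).
{ intros n. split; [apply RtoC_pos_neq, Hn|]. unfold en, zn. apply RtoC_inv. specialize (Hn n). lra. }
assert (Te := inv_INR_ctends). fold en in Te.
(* In the variable [e = 1 / z] one has [chart_q = dn e / e^2], and [dn 0 = 1 - a] is nonzero, so the
   curve extends continuously to [e = 0]. *)
set (dn := fun e : C => ((1 + e) * (1 + e) - (a + Ci * b * e - c * (e * e)))%C).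
assert (Td : ctends (fun n => dn (en n)) (dn (RtoC 0))) by (unfold dn; ctends_tac).
assert (Hd0 : dn (RtoC 0) <> RtoC 0).
{ unfold dn. replace ((1 + 0) * (1 + 0) - (a + Ci * b * 0 - c * (0 * 0)))%C with (1 - a)%C by ring.
  rewrite <- RtoC_minus. apply RtoC_pos_neq. lra. }
assert (Eq : forall n, chart_q (zn n) (quad a b c (zn n)) = (dn (en n) * (zn n * zn n))%C).
{ intros n. destruct (He n) as [H1 ->]. unfold chart_q, quad, dn. field. auto. }
assert (Hqn : forall n, dn (en n) <> RtoC 0).
{ intros n E. apply (chart_q_neq _ _ (quad_chart_dom a b c (zn n) Ha (Hzn n))).
  rewrite Eq, E. ring. }
exists (fun n => chart_curve om a b c (zn n)). split; [|split].
- intros n. apply HD. exists (zn n). auto.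
- apply (ctends_ext (fun n => Cconj om * (RtoC 2 - RtoC 4 * ((en n + en n * en n) / dn (en n))))%C).
  + intros n. change (fst (chart_curve om a b c (zn n))) with (point_s om (zn n) (quad a b c (zn n))).
    unfold point_s. rewrite Eq.
    specialize (Hqn n). set (d := dn (en n)) in *. destruct (He n) as [H1 ->]. field. auto.
  + replace (fst (royal_point (Cconj om))) with (Cconj om * (RtoC 2 - RtoC 4 * ((0 + 0 * 0) / dn (RtoC 0))))%C
     by (unfold royal_point; cbn [fst]; field; auto).
    ctends_tac.
- apply (ctends_ext (fun n => Cconj om * Cconj om * (RtoC 1 - RtoC 4 * (en n / dn (en n))))%C).
  + intros n. change (snd (chart_curve om a b c (zn n))) with (point_p om (zn n) (quad a b c (zn n))).
    unfold point_p. rewrite Eq.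
    specialize (Hqn n). set (d := dn (en n)) in *. destruct (He n) as [H1 ->]. field. auto.
  + replace (snd (royal_point (Cconj om))) with (Cconj om * Cconj om * (RtoC 1 - RtoC 4 * (0 / dn (RtoC 0))))%C
     by (unfold royal_point; cbn [snd]; field; auto).
    ctends_tac.
Qed.

(** At the royal point of [w], put [y = om * w]: then [A = (1 - y)^2], [B = (1 - y) (1 + y)], and
    [geodesic_eq] becomes [- (1 - y)^4 quad a b c z = 0] with [z = (1 + y) / (1 - y)]. At [y = 1]
    this is void, and the affine equation for [a = 1] decides. *)
Lemma royal_intersection (x : C2) :
  closure D x /\ closure royal_variety x <->
  (exists z : C, 0 <= fst z /\ quad a b c z = RtoC 0 /\ x = end_point z) \/
  (a < 1 /\ x = royal_point (Cconj om)).
Proof.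
assert (Hcm : Cmod (Cconj om) = 1) by (rewrite Cmod_conj; exact Ho).
split.
- intros [Hx HR]. apply closure_royal in HR. destruct HR as (w & Hw & ->).
  set (y := (om * w)%C).
  assert (Ew : w = (Cconj om * y)%C).
  { unfold y. rewrite Cmult_assoc, circle_conj by auto. ring. }
  assert (Hy : Cmod y <= 1) by (unfold y; rewrite Cmod_mult, Ho; lra).
  assert (EA : chart_den om (fst (royal_point w)) (snd (royal_point w)) = ((1 - y) * (1 - y))%C).
  { unfold chart_den, royal_point, y. cbn [fst snd]. ring. }
  assert (EB : chart_num om (snd (royal_point w)) = ((1 - y) * (1 + y))%C).
  { unfold chart_num, royal_point, y. cbn [fst snd]. ring. }
  destruct (excluded_middle_informative (y = RtoC 1)) as [E1|E1].
  + right. split.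
    * destruct Ha as ([_ H1] & _). destruct (Req_dec a 1) as [E|E]; [exfalso|lra].
      assert (F := closure_geodesic_eq_flat om a b c D Ho Ha HD _ E Hx).
      rewrite EA, EB, E1 in F.
      assert (N4 : RtoC 4 <> RtoC 0) by (apply RtoC_pos_neq; lra).
      apply N4. replace (RtoC 4) with (- (- RtoC 4))%C by ring.
      replace (- RtoC 4)%C with ((RtoC 2 - Ci * b) * ((1 - 1) * (1 + 1)) + (1 + c) * ((1 - 1) * (1 - 1)) - RtoC 4)%C by ring.
      rewrite F. ring.
    * rewrite Ew, E1. f_equal. ring.
  + left. destruct (cayley_surj y Hy E1) as (z & Hz & Ez & Ez2).
    exists z. split; [auto|split].
    * assert (F := closure_geodesic_eq om a b c D Ho Ha HD _ Hx).
      unfold geodesic_eq in F. rewrite EA, EB in F.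
      assert (Hn' : (1 - y)%C <> RtoC 0).
      { intros E. apply E1. replace y with (1 - (1 - y))%C by ring. rewrite E. ring. }
      replace (((1 - y) * (1 - y) + (1 - y) * (1 + y)) * ((1 - y) * (1 - y) + (1 - y) * (1 + y)) -
        RtoC 4 * ((1 - y) * (1 - y)) - (a * ((1 - y) * (1 + y) * ((1 - y) * (1 + y))) +
          Ci * b * ((1 - y) * (1 - y) * ((1 - y) * (1 + y))) - c * ((1 - y) * (1 - y) * ((1 - y) * (1 - y)))))%C
      with (- (quad a b c z) * ((1 - y) * (1 - y) * ((1 - y) * (1 - y))))%C in F.
      -- replace (quad a b c z) with (- ((- (quad a b c z) * ((1 - y) * (1 - y) * ((1 - y) * (1 - y)))) /
           ((1 - y) * (1 - y) * ((1 - y) * (1 - y)))))%C by (field; auto).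
         rewrite F. field. auto.
      -- rewrite Ez2. unfold quad.
         replace (RtoC 4) with (RtoC 2 * RtoC 2)%C by (rewrite <- RtoC_mult; f_equal; ring).
         field. auto.
    * unfold end_point. rewrite Ez, <- Ew. reflexivity.
- intros [(z & Hz & Hq & ->)|[Ha1 ->]].
  + split; [now apply end_point_in_closure|]. apply closure_royal.
    exists (Cconj om * cayley z)%C. split; auto. rewrite Cmod_mult, Hcm.
    destruct (Rle_lt_or_eq_dec _ _ Hz) as [H|H].
    * generalize (cayley_lt z H). lra.
    * rewrite cayley_eq by auto. lra.
  + split; [now apply infinite_point_in_closure|]. apply closure_royal.
    exists (Cconj om). split; auto. lra.
Qed.

Lemma end_point_royal (z : C) : 0 < fst z -> royal_variety (end_point z).
Proof.
intros Hz. exists (Cconj om * cayley z)%C. split; [|reflexivity].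
rewrite Cmod_mult, Cmod_conj, Ho. generalize (cayley_lt z Hz). lra.
Qed.

Lemma end_point_boundary (z : C) : fst z = 0 -> royal_boundary (end_point z).
Proof.
intros Hz. exists (Cconj om * cayley z)%C. split; [|reflexivity].
rewrite Cmod_mult, Cmod_conj, Ho, cayley_eq by auto. ring.
Qed.

Lemma infinite_point_boundary : royal_boundary (royal_point (Cconj om)).
Proof. exists (Cconj om). split; [|reflexivity]. rewrite Cmod_conj. exact Ho. Qed.

Lemma end_point_neq (z : C) : 0 <= fst z -> end_point z <> royal_point (Cconj om).
Proof.
intros Hz E. apply (f_equal fst) in E. unfold end_point, royal_point in E. cbn [fst] in E.
apply (cayley_neq_1 z Hz).
assert (N2 : RtoC 2 <> RtoC 0) by (apply RtoC_pos_neq; lra).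
assert (Hc : Cconj om <> RtoC 0) by (apply Cmod_gt_0; rewrite Cmod_conj, Ho; lra).
replace (cayley z) with (RtoC 2 * (Cconj om * cayley z) / (RtoC 2 * Cconj om))%C by (field; auto).
rewrite E. field. auto.
Qed.
End RoyalIntersection.

(** The zero of [quad] in the closed right half-plane when [a > 0] and [b^2 <= 4 a c]; the other
    zero is its mirror image in the imaginary axis. *)
Definition quad_root (a b c : R) : C := (sqrt (4 * a * c - b ^ 2) / (2 * a), - b / (2 * a)).

Lemma quad_root_re (a b c : R) : 0 < a -> 0 <= fst (quad_root a b c).
Proof.
intros Ha. unfold quad_root. cbn [fst]. apply Rmult_le_pos; [apply sqrt_pos|].
left. apply Rinv_0_lt_compat. lra.
Qed.

Lemma quad_zero_iff (a b c : R) (z : C) : 0 < a -> b ^ 2 <= 4 * a * c -> 0 <= fst z ->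
  quad a b c z = RtoC 0 <-> z = quad_root a b c.
Proof.
intros Ha Hd Hz. destruct (quad_parts a b c z) as [P1 P2].
assert (Hs : 0 <= 4 * a * c - b ^ 2) by lra.
assert (Sq := sqrt_sqrt _ Hs). assert (Sp := sqrt_pos (4 * a * c - b ^ 2)).
unfold quad_root. set (r := sqrt (4 * a * c - b ^ 2)) in *.
split.
- intros E. rewrite E in P1, P2. simpl fst in P1, P2; simpl snd in P2. simpl in P1, P2.
  destruct z as [x y]. cbn [fst snd] in *.
  assert (Hx : x * (2 * a * y + b) = 0) by lra.
  assert (Hy : 2 * a * y + b = 0).
  { apply Rmult_integral in Hx. destruct Hx as [Hx|Hx]; [|auto]. subst x.
    assert ((2 * a * y + b) ^ 2 + (4 * a * c - b ^ 2) = 0) by nra.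
    assert ((2 * a * y + b) ^ 2 = 0) by (generalize (pow2_ge_0 (2 * a * y + b)); lra). nra. }
  assert (Ey : y = - b / (2 * a)) by (apply Rmult_eq_reg_l with (2 * a); [|lra]; field_simplify; lra).
  assert (Ex : (2 * a * x) * (2 * a * x) = r * r).
  { rewrite Sq.
    replace (2 * a * x * (2 * a * x)) with (4 * a * (a * (x ^ 2 - y ^ 2) - b * y - c) + (2 * a * y + b) ^ 2 + (4 * a * c - b ^ 2)) by ring.
    rewrite Hy. simpl. nra. }
  assert (Ex2 : 2 * a * x = r).
  { apply Rsqr_inj; auto. apply Rmult_le_pos; lra. }
  rewrite Ey, <- Ex2. f_equal. field. lra.
- intros ->. cbn [fst snd] in *. apply injective_projections.
  + rewrite P1. simpl. replace (r / (2 * a) * (r / (2 * a) * 1)) with (r * r / (4 * a ^ 2)) by (field; lra).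
    rewrite Sq. field. lra.
  + rewrite P2. simpl. field. lra.
Qed.

(** * Moduli of data carried by a geodesic *)

(** Differentiability along holomorphic curves with a homogeneous derivative: all that [push]
    requires, and directly available both for holomorphic maps and for the explicit Phi. *)
Definition curve_derivable (F : C2 -> C) (x : C2) : Prop :=
  exists L : C -> C -> C,
    (forall l s p, L (l * s)%C (l * p)%C = (l * L s p)%C) /\
    forall (S P : C -> C) (z s p : C), S z = fst x -> P z = snd x ->
      cderiv S z s -> cderiv P z p -> cderiv (fun w => F (S w, P w)) z (L s p).

Lemma holomorphic_curve_derivable (F : C2 -> C) (x : C2) :
  @holomorphic_map C2 C_NormedModule symbidisc Defs.disc F -> symbidisc x -> curve_derivable F x.
Proof.
intros [HF _] Hx. destruct (HF x Hx) as [L HL]. exists (fun s p => L (s, p)). split.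
- intros l s p. exact (linear_scal L (proj1 HL) l (s, p)).
- intros S P z s p ES EP HS HP. apply (cderiv_comp2 F S P z s p L); auto.
  rewrite ES, EP. rewrite <- surjective_pairing. exact HL.
Qed.

Lemma symbidisc_Phi_den (om : C) (x : C2) : circle om -> symbidisc x ->
  (RtoC 2 - om * fst x)%C <> RtoC 0.
Proof.
intros Ho (z & w & Hz & Hw & ->). cbn [fst].
assert (H1 := disc_mult_circle om z Ho Hz). assert (H2 := disc_mult_circle om w Ho Hw).
replace (RtoC 2 - om * (z + w))%C with ((1 - om * z) + (1 - om * w))%C.
- assert (A1 := fst_le_Cmod (om * z)%C). assert (A2 := fst_le_Cmod (om * w)%C).
  apply re_pos_neq. change (0 < (1 + - fst (om * z)%C) + (1 + - fst (om * w)%C)). lra.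
- replace (RtoC 2) with (RtoC 1 + RtoC 1)%C by (rewrite <- RtoC_plus; f_equal; ring). ring.
Qed.

Lemma Phi_curve_derivable (om : C) (x : C2) : circle om -> symbidisc x ->
  curve_derivable (Phi om) x.
Proof.
intros Ho Hx. assert (Hd := symbidisc_Phi_den om x Ho Hx).
exists (fun s p => (((RtoC 2 * om * p - s) * (RtoC 2 - om * fst x) -
   (RtoC 2 * om * snd x - fst x) * (0 - om * s)) / ((RtoC 2 - om * fst x) * (RtoC 2 - om * fst x)))%C).
split.
- intros l s p. unfold Cdiv. set (X := fst x : C). set (Y := snd x : C).
  change (fst x) with X. change (snd x) with Y. ring.
- intros S P z s p ES EP HS HP. rewrite <- ES in Hd |- *. rewrite <- EP.
  unfold Phi. cbn [fst snd].
  cderiv_tac.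
Qed.

Section Data.
Variables (om : C) (a b c : R).
Hypothesis Ho : circle om.
Hypothesis Ha : admissible a b c.

(* [r] is the pseudohyperbolic modulus of the datum in the half-plane that the
   chart curve maps to [delta]. *)
Definition data_param (delta : datum C2) (z1 z2 : C) (r : R) : Prop :=
  0 < fst z1 /\ 0 < fst z2 /\ 0 < r /\
  ((delta = Discrete (chart_curve om a b c z1) (chart_curve om a b c z2) /\
      r = Cmod (z1 - z2) / Cmod (z1 + Cconj z2)) \/
   (z1 = z2 /\ exists l, delta = Infinitesimal (chart_curve om a b c z1)
       ((l * dcurve_s om a b c z1)%C, (l * dcurve_p om a b c z1)%C) /\
      r = Cmod l / (2 * fst z1))).

(** [push] differentiates along a complex line, [d] along the geodesic; both have tangent vectors
    proportional to the same one, and the derivative depends only on the tangent vector. *)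
Lemma push_infinitesimal (F : C2 -> C) (z l d : C) : 0 < fst z ->
  curve_derivable F (chart_curve om a b c z) ->
  cderiv (fun w => F (chart_curve om a b c w)) z d ->
  push F (Infinitesimal (chart_curve om a b c z)
       ((l * dcurve_s om a b c z)%C, (l * dcurve_p om a b c z)%C)) =
  Infinitesimal (F (chart_curve om a b c z)) (l * d)%C.
Proof.
intros Hz (L & HL1 & HL2) Hd. unfold push. f_equal.
destruct (chart_curve_cderiv om a b c z Ha Hz) as [Hs Hp].
assert (E : d = L (dcurve_s om a b c z) (dcurve_p om a b c z)).
{ apply (cderiv_unique _ _ _ _ Hd).
  apply (HL2 (fun w => point_s om w (quad a b c w)) (fun w => point_p om w (quad a b c w))); auto. }
rewrite E, <- HL1. apply cderiv_C_derive.
set (s := dcurve_s om a b c z). set (p := dcurve_p om a b c z).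
assert (Hline : forall x0 v0 : C, cderiv (fun t => x0 + t * v0)%C (RtoC 0) v0).
{ intros x0 v0. eapply cderiv_eq; [cderiv_tac|ring]. }
apply (cderiv_ext (fun t => F ((fst (chart_curve om a b c z) + t * (l * s))%C,
                               (snd (chart_curve om a b c z) + t * (l * p))%C))).
{ intros t. reflexivity. }
apply (HL2 (fun t => fst (chart_curve om a b c z) + t * (l * s))%C
           (fun t => snd (chart_curve om a b c z) + t * (l * p))%C); auto.
- ring.
- ring.
Qed.

(** Schwarz-Pick for [F] composed with the curve; it makes [r] an upper bound for the Caratheodory
    supremum. *)
Lemma modulus_pick_bound (F : C2 -> C) (delta : datum C2) (z1 z2 : C) (r : R) :
  @holomorphic_map C2 C_NormedModule symbidisc Defs.disc F -> data_param delta z1 z2 r ->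
  modulus (push F delta) <= r.
Proof.
intros HF (H1 & H2 & Hr & H).
destruct (holomorphic_curve_comp F om a b c Ho Ha HF) as [HF1 HF2].
set (h := fun w => F (chart_curve om a b c w)).
assert (Hh : forall z : C, 0 < fst z -> exists l, cderiv h z l).
{ intros z Hz. destruct (HF1 z Hz) as [L [_ HL]]. eauto. }
destruct H as [[-> ->]|(-> & l & -> & ->)].
- assert (P := pick h Hh HF2 z1 z2 H1 H2).
  rewrite Cmod_div in P by now apply hp_sum_neq. exact P.
- destruct (Hh z2 H1) as [d Hd].
  rewrite (push_infinitesimal F z2 l d); auto.
  2:{ apply holomorphic_curve_derivable; auto. now apply chart_curve_in. }
  assert (P := pick_deriv h Hh HF2 z2 d H1 Hd).
  unfold modulus. fold (h z2).
  assert (Hb := Cmod_sq_lt_1 _ (HF2 z2 H1)). fold (h z2) in Hb.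
  rewrite Cmod_mult.
  apply Rmult_le_reg_r with ((1 - Cmod (h z2) ^ 2) * (2 * fst z2)).
  + apply Rmult_lt_0_compat; lra.
  + replace (Cmod l * Cmod d / (1 - Cmod (h z2) ^ 2) * ((1 - Cmod (h z2) ^ 2) * (2 * fst z2)))
      with (Cmod l * (2 * fst z2 * Cmod d)) by (field; lra).
    replace (Cmod l / (2 * fst z2) * ((1 - Cmod (h z2) ^ 2) * (2 * fst z2)))
      with (Cmod l * (1 - Cmod (h z2) ^ 2)) by (field; lra).
    apply Rmult_le_compat_l; [apply Cmod_ge_0|exact P].
Qed.

Definition kernel (num den : C -> C) (z w : C) : C :=
  (den z * Cconj (den w) - num z * Cconj (num w))%C.

(** One formula for both kinds of data when [F] is [u * num / den] along the geodesic. In the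
    discrete case [(z1 - z2) Q] and [kernel] are the numerators of the difference of the values and
    of [1 - Cconj F2 * F1]. In the infinitesimal case the diagonal value of [Q] is the Wronskian,
    and [kernel] is [|den|^2 - |num|^2]. *)
Lemma modulus_quotient (F : C2 -> C) (u : C) (num den : C -> C) (Q : C -> C -> C)
    (delta : datum C2) (z1 z2 : C) (r : R) :
  data_param delta z1 z2 r ->
  (forall z : C, 0 < fst z -> curve_derivable F (chart_curve om a b c z)) ->
  circle u ->
  (forall z : C, 0 < fst z -> den z <> RtoC 0 /\ Cmod (num z / den z) < 1 /\
     F (chart_curve om a b c z) = (u * (num z / den z))%C) ->
  (forall z w : C, (num z * den w - num w * den z = (z - w) * Q z w)%C) ->
  (forall z : C, exists n' d', cderiv num z n' /\ cderiv den z d' /\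
     (n' * den z - num z * d' = Q z z)%C) ->
  kernel num den z1 z2 <> RtoC 0 /\
  modulus (push F delta) = r * (Cmod (Q z1 z2) * Cmod (z1 + Cconj z2) / Cmod (kernel num den z1 z2)).
Proof.
intros (H1 & H2 & Hr & H) Hcd Hu HF HQ HQd.
assert (Hu2 : (Cconj u * u)%C = RtoC 1) by now apply circle_conj.
destruct (HF z1 H1) as (Hd1 & Hm1 & E1). destruct (HF z2 H2) as (Hd2 & Hm2 & E2).
assert (Hs : 0 < Cmod (z1 + Cconj z2)) by (apply Cmod_gt_0; now apply hp_sum_neq).
assert (Hc2 : Cconj (den z2) <> RtoC 0).
{ apply Cmod_gt_0. rewrite Cmod_conj. now apply Cmod_gt_0. }
assert (Ek : kernel num den z1 z2 =
  ((1 - Cconj (num z2 / den z2) * (num z1 / den z1)) * (den z1 * Cconj (den z2)))%C).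
{ unfold kernel.
  replace (Cconj (num z2)) with (Cconj (num z2 / den z2) * Cconj (den z2))%C.
  - field. auto.
  - rewrite <- Cmult_conj. f_equal. field. auto. }
assert (Hk : kernel num den z1 z2 <> RtoC 0).
{ rewrite Ek. repeat apply Cmult_neq_0; auto. now apply mob_den_neq. }
assert (Hkp : 0 < Cmod (kernel num den z1 z2)) by now apply Cmod_gt_0.
split; [exact Hk|].
destruct H as [[-> ->]|(E12 & l & -> & ->)].
- unfold push, modulus. rewrite E1, E2.
  assert (Emod : ((u * (num z1 / den z1) - u * (num z2 / den z2)) /
     (1 - Cconj (u * (num z2 / den z2)) * (u * (num z1 / den z1))))%C =
     (u * ((z1 - z2) * Q z1 z2 * Cconj (den z2) / (den z2 * kernel num den z1 z2)))%C).
  { rewrite Cmult_conj.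
    replace (Cconj u * Cconj (num z2 / den z2) * (u * (num z1 / den z1)))%C with
      ((Cconj u * u) * (Cconj (num z2 / den z2) * (num z1 / den z1)))%C by ring.
    rewrite Hu2, Cmult_1_l, Ek, <- HQ.
    assert (Hn := mob_den_neq _ _ Hm2 Hm1).
    set (K := (1 - Cconj (num z2 / den z2) * (num z1 / den z1))%C) in *.
    field. auto. }
  rewrite Emod.
  rewrite !Cmod_mult, Cmod_div, !Cmod_mult, Cmod_conj, Hu by now apply Cmult_neq_0.
  assert (0 < Cmod (den z2)) by now apply Cmod_gt_0.
  field. lra.
- subst z2. destruct (HQd z1) as (n' & d' & Hn' & Hd' & EQ).
  assert (HD : cderiv (fun w => F (chart_curve om a b c w)) z1 (u * (Q z1 z1 / (den z1 * den z1)))%C).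
  { apply (cderiv_ext_loc (fun w => u * (num w / den w))%C).
    - exists (fst z1). split; auto. intros w Hw. symmetry. apply HF. now apply (hp_open z1).
    - apply cderiv_scal. rewrite <- EQ. now apply cderiv_div. }
  rewrite (push_infinitesimal F z1 l _ H1 (Hcd z1 H1) HD).
  unfold modulus. rewrite E1.
  assert (Hdp : 0 < Cmod (den z1)) by now apply Cmod_gt_0.
  rewrite !Cmod_mult, !Cmod_div, Cmod_mult, Hu by (auto; now apply Cmult_neq_0).
  rewrite Cmod_div in Hm1 by auto.
  assert (Hnd : Cmod (num z1) < Cmod (den z1)).
  { apply (Rmult_lt_compat_r (Cmod (den z1))) in Hm1; auto.
    unfold Rdiv in Hm1. rewrite Rmult_assoc, Rinv_l in Hm1 by lra. lra. }
  assert (Hn0 := Cmod_ge_0 (num z1)).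
  assert (Hkk : Cmod (kernel num den z1 z1) = Cmod (den z1) ^ 2 - Cmod (num z1) ^ 2).
  { unfold kernel. rewrite (Cmult_comm (den z1)), (Cmult_comm (num z1)), !Cconj_self.
    rewrite <- RtoC_minus, Cmod_R, Rabs_pos_eq; nra. }
  rewrite Hkk in *.
  assert (Hss : Cmod (z1 + Cconj z1) = 2 * fst z1).
  { replace (z1 + Cconj z1)%C with (RtoC (2 * fst z1)).
    - rewrite Cmod_R, Rabs_pos_eq; lra.
    - destruct z1; unfold Cconj, Cplus, RtoC; simpl; f_equal; ring. }
  rewrite Hss. field. repeat split; lra.
Qed.
Lemma modulus_quotient_holomorphic (F : C2 -> C) (u : C) (num den : C -> C) (Q : C -> C -> C)
    (delta : datum C2) (z1 z2 : C) (r : R) :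
  @holomorphic_map C2 C_NormedModule symbidisc Defs.disc F ->
  data_param delta z1 z2 r -> circle u ->
  (forall z : C, 0 < fst z -> den z <> RtoC 0 /\
     F (chart_curve om a b c z) = (u * (num z / den z))%C) ->
  (forall z w : C, (num z * den w - num w * den z = (z - w) * Q z w)%C) ->
  (forall z : C, exists n' d', cderiv num z n' /\ cderiv den z d' /\
     (n' * den z - num z * d' = Q z z)%C) ->
  kernel num den z1 z2 <> RtoC 0 /\
  modulus (push F delta) = r * (Cmod (Q z1 z2) * Cmod (z1 + Cconj z2) / Cmod (kernel num den z1 z2)).
Proof.
intros HF Hdp Hu Hnd HQ HQd. apply (modulus_quotient F u); auto.
- intros z Hz. apply holomorphic_curve_derivable; auto. now apply chart_curve_in.
- intros z Hz. destruct (Hnd z Hz) as [Hd E]. split; [auto|split; auto].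
  assert (H := proj2 HF _ (chart_curve_in om a b c z Ho Ha Hz)). unfold Defs.disc in H.
  rewrite E, Cmod_mult, Hu in H. lra.
Qed.
End Data.

(** * The explicit formula for rho *)

(** The polynomial [a t^2 + b t + c] at [t = - cs / sn], homogenized: multiplied by [sn^2]. *)
Definition disc_form (a b c cs sn : R) : R := a * cs ^ 2 - b * cs * sn + c * sn ^ 2.
Definition lin_form (cs sn : R) (z : C) : C := (sn * z + Ci * cs)%C.
(** With [N = tnum] and [T = tden] along the geodesic, [kern_form] is the quotient of
    [T(z) conj N(w) + N(z) conj T(w)] by [z + conj w], and [anti_form] that of
    [T(z) N(w) - N(z) T(w)] by [z - w]. Their ratio measures how far [N / T] is from an isometry on
    the datum. *)
Definition kern_form (a b c cs sn : R) (z w : C) : C :=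
  ((1 - a)%R * (lin_form cs sn z * Cconj (lin_form cs sn w)) + disc_form a b c cs sn)%C.
Definition anti_form (a b c cs sn : R) (z w : C) : C :=
  ((1 - a)%R * (lin_form cs sn z * lin_form cs sn w) - disc_form a b c cs sn)%C.

Lemma tnum_kernel (a b c cs sn : R) (z w : C) :
  (tden cs sn z * Cconj (tnum cs sn w (quad a b c w)) +
   tnum cs sn z (quad a b c z) * Cconj (tden cs sn w))%C =
  ((z + Cconj w) * kern_form a b c cs sn z w)%C.
Proof.
unfold tnum, tden, kern_form, lin_form, disc_form, quad.
destruct z, w. apply injective_projections; simpl; ring.
Qed.

Lemma tnum_anti (a b c cs sn : R) (z w : C) :
  (tden cs sn z * tnum cs sn w (quad a b c w) -
   tnum cs sn z (quad a b c z) * tden cs sn w)%C =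
  ((z - w) * anti_form a b c cs sn z w)%C.
Proof.
unfold tnum, tden, anti_form, lin_form, disc_form, quad.
destruct z, w. apply injective_projections; simpl; ring.
Qed.

(** Divided by [|kern_form|^2] at the parameters of the datum, this is [1 - rho / r^2]. The factor
    [sn^2] accounts for the maximizer [om] and [disc_form] for any others. *)
Lemma kern_anti_diff (a b c cs sn : R) (z w : C) :
  Cmod (kern_form a b c cs sn z w) ^ 2 - Cmod (anti_form a b c cs sn z w) ^ 2 =
  4 * (1 - a) * (disc_form a b c cs sn * sn ^ 2) * (fst z * fst w).
Proof.
rewrite !Cmod2_alt. unfold kern_form, anti_form, lin_form.
generalize (disc_form a b c cs sn). intros N. destruct z, w; simpl. ring.
Qed.

Lemma disc_form_nonneg (a b c cs sn : R) : admissible a b c -> 0 <= disc_form a b c cs sn.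
Proof.
intros ([Ha0 Ha1] & H & _). unfold disc_form.
destruct (Req_dec sn 0) as [->|Hn]; [nra|].
specialize (H (- cs / sn)).
replace (a * cs ^ 2 - b * cs * sn + c * sn ^ 2) with
  (sn ^ 2 * (a * (- cs / sn) ^ 2 + b * (- cs / sn) + c)) by (field; auto).
apply Rmult_le_pos; [apply pow2_ge_0|auto].
Qed.

Section Rho.
Variables (om : C) (a b c : R).
Hypothesis Ho : circle om.
Hypothesis Ha : admissible a b c.

Lemma tden_cderiv cs sn z : cderiv (tden cs sn) z (- (Ci * sn))%C.
Proof.
eapply cderiv_eq; [unfold tden; cderiv_tac|ring].
Qed.

Lemma tnum_cderiv cs sn z : cderiv (fun z => tnum cs sn z (quad a b c z)) z
  (1 * tden cs sn z + z * - (Ci * sn) + Ci * sn * dquad a b z)%C.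
Proof.
assert (H := tden_cderiv cs sn z). assert (H' := quad_cderiv a b c z).
unfold tnum. cderiv_tac.
Qed.

Lemma Phi_modulus (delta : datum C2) (z1 z2 : C) (r cs sn : R) :
  data_param om a b c delta z1 z2 r -> cs ^ 2 + sn ^ 2 = 1 ->
  0 < Cmod (kern_form a b c cs sn z1 z2) /\
  modulus (push (Phi (om * ((cs, sn) * (cs, sn)))) delta) =
    r * (Cmod (anti_form a b c cs sn z1 z2) / Cmod (kern_form a b c cs sn z1 z2)).
Proof.
intros Hdp Hu.
assert (H1 := proj1 Hdp). assert (H2 := proj1 (proj2 Hdp)).
set (T := tden cs sn). set (N := fun z => tnum cs sn z (quad a b c z)).
assert (Hdom : forall z : C, 0 < fst z -> chart_dom z (quad a b c z)).
{ intros z Hz. now apply quad_chart_dom. }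
assert (Hcirc : circle (om * ((cs, sn) * (cs, sn)))).
{ unfold circle. rewrite !Cmod_mult, Ho.
  replace (Cmod (cs, sn)) with 1; [ring|]. unfold Cmod. cbn [fst snd]. now rewrite Hu, sqrt_1. }
assert (Ek : forall z w, kernel (fun z => T z - N z)%C (fun z => T z + N z)%C z w =
  (RtoC 2 * ((z + Cconj w) * kern_form a b c cs sn z w))%C).
{ intros z w. rewrite <- tnum_kernel. unfold kernel. fold (N z) (N w) (T z) (T w).
  rewrite !Cplus_conj, !Cminus_conj. ring. }
assert (Hs : 0 < Cmod (z1 + Cconj z2)) by (apply Cmod_gt_0; now apply hp_sum_neq).
assert (Hlt : forall z : C, 0 < fst z -> (T z + N z)%C <> RtoC 0 /\
  Cmod ((T z - N z) / (T z + N z))%C < 1).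
{ intros z Hz. assert (Hn := tden_plus_tnum_neq cs sn _ _ Hu (Hdom z Hz)).
  fold (T z) (N z) in Hn. split; auto.
  assert (Hp := tnum_tden_pos cs sn _ _ Hu (Hdom z Hz)). fold (T z) (N z) in Hp.
  assert (Hd := Cmod_sum_diff (T z) (N z)).
  assert (P : 0 < Cmod (T z + N z)) by now apply Cmod_gt_0.
  rewrite Cmod_div by auto. apply Rmult_lt_reg_r with (Cmod (T z + N z)); auto.
  unfold Rdiv. rewrite Rmult_assoc, Rinv_l by lra.
  generalize (Cmod_ge_0 (T z - N z)). intros. nra. }
assert (M : kernel (fun z => T z - N z)%C (fun z => T z + N z)%C z1 z2 <> RtoC 0 /\
  modulus (push (Phi (om * ((cs, sn) * (cs, sn)))) delta) =
  r * (Cmod (RtoC 2 * anti_form a b c cs sn z1 z2) * Cmod (z1 + Cconj z2) /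
       Cmod (kernel (fun z => T z - N z)%C (fun z => T z + N z)%C z1 z2))).
{ apply (modulus_quotient om a b c Ha (Phi (om * ((cs, sn) * (cs, sn)))) (Cconj om)
    (fun z => T z - N z)%C (fun z => T z + N z)%C
    (fun z w => RtoC 2 * anti_form a b c cs sn z w)%C delta z1 z2 r); auto.
  - intros z Hz. apply Phi_curve_derivable; auto. now apply chart_curve_in.
  - unfold circle. rewrite Cmod_conj. exact Ho.
  - intros z Hz. destruct (Hlt z Hz) as [L1 L2]. split; [auto|split; [auto|]].
    unfold chart_curve. rewrite Phi_point by auto. reflexivity.
  - intros z w.
    transitivity (RtoC 2 * (T z * N w - N z * T w))%C; [ring|].
    unfold N, T. rewrite tnum_anti. ring.
  - intros z.
    eexists _, _. split; [|split].
    + apply (cderiv_minus T N); [apply tden_cderiv|apply tnum_cderiv].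
    + apply (cderiv_plus T N); [apply tden_cderiv|apply tnum_cderiv].
    + unfold T, N, tnum, tden, anti_form, lin_form, disc_form, quad, dquad.
      destruct z. apply injective_projections; simpl; ring. }
destruct M as [M1 M2]. apply Cmod_gt_0 in M1. rewrite M2, Ek, !Cmod_mult, Cmod_R, Rabs_pos_eq in * by lra.
assert (Hk := Cmod_ge_0 (kern_form a b c cs sn z1 z2)).
split; [nra|]. field. split; nra.
Qed.

Lemma rho_formula (delta : datum C2) (z1 z2 : C) (r cs sn : R) :
  data_param om a b c delta z1 z2 r -> cs ^ 2 + sn ^ 2 = 1 ->
  0 < Cmod (kern_form a b c cs sn z1 z2) ^ 2 /\
  rho delta (om * ((cs, sn) * (cs, sn))) =
    r ^ 2 * (1 - 4 * (1 - a) * (fst z1 * fst z2) * (sn ^ 2 * disc_form a b c cs sn)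
       / Cmod (kern_form a b c cs sn z1 z2) ^ 2).
Proof.
intros Hdp Hu. destruct (Phi_modulus delta z1 z2 r cs sn Hdp Hu) as [Hk E].
split; [nra|]. unfold rho. rewrite E.
assert (Hd := kern_anti_diff a b c cs sn z1 z2).
set (K := Cmod (kern_form a b c cs sn z1 z2)) in *. set (A := Cmod (anti_form a b c cs sn z1 z2)) in *.
replace ((r * (A / K)) ^ 2) with (r ^ 2 * (A ^ 2 / K ^ 2)) by (field; lra).
f_equal. replace (A ^ 2) with (K ^ 2 - 4 * (1 - a) * (disc_form a b c cs sn * sn ^ 2) * (fst z1 * fst z2)) by lra.
field. lra.
Qed.

(** * The coordinate functions along a geodesic *)

Lemma fst_half_holomorphic :
  @holomorphic_map C2 C_NormedModule symbidisc Defs.disc (fun x : C2 => (fst x / RtoC 2)%C).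
Proof.
assert (N2 : RtoC 2 <> RtoC 0) by (apply RtoC_pos_neq; lra).
split.
- intros x _. exists (fun y : C2 => scal (/ RtoC 2)%C (fst y : C_NormedModule)).
  apply (filterdiff_ext (fun y : C2 => scal (/ RtoC 2)%C (fst y : C_NormedModule))).
  + intros y. unfold Cdiv. change (/ RtoC 2 * (fst y : C) = (fst y : C) * / RtoC 2)%C. ring.
  + apply (@filterdiff_scal_r_fct C_AbsRing C2 C_NormedModule (locally x) (filter_filter (ProperFilter := locally_filter x))
      (/ RtoC 2)%C (fun y => fst y) (fun y => fst y)); [exact Cmult_comm|].
    apply filterdiff_linear. apply (@is_linear_fst C_AbsRing C_NormedModule C_NormedModule).
- intros x (z & w & Hz & Hw & ->). cbn [fst]. unfold Defs.disc in *.
  rewrite Cmod_div, Cmod_R, Rabs_pos_eq by (auto; lra).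
  generalize (Cmod_triangle z w). intros. lra.
Qed.

Lemma snd_holomorphic :
  @holomorphic_map C2 C_NormedModule symbidisc Defs.disc (fun x : C2 => snd x).
Proof.
split.
- intros x _. exists (fun y : C2 => snd y). apply filterdiff_linear.
  apply (@is_linear_snd C_AbsRing C_NormedModule C_NormedModule).
- intros x (z & w & Hz & Hw & ->). cbn [snd]. unfold Defs.disc in *. rewrite Cmod_mult.
  generalize (Cmod_ge_0 z) (Cmod_ge_0 w). intros. nra.
Qed.

(** All moduli are at most [r] by [modulus_pick_bound], and [F] attains [r]; so the Caratheodory
    supremum is [r], and solving the problem means attaining it. *)
Lemma solves_Car_iff (delta : datum C2) (z1 z2 : C) (r : R) (f F : C2 -> C) :
  data_param om a b c delta z1 z2 r ->
  @holomorphic_map C2 C_NormedModule symbidisc Defs.disc F -> modulus (push F delta) = r ->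
  solves_Car delta f <->
  @holomorphic_map C2 C_NormedModule symbidisc Defs.disc f /\ modulus (push f delta) = r.
Proof.
intros Hdp HF EF. split.
- intros [Hf [Hub _]]. split; auto. apply Rle_antisym.
  + now apply (modulus_pick_bound om a b c Ho Ha f delta z1 z2).
  + rewrite <- EF. apply Hub. exists F. auto.
- intros [Hf Ef]. split; auto. rewrite Ef. split.
  + intros t (g & Hg & ->). now apply (modulus_pick_bound om a b c Ho Ha g delta z1 z2).
  + intros t Ht. apply Ht. exists f. auto.
Qed.
End Rho.

Lemma Cmod_lt_sq (x y : C) : Cmod x ^ 2 < Cmod y ^ 2 -> Cmod x < Cmod y.
Proof. generalize (Cmod_ge_0 x) (Cmod_ge_0 y). intros. nra. Qed.

Ltac Cring :=
  repeat match goal with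
  | |- context [?z] => is_var z; match type of z with C => destruct z end
  end;
  apply injective_projections; simpl; ring.

Section Coordinates.
Variables (om : C).
Hypothesis Ho : circle om.
Variables (delta : datum C2) (z1 z2 : C) (r : R).

Lemma quad_0 (z : C) : quad 0 0 0 z = RtoC 0.
Proof. unfold quad. ring. Qed.

Lemma chart_q_flat (b c : R) (z : C) :
  chart_q z (quad 1 b c z) = ((RtoC 2 - Ci * b) * z + (1 + c))%C.
Proof. unfold chart_q, quad. ring. Qed.

Lemma chart_q_royal (z : C) : chart_q z (quad 0 0 0 z) = ((z + 1) * (z + 1))%C.
Proof. rewrite quad_0. unfold chart_q. ring. Qed.

Lemma circle_conj_om : circle (Cconj om) /\ circle (Cconj om * Cconj om).
Proof. unfold circle. rewrite Cmod_mult, Cmod_conj, Ho. split; ring. Qed.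

Lemma modulus_of_ratio (a b c : R) (F : C2 -> C) (u : C) (num den : C -> C) (Q : C -> C -> C) :
  admissible a b c -> data_param om a b c delta z1 z2 r ->
  @holomorphic_map C2 C_NormedModule symbidisc Defs.disc F -> circle u ->
  (forall z, den z = chart_q z (quad a b c z)) ->
  (forall z : C, 0 < fst z -> den z <> RtoC 0 -> F (chart_curve om a b c z) = (u * (num z / den z))%C) ->
  (forall z w : C, (num z * den w - num w * den z = (z - w) * Q z w)%C) ->
  (forall z : C, exists n' d', cderiv num z n' /\ cderiv den z d' /\
     (n' * den z - num z * d' = Q z z)%C) ->
  (Cmod (Q z1 z2 * (z1 + Cconj z2)) = Cmod (kernel num den z1 z2) -> modulus (push F delta) = r) /\
  (Cmod (Q z1 z2 * (z1 + Cconj z2)) < Cmod (kernel num den z1 z2) -> modulus (push F delta) < r).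
Proof.
intros Ha Hdp HF Hu Hq HE HQ HQd.
destruct (modulus_quotient_holomorphic om a b c Ho Ha F u num den Q delta z1 z2 r) as [Hk E]; auto.
{ intros z Hz. assert (Hd : den z <> RtoC 0); [|auto].
  rewrite Hq. apply chart_q_neq. now apply quad_chart_dom. }
apply Cmod_gt_0 in Hk. rewrite E, Cmod_mult.
destruct Hdp as (_ & _ & Hr & _).
split; intros H.
- rewrite H. field. lra.
- rewrite <- (Rmult_1_r r) at 2. apply Rmult_lt_compat_l; auto.
  apply Rmult_lt_reg_r with (Cmod (kernel num den z1 z2)); auto.
  unfold Rdiv. rewrite Rmult_assoc, Rinv_l by lra. lra.
Qed.

(** For [a = 1] the quadratic terms of [chart_q] cancel, so [p] is a fractional linear function of
    the half-plane parameter, and the comparison of [Q] with [kernel] is an equality. *)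
Lemma snd_flat_modulus (b c : R) :
  admissible 1 b c -> data_param om 1 b c delta z1 z2 r ->
  modulus (push (fun x : C2 => snd x) delta) = r.
Proof.
intros Ha Hdp.
apply (modulus_of_ratio 1 b c (fun x : C2 => snd x) (Cconj om * Cconj om)%C
  (fun z => - (RtoC 2 + Ci * b) * z + (1 + c))%C (fun z => (RtoC 2 - Ci * b) * z + (1 + c))%C
  (fun _ _ => - (RtoC 4 * (1 + c)))%C); auto.
- apply snd_holomorphic.
- apply circle_conj_om.
- intros z. now rewrite chart_q_flat.
- intros z _ Hd. unfold chart_curve, point_p. cbn [snd]. rewrite chart_q_flat. f_equal.
  transitivity (((RtoC 2 - Ci * b) * z + (1 + c) - RtoC 4 * z) / ((RtoC 2 - Ci * b) * z + (1 + c)))%C;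
    [field; auto|]. f_equal. Cring.
- intros z w. Cring.
- intros z. eexists _, _. split; [cderiv_tac|split; [cderiv_tac|]]. Cring.
- rewrite <- Cmod_opp. f_equal. unfold kernel. Cring.
Qed.

(** Again [s / 2] is fractional linear in the parameter, but contracts strictly; this separates flat
    from royal data. *)
Lemma fst_flat_modulus (b c : R) :
  admissible 1 b c -> data_param om 1 b c delta z1 z2 r ->
  modulus (push (fun x : C2 => (fst x / RtoC 2)%C) delta) < r.
Proof.
intros Ha Hdp. assert (H1 := proj1 Hdp). assert (H2 := proj1 (proj2 Hdp)).
assert (Hc : 0 <= c) by (destruct Ha as (_ & H & _); specialize (H 0); lra).
assert (Hdisc := pos_quadratic_discr 1 b c Rlt_0_1 (proj2 (proj2 Ha) eq_refl)).
assert (N2 : RtoC 2 <> RtoC 0) by (apply RtoC_pos_neq; lra).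
apply (modulus_of_ratio 1 b c (fun x : C2 => (fst x / RtoC 2)%C) (Cconj om)
  (fun z => - (Ci * b) * z + (c - 1))%C (fun z => (RtoC 2 - Ci * b) * z + (1 + c))%C
  (fun _ _ => RtoC 2 - RtoC 2 * c - RtoC 2 * (Ci * b))%C); auto.
- apply fst_half_holomorphic.
- apply circle_conj_om.
- intros z. now rewrite chart_q_flat.
- intros z _ Hd. unfold chart_curve, point_s. cbn [fst]. rewrite chart_q_flat.
  transitivity (Cconj om * (((RtoC 2 - Ci * b) * z + (1 + c) - RtoC 4 * (z + 1) / RtoC 2) / ((RtoC 2 - Ci * b) * z + (1 + c))))%C;
    [field; auto|]. do 2 f_equal.
  replace (RtoC 4) with (RtoC 2 * RtoC 2)%C by Cring.
  transitivity ((RtoC 2 - Ci * b) * z + (1 + c) - RtoC 2 * (z + 1))%C; [field; auto|Cring].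
- intros z w. ring.
- intros z. eexists _, _. split; [cderiv_tac|split; [cderiv_tac|]]. ring.
- apply Cmod_lt_sq. rewrite !Cmod2_alt.
  unfold kernel. destruct z1 as [x1 y1], z2 as [x2 y2]. simpl in *.
  set (v1 := y1 + b / 2). set (v2 := y2 + b / 2).
  replace y1 with (v1 - b / 2) by (unfold v1; ring). replace y2 with (v2 - b / 2) by (unfold v2; ring).
  set (e := 4 * c - b ^ 2) in *. assert (He : 0 < e) by (unfold e; lra).
  (* With z = Z - i b / 2, the difference of the two sides is
     |X|^2 + 4 (1 + c) Re (X conj S) + 4 e |S|^2, X = 4 Z1 conj Z2 + e, S = Z1 + conj Z2 *)
  apply Rlt_0_minus.
  match goal with |- 0 < ?G => replace G with
    ((4 * (x1 * x2 + v1 * v2) + e) ^ 2 + (4 * (v1 * x2 - x1 * v2)) ^ 2 +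
     4 * (1 + c) * (4 * ((x1 ^ 2 + v1 ^ 2) * x2 + (x2 ^ 2 + v2 ^ 2) * x1) + e * (x1 + x2)) +
     4 * e * ((x1 + x2) ^ 2 + (v1 - v2) ^ 2)) by (unfold e; field) end.
  assert (0 < (x1 ^ 2 + v1 ^ 2) * x2) by (apply Rmult_lt_0_compat; nra).
  assert (0 < (x2 ^ 2 + v2 ^ 2) * x1) by (apply Rmult_lt_0_compat; nra).
  assert (0 < e * (x1 + x2)) by (apply Rmult_lt_0_compat; lra).
  assert (0 < 4 * (1 + c) * (4 * ((x1 ^ 2 + v1 ^ 2) * x2 + (x2 ^ 2 + v2 ^ 2) * x1) + e * (x1 + x2)))
    by (apply Rmult_lt_0_compat; lra).
  assert (0 <= e * ((x1 + x2) ^ 2 + (v1 - v2) ^ 2)).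
  { apply Rmult_le_pos; [lra|]. generalize (pow2_ge_0 (x1 + x2)) (pow2_ge_0 (v1 - v2)). lra. }
  generalize (pow2_ge_0 (4 * (x1 * x2 + v1 * v2) + e)) (pow2_ge_0 (4 * (v1 * x2 - x1 * v2))). lra.
Qed.

(** On [g = 0] the function [s / 2] is [cayley] up to a rotation, hence an isometry. The common
    factor [z + 1] is kept because the denominator has to be [chart_q]. *)
Lemma fst_royal_modulus :
  admissible 0 0 0 -> data_param om 0 0 0 delta z1 z2 r ->
  modulus (push (fun x : C2 => (fst x / RtoC 2)%C) delta) = r.
Proof.
intros Ha Hdp. assert (N2 : RtoC 2 <> RtoC 0) by (apply RtoC_pos_neq; lra).
apply (modulus_of_ratio 0 0 0 (fun x : C2 => (fst x / RtoC 2)%C) (Cconj om)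
  (fun z => (z - 1) * (z + 1))%C (fun z => (z + 1) * (z + 1))%C
  (fun z w => RtoC 2 * ((z + 1) * (w + 1)))%C); auto.
- apply fst_half_holomorphic.
- apply circle_conj_om.
- intros z. now rewrite chart_q_royal.
- intros z Hz _. assert (Hn := plus_one_neq z Hz).
  unfold chart_curve, point_s. cbn [fst]. rewrite chart_q_royal.
  transitivity (Cconj om * ((z + 1 - RtoC 2) * (z + 1) / ((z + 1) * (z + 1))))%C.
  + replace (RtoC 4) with (RtoC 2 * RtoC 2)%C by Cring. field. auto.
  + do 3 f_equal. Cring.
- intros z w. Cring.
- intros z. eexists _, _. split; [cderiv_tac|split; [cderiv_tac|]]. Cring.
- transitivity (Cmod (RtoC 2 * (z1 + Cconj z2) * ((z1 + 1) * Cconj (z2 + 1)))).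
  + rewrite !Cmod_mult, Cmod_conj. ring.
  + f_equal. unfold kernel. Cring.
Qed.

(** Here [p] is the square of [s / 2], and squaring contracts strictly: after the common factor
    [z1 + conj z2] the claim is [|z1 z2 - 1| < |z1 conj z2 + 1|]. *)
Lemma snd_royal_modulus :
  admissible 0 0 0 -> data_param om 0 0 0 delta z1 z2 r ->
  modulus (push (fun x : C2 => snd x) delta) < r.
Proof.
intros Ha Hdp. assert (H1 := proj1 Hdp). assert (H2 := proj1 (proj2 Hdp)).
apply (modulus_of_ratio 0 0 0 (fun x : C2 => snd x) (Cconj om * Cconj om)%C
  (fun z => (z - 1) * (z - 1))%C (fun z => (z + 1) * (z + 1))%C
  (fun z w => RtoC 4 * (z * w - 1))%C); auto.
- apply snd_holomorphic.
- apply circle_conj_om.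
- intros z. now rewrite chart_q_royal.
- intros z _ Hd. unfold chart_curve, point_p. cbn [snd]. rewrite chart_q_royal. f_equal.
  transitivity (((z + 1) * (z + 1) - RtoC 4 * z) / ((z + 1) * (z + 1)))%C; [field; auto|].
  + intros E. apply Hd. rewrite E. ring.
  + f_equal. Cring.
- intros z w. Cring.
- intros z. eexists _, _. split; [cderiv_tac|split; [cderiv_tac|]]. Cring.
- replace (kernel _ _ z1 z2) with (RtoC 4 * (z1 * Cconj z2 + 1) * (z1 + Cconj z2))%C
    by (unfold kernel; Cring).
  assert (Hs : 0 < Cmod (z1 + Cconj z2)) by (apply Cmod_gt_0; now apply hp_sum_neq).
  assert (Hlt : Cmod (z1 * z2 - 1) < Cmod (z1 * Cconj z2 + 1)).
  { apply Cmod_lt_sq. rewrite !Cmod2_alt. destruct z1 as [x1 y1], z2 as [x2 y2]. simpl in *.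
    assert (0 < x1 * x2) by now apply Rmult_lt_0_compat. apply Rlt_0_minus.
    match goal with |- 0 < ?G => replace G with (4 * (x1 * x2)) by ring end. lra. }
  rewrite !Cmod_mult, Cmod_R, Rabs_pos_eq by lra.
  apply Rmult_lt_compat_r; lra.
Qed.
End Coordinates.

(** * Second derivatives at a double zero, and half-angles *)

Definition twice_derivable (f : R -> R) : Prop :=
  exists f1 f2, forall t, is_derive f t (f1 t) /\ is_derive f1 t (f2 t).

Lemma twice_const k : twice_derivable (fun _ => k).
Proof. exists (fun _ => 0), (fun _ => 0). intros t. split; apply @is_derive_const. Qed.

Lemma twice_plus f g : twice_derivable f -> twice_derivable g -> twice_derivable (fun t => f t + g t).
Proof.
intros (f1 & f2 & Hf) (g1 & g2 & Hg). exists (fun t => f1 t + g1 t), (fun t => f2 t + g2 t).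
intros t. destruct (Hf t), (Hg t). split.
- now apply (is_derive_plus f g).
- now apply (is_derive_plus f1 g1).
Qed.

Lemma twice_mult f g : twice_derivable f -> twice_derivable g -> twice_derivable (fun t => f t * g t).
Proof.
intros (f1 & f2 & Hf) (g1 & g2 & Hg). exists (fun t => f1 t * g t + f t * g1 t),
  (fun t => (f2 t * g t + f1 t * g1 t) + (f1 t * g1 t + f t * g2 t)).
intros t. destruct (Hf t), (Hg t). split.
- now apply (Derive.is_derive_mult f g).
- apply (is_derive_plus (fun t => f1 t * g t) (fun t => f t * g1 t)).
  + now apply (Derive.is_derive_mult f1 g).
  + now apply (Derive.is_derive_mult f g1).
Qed.

Lemma twice_inv f : (forall t, f t <> 0) -> twice_derivable f -> twice_derivable (fun t => / f t).
Proof.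
intros H0 (f1 & f2 & Hf).
assert (Hi : forall t, is_derive (fun t => / f t) t (- f1 t / f t ^ 2)).
{ intros t. apply is_derive_inv; auto. apply Hf. }
exists (fun t => - f1 t / f t ^ 2),
  (fun t => (- f2 t * (f t ^ 2) - (- f1 t) * (INR 2 * f1 t * f t ^ 1)) / (f t ^ 2) ^ 2).
intros t. split; auto.
apply (is_derive_div (fun t => - f1 t) (fun t => f t ^ 2)).
- apply (is_derive_opp f1). apply Hf.
- apply (is_derive_pow f 2 t (f1 t)). apply Hf.
- apply pow_nonzero; auto.
Qed.

Lemma twice_cos t0 : twice_derivable (fun t => cos ((t - t0) / 2)).
Proof.
exists (fun t => - sin ((t - t0) / 2) / 2), (fun t => - cos ((t - t0) / 2) / 4).
intros t. unfold Rminus, Rdiv. split; (auto_derive; [auto|field]).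
Qed.

Lemma twice_sin t0 : twice_derivable (fun t => sin ((t - t0) / 2)).
Proof.
exists (fun t => cos ((t - t0) / 2) / 2), (fun t => - sin ((t - t0) / 2) / 4).
intros t. unfold Rminus, Rdiv. split; (auto_derive; [auto|field]).
Qed.

Lemma twice_ext f g : (forall t, f t = g t) -> twice_derivable f -> twice_derivable g.
Proof.
intros E (f1 & f2 & H). exists f1, f2. intros t. destruct (H t). split; auto.
now apply (is_derive_ext f).
Qed.

Ltac twice_tac :=
  lazymatch goal with
  | |- twice_derivable (fun _ => ?k) => apply twice_const
  | |- twice_derivable (fun t => @?f t + @?g t) => apply (twice_plus f g); twice_tac
  | |- twice_derivable (fun t => @?f t * @?g t) => apply (twice_mult f g); twice_tac
  | _ => assumption
  end.

(** The factor [sin^2] has a double zero at [t0] with second derivative 1/2 there, so only the value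
    of [h] survives, not its derivatives. *)
Lemma second_derivative_double_zero (K t0 : R) (h : R -> R) : twice_derivable h ->
  Derive_n (fun t => K + sin ((t - t0) / 2) ^ 2 * h t) 2 t0 = h t0 / 2.
Proof.
intros (h1 & h2 & H).
assert (D1 : forall t, Derive (fun t => K + sin ((t - t0) / 2) ^ 2 * h t) t =
  sin ((t - t0) / 2) * (cos ((t - t0) / 2) * h t + sin ((t - t0) / 2) * h1 t)).
{ intros t. apply is_derive_unique. destruct (H t) as [Hh _].
  assert (Eh : Derive (fun x => h x) t = h1 t) by now apply is_derive_unique.
  auto_derive; [repeat split; now exists (h1 t)|]. rewrite Eh. unfold Rminus, Rdiv. field. }
cbn [Derive_n].
etransitivity; [apply Derive_ext; exact D1|].
apply is_derive_unique. destruct (H t0) as [Hh Hh1].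
assert (Eh : Derive (fun x => h x) t0 = h1 t0) by now apply is_derive_unique.
assert (Eh1 : Derive (fun x => h1 x) t0 = h2 t0) by now apply is_derive_unique.
auto_derive; [repeat split; [now exists (h1 t0)|now exists (h2 t0)]|].
rewrite Eh, Eh1. unfold Rminus. rewrite Rplus_opp_r.
unfold Rdiv. rewrite Rmult_0_l, sin_0, cos_0. field.
Qed.

Lemma circle_expi (w : C) : circle w -> exists t, w = expi t.
Proof.
intros H. destruct w as [x y].
destruct (unit_circle_angle x y) as (t & _ & -> & ->); [|now exists t].
unfold circle in H. assert (E := Cmod2_alt (x, y)). rewrite H in E. simpl in *. lra.
Qed.

Lemma expi_half (t t0 : R) :
  expi t = (expi t0 * ((cos ((t - t0) / 2), sin ((t - t0) / 2)) *
                       (cos ((t - t0) / 2), sin ((t - t0) / 2))))%C.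
Proof.
set (u := (t - t0) / 2).
assert (Et : t = t0 + 2 * u) by (unfold u; field). rewrite Et.
unfold expi. rewrite cos_plus, sin_plus, cos_2a, sin_2a.
apply injective_projections; simpl; ring.
Qed.

(** Half-angle parameters [cs], [sn] relative to [om] reach the whole circle, so every value of
    [rho] is covered by [rho_formula]. *)
Lemma circle_square (om w : C) : circle om -> circle w ->
  exists cs sn, cs ^ 2 + sn ^ 2 = 1 /\ w = (om * ((cs, sn) * (cs, sn)))%C.
Proof.
intros Ho Hw. destruct (circle_expi om Ho) as [t0 ->]. destruct (circle_expi w Hw) as [t ->].
exists (cos ((t - t0) / 2)), (sin ((t - t0) / 2)). split.
- generalize (sin2_cos2 ((t - t0) / 2)). unfold Rsqr. intros; lra.
- apply expi_half.
Qed.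

(** * Maximizers of rho and its second derivative *)

Section Maximizers.
Variables (om : C) (a b c : R).
Hypothesis Ho : circle om.
Hypothesis Ha : admissible a b c.
Variables (delta : datum C2) (z1 z2 : C) (r : R).
Hypothesis Hdp : data_param om a b c delta z1 z2 r.

Lemma square_circle (cs sn : R) : cs ^ 2 + sn ^ 2 = 1 -> circle (om * ((cs, sn) * (cs, sn))).
Proof.
intros Hu. unfold circle. rewrite !Cmod_mult, Ho.
replace (Cmod (cs, sn)) with 1; [ring|]. unfold Cmod. cbn [fst snd]. now rewrite Hu, sqrt_1.
Qed.

Lemma rho_le (w : C) : circle w -> rho delta w <= r ^ 2.
Proof.
intros Hw. destruct (circle_square om w Ho Hw) as (cs & sn & Hu & ->).
destruct (rho_formula om a b c Ho Ha delta z1 z2 r cs sn Hdp Hu) as [Hk ->].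
destruct Hdp as (H1 & H2 & Hr & _).
assert (HN := disc_form_nonneg a b c cs sn Ha). destruct Ha as ([_ Ha1] & _).
rewrite <- (Rmult_1_r (r ^ 2)) at 2. apply Rmult_le_compat_l; [nra|].
assert (0 <= 4 * (1 - a) * (fst z1 * fst z2) * (sn ^ 2 * disc_form a b c cs sn) /
  Cmod (kern_form a b c cs sn z1 z2) ^ 2); [|lra].
apply Rmult_le_pos; [|left; now apply Rinv_0_lt_compat].
apply Rmult_le_pos.
- apply Rmult_le_pos; [lra|]. apply Rmult_le_pos; lra.
- apply Rmult_le_pos; auto. apply pow2_ge_0.
Qed.

Lemma rho_eq_iff (cs sn : R) : cs ^ 2 + sn ^ 2 = 1 ->
  rho delta (om * ((cs, sn) * (cs, sn))) = r ^ 2 <->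
  (1 - a) * (sn ^ 2 * disc_form a b c cs sn) = 0.
Proof.
intros Hu. destruct (rho_formula om a b c Ho Ha delta z1 z2 r cs sn Hdp Hu) as [Hk ->].
destruct Hdp as (H1 & H2 & Hr & _).
assert (Hx : 0 < fst z1 * fst z2) by now apply Rmult_lt_0_compat.
set (K := Cmod (kern_form a b c cs sn z1 z2) ^ 2) in *.
set (M := sn ^ 2 * disc_form a b c cs sn).
assert (Hr2 : 0 < r ^ 2) by nra.
split.
- intros E. assert (E1 : r ^ 2 * (4 * (fst z1 * fst z2)) / K * ((1 - a) * M) = 0).
  { replace (r ^ 2 * (4 * (fst z1 * fst z2)) / K * ((1 - a) * M)) with
      (r ^ 2 - r ^ 2 * (1 - 4 * (1 - a) * (fst z1 * fst z2) * M / K)) by (field; lra). lra. }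
  apply Rmult_integral in E1. destruct E1 as [E1|E1]; auto. exfalso.
  assert (0 < r ^ 2 * (4 * (fst z1 * fst z2)) / K); [|lra].
  apply Rdiv_lt_0_compat; auto. apply Rmult_lt_0_compat; lra.
- intros E. replace (4 * (1 - a) * (fst z1 * fst z2) * M) with (4 * (fst z1 * fst z2) * ((1 - a) * M)) by ring.
  rewrite E. field. lra.
Qed.

Lemma rho_om : rho delta om = r ^ 2.
Proof.
assert (E : om = (om * ((RtoC 1) * (RtoC 1)))%C) by ring.
rewrite E at 1. apply (rho_eq_iff 1 0); ring.
Qed.

Lemma maximizer_iff (w : C) : maximizer delta w <-> circle w /\ rho delta w = r ^ 2.
Proof.
split.
- intros [Hw Hm]. split; auto. apply Rle_antisym; [now apply rho_le|].
  rewrite <- rho_om. now apply Hm.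
- intros [Hw E]. split; auto. intros w' Hw'. rewrite E. now apply rho_le.
Qed.

Lemma maximizer_om : maximizer delta om.
Proof. apply maximizer_iff. split; auto. apply rho_om. Qed.

Lemma maximizer_square (cs sn : R) : cs ^ 2 + sn ^ 2 = 1 ->
  maximizer delta (om * ((cs, sn) * (cs, sn))) <->
  (1 - a) * (sn ^ 2 * disc_form a b c cs sn) = 0.
Proof.
intros Hu. rewrite maximizer_iff, <- rho_eq_iff by auto. split; [tauto|].
intros E. split; auto. now apply square_circle.
Qed.

Lemma rho_constant_iff : rho_constant delta <-> forall w, circle w -> maximizer delta w.
Proof.
split.
- intros H w Hw. apply maximizer_iff. split; auto. rewrite (H w om Hw Ho). apply rho_om.
- intros H w w' Hw Hw'.
  apply H, maximizer_iff in Hw. apply H, maximizer_iff in Hw'. destruct Hw, Hw'. congruence.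
Qed.

Lemma rho_second_derivative : exists k, 0 < k /\ forall t0, expi t0 = om ->
  Derive_n (fun t => rho delta (expi t)) 2 t0 = - (k * ((1 - a) * a)).
Proof.
assert (Hu1 : 1 ^ 2 + 0 ^ 2 = 1) by ring.
destruct (rho_formula om a b c Ho Ha delta z1 z2 r 1 0 Hdp Hu1) as [Hk1 _].
pose proof Hdp as (H1 & H2 & Hr & _).
assert (Hx : 0 < fst z1 * fst z2) by now apply Rmult_lt_0_compat.
set (K0 := Cmod (kern_form a b c 1 0 z1 z2) ^ 2) in *.
(* Here [rho = r^2 + sn^2 h] with [h = - 4 r^2 (1 - a) Re z1 Re z2 disc_form / |kern_form|^2]. At
   [t0], where [(cs, sn) = (1, 0)], [disc_form] equals [a], and the second derivative is half of
   [h t0]. *)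
exists (2 * r ^ 2 * (fst z1 * fst z2) / K0). split.
{ apply Rdiv_lt_0_compat; auto. apply Rmult_lt_0_compat; [nra|auto]. }
intros t0 Et0.
set (cs := fun t => cos ((t - t0) / 2)). set (sn := fun t => sin ((t - t0) / 2)).
assert (Hu : forall t, cs t ^ 2 + sn t ^ 2 = 1).
{ intros t. generalize (sin2_cos2 ((t - t0) / 2)). unfold Rsqr, cs, sn. intros; lra. }
set (Q := fun t => fst (kern_form a b c (cs t) (sn t) z1 z2) ^ 2 + snd (kern_form a b c (cs t) (sn t) z1 z2) ^ 2).
assert (HQ : forall t, Cmod (kern_form a b c (cs t) (sn t) z1 z2) ^ 2 = Q t).
{ intros t. rewrite Cmod2_alt. reflexivity. }
set (h := fun t => - (4 * r ^ 2 * (1 - a) * (fst z1 * fst z2)) * (disc_form a b c (cs t) (sn t) * / Q t)).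
assert (Hcs : twice_derivable cs) by apply twice_cos.
assert (Hsn : twice_derivable sn) by apply twice_sin.
assert (Hh : twice_derivable h).
{ unfold h. apply twice_mult; [apply twice_const|]. apply twice_mult.
  - apply (twice_ext (fun t => a * (cs t * cs t) + (- b) * (cs t * sn t) + c * (sn t * sn t))).
    + intros t. unfold disc_form. ring.
    + twice_tac.
  - apply twice_inv.
    + intros t. destruct (rho_formula om a b c Ho Ha delta z1 z2 r (cs t) (sn t) Hdp (Hu t)) as [Hk _].
      rewrite HQ in Hk. lra.
    + destruct z1 as [x1 y1], z2 as [x2 y2].
      (* The squared real and imaginary parts of [kern_form], written out as polynomials in [cs] and
         [sn] so that [twice_tac] applies. *)
      apply (twice_ext (fun t =>
        ((1 - a) * ((x1 * x2 + y1 * y2) * (sn t * sn t) + cs t * cs t + (y1 + y2) * (sn t * cs t)) +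
           (a * (cs t * cs t) + (- b) * (cs t * sn t) + c * (sn t * sn t))) *
        ((1 - a) * ((x1 * x2 + y1 * y2) * (sn t * sn t) + cs t * cs t + (y1 + y2) * (sn t * cs t)) +
           (a * (cs t * cs t) + (- b) * (cs t * sn t) + c * (sn t * sn t))) +
        ((1 - a) * ((y1 * x2 + - (x1 * y2)) * (sn t * sn t) + (x2 + - x1) * (sn t * cs t))) *
        ((1 - a) * ((y1 * x2 + - (x1 * y2)) * (sn t * sn t) + (x2 + - x1) * (sn t * cs t))))).
      * intros t. unfold Q, kern_form, lin_form, disc_form. simpl. ring.
      * twice_tac. }
rewrite (Derive_n_ext _ (fun t => r ^ 2 + sin ((t - t0) / 2) ^ 2 * h t)).
- rewrite second_derivative_double_zero by auto. unfold h.
  assert (C0 : cs t0 = 1).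
  { unfold cs, Rminus. rewrite Rplus_opp_r. unfold Rdiv. rewrite Rmult_0_l. apply cos_0. }
  assert (S0 : sn t0 = 0).
  { unfold sn, Rminus. rewrite Rplus_opp_r. unfold Rdiv. rewrite Rmult_0_l. apply sin_0. }
  rewrite <- HQ, C0, S0. fold K0. unfold disc_form. field. lra.
- intros t. rewrite (expi_half t t0), Et0.
  destruct (rho_formula om a b c Ho Ha delta z1 z2 r (cs t) (sn t) Hdp (Hu t)) as [Hk E].
  fold (cs t) (sn t). rewrite E, HQ. rewrite HQ in Hk. unfold h. field. lra.
Qed.
End Maximizers.

(** * Mutual exclusion of the alternatives *)

Lemma royal_point_inj (z w : C) : royal_point z = royal_point w -> z = w.
Proof.
intros E. apply (f_equal fst) in E. unfold royal_point in E. cbn [fst] in E.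
assert (N2 : RtoC 2 <> RtoC 0) by (apply RtoC_pos_neq; lra).
replace z with (RtoC 2 * z / RtoC 2)%C by (field; auto). rewrite E. field.
Qed.

Lemma royal_disjoint (x : C2) : royal_variety x -> royal_boundary x -> False.
Proof.
intros (z & Hz & E1) (w & Hw & E2). rewrite E1 in E2. apply (royal_point_inj z w) in E2.
subst w. lra.
Qed.

(** The parameters 0, 1/2 and 1 give three distinct points of the closed royal variety. *)
Lemma closure_royal_many (a b : C2) :
  ~ (forall x, closure royal_variety x -> x = a \/ x = b).
Proof.
intros H.
assert (Hc : forall t : R, 0 <= t <= 1 -> royal_point (RtoC t) = a \/ royal_point (RtoC t) = b).
{ intros t Ht. apply H, closure_royal. exists (RtoC t). split; auto.
  rewrite Cmod_R, Rabs_pos_eq; lra. }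
assert (Hi : forall s t, royal_point (RtoC s) = royal_point (RtoC t) -> s = t).
{ intros s t E. apply royal_point_inj in E. now apply (f_equal fst) in E. }
destruct (Hc 0) as [E0|E0]; [lra| |]; destruct (Hc 1) as [E1|E1]; [lra| | |lra| |];
  destruct (Hc (1 / 2)) as [E2|E2]; try lra;
  (assert (F1 := Hi 0 1); assert (F2 := Hi 0 (1 / 2)); assert (F3 := Hi 1 (1 / 2));
   rewrite E0, E1, E2 in *; try (specialize (F1 eq_refl); lra); try (specialize (F2 eq_refl); lra);
   try (specialize (F3 eq_refl); lra)).
Qed.

(** If two families of mutually exclusive alternatives always occur in matching pairs, each pair is
    an equivalence. *)
Lemma iff_of_exclusive_cases (E1 E2 E3 E4 E5 T1 T2 T3 T4 T5 : Prop) :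
  (E1 -> ~ E2 /\ ~ E3 /\ ~ E4 /\ ~ E5) -> (E2 -> ~ E3 /\ ~ E4 /\ ~ E5) ->
  (E3 -> ~ E4 /\ ~ E5) -> (E4 -> ~ E5) ->
  (T1 -> ~ T2 /\ ~ T3 /\ ~ T4 /\ ~ T5) -> (T2 -> ~ T3 /\ ~ T4 /\ ~ T5) ->
  (T3 -> ~ T4 /\ ~ T5) -> (T4 -> ~ T5) ->
  (E1 /\ T1) \/ (E2 /\ T2) \/ (E3 /\ T3) \/ (E4 /\ T4) \/ (E5 /\ T5) ->
  (E1 <-> T1) /\ (E2 <-> T2) /\ (E3 <-> T3) /\ (E4 <-> T4) /\ (E5 <-> T5).
Proof. tauto. Qed.

Section RoyalSets.
Variable E : C2 -> Prop.

Definition meets_in_and_boundary : Prop :=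
  exists a b : C2, royal_variety a /\ royal_boundary b /\ a <> b /\
    forall x, E x <-> x = a \/ x = b.
Definition meets_boundary_once : Prop :=
  exists a : C2, royal_boundary a /\ forall x, E x <-> x = a.
Definition meets_boundary_twice : Prop :=
  exists a b : C2, royal_boundary a /\ royal_boundary b /\ a <> b /\
    forall x, E x <-> x = a \/ x = b.
Definition meets_in_once : Prop :=
  exists a : C2, royal_variety a /\ forall x, E x <-> x = a.
Definition contains_royal : Prop := forall x, E x <-> closure royal_variety x.

Lemma not_single_and_pair (p a b : C2) : (forall x, E x <-> x = p) -> a <> b ->
  (forall x, E x <-> x = a \/ x = b) -> False.
Proof.
intros H1 Hn H2. apply Hn.
transitivity p; [|symmetry]; apply H1, H2; auto.
Qed.

Lemma royal_sets_exclusive :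
  (meets_in_and_boundary -> ~ meets_boundary_once /\ ~ meets_boundary_twice /\ ~ meets_in_once /\ ~ contains_royal) /\
  (meets_boundary_once -> ~ meets_boundary_twice /\ ~ meets_in_once /\ ~ contains_royal) /\
  (meets_boundary_twice -> ~ meets_in_once /\ ~ contains_royal) /\
  (meets_in_once -> ~ contains_royal).
Proof.
assert (M1 : forall p, (forall x, E x <-> x = p) -> ~ contains_royal).
{ intros p H HR. apply (closure_royal_many p p). intros x Hx. left. now apply H, HR. }
assert (M2 : forall p q, (forall x, E x <-> x = p \/ x = q) -> ~ contains_royal).
{ intros p q H HR. apply (closure_royal_many p q). intros x Hx. now apply H, HR. }
repeat split.
- intros (q & _ & K). destruct H as (a & b & _ & _ & Hn & H). exact (not_single_and_pair q a b K Hn H).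
- intros (p & q & Hp & Hq & _ & K). destruct H as (a & b & Ha & _ & _ & H).
  destruct (proj1 (K a) (proj2 (H a) (or_introl eq_refl))); subst; eapply royal_disjoint; eauto.
- intros (q & _ & K). destruct H as (a & b & _ & _ & Hn & H). exact (not_single_and_pair q a b K Hn H).
- destruct H as (a & b & _ & _ & _ & H). exact (M2 a b H).
- intros (p & q & _ & _ & Hn & K). destruct H as (a & _ & H). exact (not_single_and_pair a p q H Hn K).
- intros (q & Hq & K). destruct H as (a & Ha & H).
  assert (a = q) by now apply K, H. subst. eapply royal_disjoint; eauto.
- destruct H as (a & _ & H). exact (M1 a H).
- intros (q & _ & K). destruct H as (a & b & _ & _ & Hn & H). exact (not_single_and_pair q a b K Hn H).
- destruct H as (a & b & _ & _ & _ & H). exact (M2 a b H).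
- intros (a & _ & H). exact (M1 a H).
Qed.
End RoyalSets.

(** * The five cases *)

Section Classification.
Variables (om : C) (a b c : R) (D : C2 -> Prop).
Hypothesis Ho : circle om.
Hypothesis Ha : admissible a b c.
Hypothesis HD : forall x, D x <-> exists z : C, 0 < fst z /\ x = chart_curve om a b c z.
Variables (delta : datum C2) (z1 z2 : C) (r : R).
Hypothesis Hdp : data_param om a b c delta z1 z2 r.

Let E (x : C2) : Prop := closure D x /\ closure royal_variety x.

Lemma royal_intersection_root : 0 < a ->
  forall x, E x <-> x = end_point om (quad_root a b c) \/ (a < 1 /\ x = royal_point (Cconj om)).
Proof.
intros Hpos x. unfold E. rewrite (royal_intersection om a b c D Ho Ha HD x).
assert (Hd := nonneg_quadratic_discr a b c (proj1 (proj2 Ha))).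
split.
- intros [(z & Hz & Hq & ->)|H]; auto. left. f_equal. now apply quad_zero_iff.
- intros [->|H]; auto. left. exists (quad_root a b c).
  assert (Hr := quad_root_re a b c Hpos). split; auto. split; auto.
  now apply quad_zero_iff.
Qed.

Lemma quad_root_pos : 0 < a -> b ^ 2 < 4 * a * c -> 0 < fst (quad_root a b c).
Proof.
intros Hpos H. unfold quad_root. cbn [fst]. apply Rdiv_lt_0_compat; [|lra].
apply sqrt_lt_R0. lra.
Qed.

Lemma unique_maximizer_angle :
  (forall w, maximizer delta w -> w = om) ->
  exists t0, (forall w, maximizer delta w <-> w = expi t0) /\ expi t0 = om.
Proof.
intros H. destruct (circle_expi om Ho) as [t0 Et]. exists t0. split; [|auto].
intros w. rewrite <- Et. split; auto. intros ->.
apply (maximizer_om om a b c Ho Ha delta z1 z2 r Hdp).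
Qed.

Lemma expi_of_unique (t0 : R) : (forall w, maximizer delta w <-> w = expi t0) -> expi t0 = om.
Proof.
intros H. symmetry. apply H. apply (maximizer_om om a b c Ho Ha delta z1 z2 r Hdp).
Qed.

Lemma maximizer_cases (w : C) : maximizer delta w ->
  exists cs sn, cs ^ 2 + sn ^ 2 = 1 /\ w = (om * ((cs, sn) * (cs, sn)))%C /\
    (1 - a) * (sn ^ 2 * disc_form a b c cs sn) = 0.
Proof.
intros H. destruct (circle_square om w Ho (proj1 H)) as (cs & sn & Hu & ->).
exists cs, sn. split; [auto|split; [auto|]].
apply (maximizer_square om a b c Ho Ha delta z1 z2 r Hdp cs sn Hu). exact H.
Qed.

Lemma square_of_real (cs : R) : cs ^ 2 + 0 ^ 2 = 1 -> (om * ((cs, 0) * (cs, 0)))%C = om.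
Proof.
intros H. replace ((cs, 0) * (cs, 0))%C with (RtoC 1); [ring|].
apply injective_projections; simpl in *; lra.
Qed.

Lemma unique_maximizer : a < 1 ->
  (forall cs sn, sn <> 0 -> disc_form a b c cs sn <> 0) ->
  forall w, maximizer delta w -> w = om.
Proof.
intros Ha1 HN w Hw. destruct (maximizer_cases w Hw) as (cs & sn & Hu & -> & HE).
destruct (Req_dec sn 0) as [->|Hsn]; [now apply square_of_real|exfalso].
apply Rmult_integral in HE. destruct HE as [HE|HE]; [lra|].
apply Rmult_integral in HE. destruct HE as [HE|HE].
- apply (pow_nonzero sn 2) in Hsn. contradiction.
- exact (HN cs sn Hsn HE).
Qed.

Lemma all_maximizers_constant :
  (forall cs sn, (1 - a) * (sn ^ 2 * disc_form a b c cs sn) = 0) -> rho_constant delta.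
Proof.
intros H. apply (rho_constant_iff om a b c Ho Ha delta z1 z2 r Hdp).
intros w Hw. destruct (circle_square om w Ho Hw) as (cs & sn & Hu & ->).
apply (maximizer_square om a b c Ho Ha delta z1 z2 r Hdp cs sn Hu). auto.
Qed.

(** A unique maximizer must be [om], where [rho_second_derivative] fixes the value that separates
    purely unbalanced from exceptional data. If [rho] is constant, the points 1, -1 and [i] are
    three maximizers, one too many for the other types. *)
Lemma datum_types_exclusive :
  (purely_unbalanced delta -> ~ exceptional delta /\ ~ purely_balanced delta /\ ~ rho_constant delta) /\
  (exceptional delta -> ~ purely_balanced delta /\ ~ rho_constant delta) /\
  (purely_balanced delta -> ~ rho_constant delta).
Proof.
assert (C1 : circle (RtoC 1)) by (unfold circle; apply Cmod_1).
assert (C2 : circle (- (1))%C) by (unfold circle; rewrite Cmod_opp; apply Cmod_1).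
assert (C3 : circle Ci) by (unfold circle; apply Cmod_Ci).
assert (N12 : RtoC 1 <> (- (1))%C) by (intros F; apply (f_equal fst) in F; simpl in F; lra).
assert (N13 : RtoC 1 <> Ci) by (intros F; apply (f_equal fst) in F; simpl in F; lra).
assert (N23 : (- (1))%C <> Ci) by (intros F; apply (f_equal fst) in F; simpl in F; lra).
assert (Hall : rho_constant delta -> forall w, circle w -> maximizer delta w).
{ intros H. now apply (rho_constant_iff om a b c Ho Ha delta z1 z2 r Hdp). }
assert (U1 : forall t0, (forall w, maximizer delta w <-> w = expi t0) -> ~ rho_constant delta).
{ intros t0 H Hc. apply N12. transitivity (expi t0); [|symmetry]; apply H; auto. }
assert (U2 : forall t0, (forall w, maximizer delta w <-> w = expi t0) -> ~ purely_balanced delta).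
{ intros t0 H (w1 & w2 & Hn & Hw). apply Hn. transitivity (expi t0); [|symmetry]; apply H, Hw; auto. }
repeat split.
- intros (t1 & H1 & D1). destruct H as (t0 & H0 & D0).
  destruct (rho_second_derivative om a b c Ho Ha delta z1 z2 r Hdp) as (k & Hk & HK).
  rewrite HK in D0 by now apply expi_of_unique.
  rewrite HK in D1 by now apply expi_of_unique. lra.
- destruct H as (t0 & H0 & _). exact (U2 t0 H0).
- destruct H as (t0 & H0 & _). exact (U1 t0 H0).
- destruct H as (t0 & H0 & _). exact (U2 t0 H0).
- destruct H as (t0 & H0 & _). exact (U1 t0 H0).
- intros (w1 & w2 & _ & Hw) Hc. specialize (Hall Hc).
  destruct (proj1 (Hw _) (Hall _ C1)) as [E1|E1]; destruct (proj1 (Hw _) (Hall _ C2)) as [E2|E2];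
  destruct (proj1 (Hw _) (Hall _ C3)) as [E3|E3]; congruence.
Qed.

(** Flat and royal data both have constant [rho]; royal is ruled out because [p] attains [r] while
    [s / 2] stays strictly below it. *)
Lemma flat_case : a = 1 -> meets_in_once E /\ flat delta /\ ~ royal delta.
Proof.
intros Ea. assert (Hroot := royal_intersection_root ltac:(lra)).
assert (Hd := pos_quadratic_discr a b c ltac:(lra) (proj2 (proj2 Ha) Ea)).
assert (Hpos := quad_root_pos ltac:(lra) Hd).
pose proof Ha as Ha'. pose proof Hdp as Hdp'. rewrite Ea in Ha', Hdp'.
assert (Es := snd_flat_modulus om Ho delta z1 z2 r b c Ha' Hdp').
split; [|split].
- exists (end_point om (quad_root a b c)). split.
  + now apply (end_point_royal om Ho).
  + intros x. rewrite Hroot. split; [intros [H|[H _]]; [auto|lra]|auto].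
- split.
  + apply all_maximizers_constant. intros cs sn. rewrite Ea. ring.
  + apply (solves_Car_iff om 1 b c Ho Ha' delta z1 z2 r _ _ Hdp' snd_holomorphic Es).
    split; [apply snd_holomorphic|exact Es].
- intros [_ H]. apply (solves_Car_iff om 1 b c Ho Ha' delta z1 z2 r _ _ Hdp' snd_holomorphic Es) in H.
  destruct H as [_ H]. assert (F := fst_flat_modulus om Ho delta z1 z2 r b c Ha' Hdp').
  rewrite H in F. lra.
Qed.

Lemma royal_case : a = 0 -> b = 0 -> c = 0 -> contains_royal E /\ royal delta /\ ~ flat delta.
Proof.
intros Ea Eb Ec.
pose proof Ha as Ha'. pose proof Hdp as Hdp'. pose proof HD as HD'.
rewrite Ea, Eb, Ec in Ha', Hdp', HD'.
assert (Es := fst_royal_modulus om Ho delta z1 z2 r Ha' Hdp').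
split; [|split].
- intros x. unfold E. rewrite (royal_intersection om 0 0 0 D Ho Ha' HD' x), closure_royal. split.
  + intros [(z & Hz & _ & ->)|[_ ->]].
    * exists (Cconj om * cayley z)%C. split; [|reflexivity]. rewrite Cmod_mult, Cmod_conj, Ho.
      destruct (Rle_lt_or_eq_dec _ _ Hz) as [H|H].
      -- generalize (cayley_lt z H). lra.
      -- rewrite cayley_eq by auto. lra.
    * exists (Cconj om). split; [|reflexivity]. rewrite Cmod_conj, Ho. lra.
  + intros (w & Hw & ->).
    set (y := (om * w)%C).
    assert (Ew : w = (Cconj om * y)%C).
    { unfold y. rewrite Cmult_assoc, circle_conj by auto. ring. }
    assert (Hy : Cmod y <= 1) by (unfold y; rewrite Cmod_mult, Ho; lra).
    destruct (excluded_middle_informative (y = RtoC 1)) as [E1|E1].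
    * right. split; [lra|]. rewrite Ew, E1. f_equal. ring.
    * left. destruct (cayley_surj y Hy E1) as (z & Hz & Ez & _).
      exists z. split; [auto|split; [apply quad_0|]]. unfold end_point. rewrite Ez, <- Ew. reflexivity.
- split.
  + apply all_maximizers_constant. intros cs sn. unfold disc_form. rewrite Ea, Eb, Ec. ring.
  + apply (solves_Car_iff om 0 0 0 Ho Ha' delta z1 z2 r _ _ Hdp' fst_half_holomorphic Es).
    split; [apply fst_half_holomorphic|exact Es].
- intros [_ H]. apply (solves_Car_iff om 0 0 0 Ho Ha' delta z1 z2 r _ _ Hdp' fst_half_holomorphic Es) in H.
  destruct H as [_ H]. assert (F := snd_royal_modulus om Ho delta z1 z2 r Ha' Hdp').
  rewrite H in F. lra.
Qed.

Lemma exceptional_case : a = 0 -> b = 0 -> 0 < c -> meets_boundary_once E /\ exceptional delta.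
Proof.
intros Ea Eb Hc. split.
- exists (royal_point (Cconj om)). split; [now apply infinite_point_boundary|].
  intros x. unfold E. rewrite (royal_intersection om a b c D Ho Ha HD x). split.
  + intros [(z & _ & Hq & _)|[_ ->]]; auto. exfalso.
    apply (f_equal fst) in Hq. destruct (quad_parts a b c z) as [P _]. rewrite P, Ea, Eb in Hq.
    simpl in Hq. lra.
  + intros ->. right. split; [lra|auto].
- destruct unique_maximizer_angle as (t0 & H0 & Et).
  + apply unique_maximizer; [lra|]. intros cs sn Hsn. unfold disc_form. rewrite Ea, Eb.
    assert (0 < sn ^ 2) by (apply pow2_gt_0; auto). nra.
  + exists t0. split; auto.
    destruct (rho_second_derivative om a b c Ho Ha delta z1 z2 r Hdp) as (k & Hk & HK).
    rewrite HK, Ea by auto. ring.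
Qed.

Lemma unbalanced_case : 0 < a < 1 -> b ^ 2 < 4 * a * c ->
  meets_in_and_boundary E /\ purely_unbalanced delta.
Proof.
intros [Ha0 Ha1] Hd. split.
- assert (Hpos := quad_root_pos Ha0 Hd).
  exists (end_point om (quad_root a b c)), (royal_point (Cconj om)).
  split; [now apply (end_point_royal om Ho)|]. split; [now apply infinite_point_boundary|].
  split; [apply end_point_neq; auto; lra|].
  intros x. rewrite (royal_intersection_root Ha0 x). tauto.
- destruct unique_maximizer_angle as (t0 & H0 & Et).
  + apply unique_maximizer; [lra|]. intros cs sn Hsn. unfold disc_form. intros F.
    assert (0 < sn ^ 2) by (apply pow2_gt_0; auto).
    assert (F2 : (2 * a * cs - b * sn) ^ 2 + (4 * a * c - b ^ 2) * sn ^ 2 = 0).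
    { replace ((2 * a * cs - b * sn) ^ 2 + (4 * a * c - b ^ 2) * sn ^ 2) with
        (4 * a * (a * cs ^ 2 - b * cs * sn + c * sn ^ 2)) by ring. rewrite F. ring. }
    generalize (pow2_ge_0 (2 * a * cs - b * sn)).
    assert (0 < (4 * a * c - b ^ 2) * sn ^ 2) by (apply Rmult_lt_0_compat; lra). lra.
  + exists t0. split; auto.
    destruct (rho_second_derivative om a b c Ho Ha delta z1 z2 r Hdp) as (k & Hk & HK).
    rewrite HK by auto.
    assert (0 < k * ((1 - a) * a)); [|lra].
    apply Rmult_lt_0_compat; auto. apply Rmult_lt_0_compat; lra.
Qed.

Lemma balanced_case : 0 < a < 1 -> b ^ 2 = 4 * a * c ->
  meets_boundary_twice E /\ purely_balanced delta.
Proof.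
intros [Ha0 Ha1] Hd. split.
- assert (Hz : fst (quad_root a b c) = 0).
  { unfold quad_root. cbn [fst]. rewrite Hd, Rminus_diag, sqrt_0. unfold Rdiv. ring. }
  exists (end_point om (quad_root a b c)), (royal_point (Cconj om)).
  split; [now apply (end_point_boundary om Ho)|]. split; [now apply infinite_point_boundary|].
  split; [apply end_point_neq; auto; lra|].
  intros x. rewrite (royal_intersection_root Ha0 x). tauto.
- assert (Hh : 0 < b ^ 2 + 4 * a ^ 2) by nra.
  (* When [b^2 = 4 a c], [4 a] times [disc_form] is the square of [2 a cs - b sn]. The remaining
     direction is thus [(cs, sn)] proportional to [(b, 2 a)], and [v2] is
     [(b + 2 a i)^2 / (b^2 + 4 a^2)], its square after normalization. *)
  set (v2 := ((b ^ 2 - 4 * a ^ 2) / (b ^ 2 + 4 * a ^ 2), 4 * a * b / (b ^ 2 + 4 * a ^ 2)) : C).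
  set (w2 := (om * v2)%C).
  assert (Hsq : forall cs sn, cs ^ 2 + sn ^ 2 = 1 -> 2 * a * cs = b * sn ->
    (om * ((cs, sn) * (cs, sn)))%C = w2).
  { intros cs sn Hu HE. unfold w2. f_equal. unfold v2.
    assert (E1 : cs = b * sn / (2 * a)) by (rewrite <- HE; field; lra).
    assert (E2 : sn ^ 2 = 4 * a ^ 2 / (b ^ 2 + 4 * a ^ 2)).
    { apply Rmult_eq_reg_r with ((b ^ 2 + 4 * a ^ 2) / (4 * a ^ 2)).
      - replace (sn ^ 2 * ((b ^ 2 + 4 * a ^ 2) / (4 * a ^ 2))) with (cs ^ 2 + sn ^ 2) by (rewrite E1; field; lra).
        rewrite Hu. field. split; nra.
      - apply Rgt_not_eq. apply Rdiv_lt_0_compat; nra. }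
    apply injective_projections; cbn [fst snd Cmult].
    - replace (cs * cs - sn * sn) with (sn ^ 2 * (b ^ 2 / (4 * a ^ 2) - 1)) by (rewrite E1; field; lra).
      rewrite E2. field. split; nra.
    - replace (cs * sn + sn * cs) with (sn ^ 2 * (b / a)) by (rewrite E1; field; lra).
      rewrite E2. field. split; nra. }
  exists om, w2. split.
  + intros F.
    assert (G : v2 = RtoC 1).
    { assert (Hn := circle_neq om Ho).
      transitivity (w2 / om)%C; [unfold w2; field; auto|]. rewrite <- F. field. auto. }
    apply (f_equal fst) in G. unfold v2 in G. cbn [fst] in G.
    assert (G2 : b ^ 2 - 4 * a ^ 2 = b ^ 2 + 4 * a ^ 2).
    { replace (b ^ 2 - 4 * a ^ 2) with ((b ^ 2 - 4 * a ^ 2) / (b ^ 2 + 4 * a ^ 2) * (b ^ 2 + 4 * a ^ 2)) by (field; lra).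
      change (fst (RtoC 1)) with 1 in G. rewrite G. ring. }
    nra.
  + intros w. split.
    * intros Hw. destruct (maximizer_cases w Hw) as (cs & sn & Hu & -> & HE).
      destruct (Req_dec sn 0) as [->|Hsn]; [left; now apply square_of_real|right].
      apply Hsq; auto.
      apply Rmult_integral in HE. destruct HE as [HE|HE]; [lra|].
      apply Rmult_integral in HE. destruct HE as [HE|HE].
      { exfalso. apply (pow_nonzero sn 2) in Hsn. contradiction. }
      unfold disc_form in HE.
      assert (F2 : (2 * a * cs - b * sn) ^ 2 = 0).
      { replace ((2 * a * cs - b * sn) ^ 2) with
        (4 * a * (a * cs ^ 2 - b * cs * sn + c * sn ^ 2) + (b ^ 2 - 4 * a * c) * sn ^ 2) by ring.
        rewrite HE, Hd. ring. }
      nra.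
    * intros [->| ->]; [apply (maximizer_om om a b c Ho Ha delta z1 z2 r Hdp)|].
      set (h := sqrt (b ^ 2 + 4 * a ^ 2)).
      assert (Hh2 : h * h = b ^ 2 + 4 * a ^ 2) by (apply sqrt_sqrt; lra).
      assert (Hhp : 0 < h) by now apply sqrt_lt_R0.
      assert (Hu : (b / h) ^ 2 + (2 * a / h) ^ 2 = 1).
      { replace ((b / h) ^ 2 + (2 * a / h) ^ 2) with ((b ^ 2 + 4 * a ^ 2) / (h * h)) by (field; lra).
        rewrite Hh2. field. lra. }
      rewrite <- (Hsq (b / h) (2 * a / h) Hu) by (field; lra).
      apply (maximizer_square om a b c Ho Ha delta z1 z2 r Hdp _ _ Hu).
      unfold disc_form.
      replace (a * (b / h) ^ 2 - b * (b / h) * (2 * a / h) + c * (2 * a / h) ^ 2)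
        with (a * (4 * a * c - b ^ 2) / h ^ 2) by (field; lra).
      rewrite Hd. field. lra.
Qed.

Lemma classification :
  (meets_in_and_boundary E /\ purely_unbalanced delta) \/
  (meets_boundary_once E /\ exceptional delta) \/
  (meets_boundary_twice E /\ purely_balanced delta) \/
  (meets_in_once E /\ (flat delta /\ ~ royal delta)) \/
  (contains_royal E /\ (royal delta /\ ~ flat delta)).
Proof.
assert (HN := proj1 (proj2 Ha)). assert (Hd := nonneg_quadratic_discr a b c HN).
destruct Ha as ([Ha0 Ha1] & _).
destruct (Req_dec a 1) as [E1|N1]; [do 3 right; left; now apply flat_case|].
destruct (Req_dec a 0) as [E0|N0].
(* At [a = 0] the discriminant inequality [b^2 <= 4 a c] leaves only [b = 0]. *)
- assert (Hb : b = 0) by (rewrite E0 in Hd; nra).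
  assert (Hc : 0 <= c) by (specialize (HN 0); lra).
  destruct (Req_dec c 0) as [Ec|Nc].
  + do 4 right. now apply royal_case.
  + right; left. apply exceptional_case; auto. lra.
- destruct (Req_dec (b ^ 2) (4 * a * c)) as [Eb|Nb].
  + do 2 right; left. apply balanced_case; auto. lra.
  + left. apply unbalanced_case; lra.
Qed.
End Classification.

Lemma data_param_of_contacts (om : C) (a b c : R) (D : C2 -> Prop) (delta : datum C2) :
  circle om -> admissible a b c ->
  (forall x, D x <-> exists z : C, 0 < fst z /\ x = chart_curve om a b c z) ->
  datum_in symbidisc delta -> nondegenerate delta -> contacts delta D ->
  exists z1 z2 r, data_param om a b c delta z1 z2 r.
Proof.
intros Ho Ha HD Hin Hnd Hc.
destruct (contacts_param om a b c D Ho Ha HD delta Hin Hnd Hc)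
  as [(z1 & z2 & H1 & H2 & Hn & E)|(z & l & Hz & Hl & E)].
- exists z1, z2, (Cmod (z1 - z2) / Cmod (z1 + Cconj z2)).
  split; [auto|split; [auto|split; [|auto]]].
  apply Rdiv_lt_0_compat; apply Cmod_gt_0.
  + intros F. apply Hn. replace z1 with ((z1 - z2) + z2)%C by ring. rewrite F. ring.
  + now apply hp_sum_neq.
- exists z, z, (Cmod l / (2 * fst z)).
  split; [auto|split; [auto|split]].
  + apply Rdiv_lt_0_compat; [now apply Cmod_gt_0|lra].
  + right. split; auto. exists l. auto.
Qed.

Theorem theorem7p1 :
  forall (delta : datum C2) (D : C2 -> Prop),
    datum_in symbidisc delta ->
    nondegenerate delta ->
    complex_geodesic D ->
    contacts delta D ->
    let E := fun x : C2 => closure D x /\ closure royal_variety x in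
    ((exists a b : C2, royal_variety a /\ royal_boundary b /\ a <> b /\
        forall x, E x <-> x = a \/ x = b)
       <-> purely_unbalanced delta) /\
    ((exists a : C2, royal_boundary a /\ forall x, E x <-> x = a)
       <-> exceptional delta) /\
    ((exists a b : C2, royal_boundary a /\ royal_boundary b /\ a <> b /\
        forall x, E x <-> x = a \/ x = b)
       <-> purely_balanced delta) /\
    ((exists a : C2, royal_variety a /\ forall x, E x <-> x = a)
       <-> flat delta) /\
    ((forall x, E x <-> closure royal_variety x)
       <-> royal delta).
Proof.
intros delta D Hin Hnd HG Hc E.
destruct (geodesic_normal_form D HG) as (om & a & b & c & Ho & Ha & HD).
destruct (data_param_of_contacts om a b c D delta Ho Ha HD Hin Hnd Hc) as (z1 & z2 & r & Hdp).
destruct (royal_sets_exclusive E) as (X1 & X2 & X3 & X4).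
destruct (datum_types_exclusive om a b c Ho Ha delta z1 z2 r Hdp) as (Y1 & Y2 & Y3).
assert (K := classification om a b c D Ho Ha HD delta z1 z2 r Hdp). fold E in K.
change ((meets_in_and_boundary E <-> purely_unbalanced delta) /\
  (meets_boundary_once E <-> exceptional delta) /\
  (meets_boundary_twice E <-> purely_balanced delta) /\
  (meets_in_once E <-> flat delta) /\ (contains_royal E <-> royal delta)).
assert (Hf : flat delta -> rho_constant delta) by apply proj1.
assert (Hr : royal delta -> rho_constant delta) by apply proj1.
(* Both types share [rho_constant], so [datum_types_exclusive] does not separate them. In the flat
   and royal cases [K] carries the negation of the other type; in the remaining three, constancy of
   [rho] is already contradictory. *)
assert (Hfr : flat delta -> royal delta -> False).
{ intros F R. destruct K as [[_ K]|[[_ K]|[[_ K]|[[_ K]|[_ K]]]]]; try tauto. }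
apply iff_of_exclusive_cases; tauto.
Qed.
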